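(* Let $\lambda>0$, $v>0$. Let $\Phi=\{X_i\}$ be a homogeneous Poisson point process on $\mathbb R^2$ of intensity $\lambda$, $(\Theta_i)$ i.i.d. uniform on $[-\pi,\pi)$ independent of $\Phi$, and let station $i$ be at $X_i+vt(\cos\Theta_i,\sin\Theta_i)$ at time $t\in\mathbb R$. Then the intensity of the handover point process $\mathcal V$ (the handover frequency) is $\lambda_{\mathcal V}=\frac{4v\sqrt\lambda}{\pi}$.
   Context: A user at the origin is served at each time by the closest station. A handover epoch is a time $t$ at which two stations are at the same distance from the origin and no station is strictly closer; $\mathcal V$ is the point process on $\mathbb R$ of handover epochs, which is stationary, and its intensity is the expected number of handover epochs in $[0,1]$. *)

(* Defs.v *)
From mathcomp Require Import all_boot all_order all_algebra.
From mathcomp Require Import all_classical all_reals all_analysis.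
Import Order.TTheory GRing.Theory Num.Theory.

Set Implicit Arguments.
Unset Strict Implicit.
Unset Printing Implicit Defensive.

Local Open Scope classical_set_scope.
Local Open Scope ring_scope.

Section Handover.
Context {R : realType}.

Definition Leb2 := ((@lebesgue_measure R) \x (@lebesgue_measure R))%E.

Definition enorm2 (p : R * R) : R := Num.sqrt (p.1 ^+ 2 + p.2 ^+ 2).

Definition poisson_mass (m : R) (n : nat) : R := expR (- m) * m ^+ n / (n`!)%:R.

Context {d : measure_display} {T : measurableType d}.

Definition count_eq (X : nat -> T -> R * R) (B : set (R * R)) (n : nat) : set T :=
  [set w | exists s : seq nat,
     [/\ uniq s, size s = n & forall i, (i \in s) <-> B (X i w)]].

Definition is_homogeneous_PPP (P : probability T R) (X : nat -> T -> R * R)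
    (lam : R) : Prop :=
  (forall i, measurable_fun setT (X i)) /\
  forall (k : nat) (B : 'I_k -> set (R * R)) (n : 'I_k -> nat),
    (forall j, measurable (B j)) ->
    (forall j, (Leb2 (B j) < +oo)%E) ->
    (forall j j', j != j' -> B j `&` B j' = set0) ->
    P (\bigcap_(j in [set: 'I_k]) count_eq X (B j) (n j)) =
    (\prod_(j < k) poisson_mass (lam * fine (Leb2 (B j))) (n j))%:E.

Definition sigma_of_points (X : nat -> T -> R * R) : set (set T) :=
  <<s \bigcup_(i in [set: nat]) [set X i @^-1` B | B in @measurable _ (R * R)%type] >>.

Definition iid_uniform_marks_indep (P : probability T R)
    (X : nat -> T -> R * R) (Th : nat -> T -> R) : Prop :=
  (forall i, measurable_fun setT (Th i)) /\
  forall (E : set T) (s : seq nat) (A : nat -> set R),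
    uniq s -> sigma_of_points X E -> (forall i, measurable (A i)) ->
    P (E `&` \bigcap_(i in [set i | i \in s]) (Th i @^-1` A i)) =
    (P E * \prod_(i <- s)
       (lebesgue_measure (A i `&` `[(- pi)%R, pi%R[) / (2 * pi)%:E))%E.

Definition station (X : nat -> T -> R * R) (Th : nat -> T -> R) (v : R)
    (i : nat) (w : T) (t : R) : R * R :=
  ((X i w).1 + v * t * cos (Th i w), (X i w).2 + v * t * sin (Th i w)).

Definition handover_epoch (X : nat -> T -> R * R) (Th : nat -> T -> R) (v : R)
    (w : T) (t : R) : Prop :=
  exists i j, i != j /\
    enorm2 (station X Th v i w t) = enorm2 (station X Th v j w t) /\
    forall k, enorm2 (station X Th v i w t) <= enorm2 (station X Th v k w t).

Definition handover_count (X : nat -> T -> R * R) (Th : nat -> T -> R) (v : R)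
    (w : T) : \bar R :=
  \esum_(t in [set t : R | 0 <= t <= 1 /\ handover_epoch X Th v w t]) 1%E.

End Handover.

(* Main.v *)
Require Import Defs.
From HB Require Import structures.
From mathcomp Require Import all_boot all_order all_algebra.
From mathcomp Require Import all_classical all_reals all_analysis.
From mathcomp Require Import measurable_realfun ring lra.
Import Order.TTheory GRing.Theory Num.Theory.
Import numFieldNormedType.Exports.
Set Implicit Arguments.
Unset Strict Implicit.
Unset Printing Implicit Defensive.
Local Open Scope classical_set_scope.
Local Open Scope ring_scope.

(** Up to the common term [v^2 t^2], the squared distance of station [i] to the
    origin is an affine function of [t], so the handovers are the break points of
    the lower envelope of countably many lines.  Almost surely no two stations tie
    at a dyadic time, and then the number of handovers in [0,1] is the limit of the
    number of [k < 2^n] such that no station is closest both at [k/2^n] and at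
    [(k+1)/2^n].  Two consecutive dyadic times at distance [h] contribute
    [1 - J(h)], where [J(h)], the probability that one station wins at both times,
    is [int lam * exp (- lam * mu (below y)) dmu(y)] with [below y] the stations
    that beat [y] at one of the two times: this comes from discretising the pairs
    of squared distances and from the void probabilities of the marked process.
    By translation invariance, under [mu] the pair of squared distances has the
    law of [(a, a + 2 v h sqrt(a) cos u + (v h)^2)], with [a] Lebesgue on [0,oo[
    (times [pi]) and [u] uniform on [0,pi].  Hence [mu (below y)] is
    [pi * (a + 2 v h sqrt(a) E(cos u - cos u')^+)] up to [O(h^2)], and since
    [E(cos u - cos u')^+ = 4/pi^2], [1 - J(h)] is [4 v sqrt(lam)/pi * h + O(h^2)]. *)

(** * Measures on the line and the plane *)

(** The hypotheses give only the joint law of the counts in finitely many disjoint sets of finite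
    measure, so the winner is found through void probabilities instead of a Palm formula. A grid
    cell that is hit while its set of better stations is empty is a difference of two void events,
    of probability [exp (- a) (1 - exp (- c))], where [c] vanishes with the mesh; summing over cells
    gives [J(h)]. The void probabilities of the marked points come from limits of E prod (1 -
    g(X_i)): step functions [g] reduce to Poisson counts, and the marks are averaged out one at a
    time.

    The error [O(h^2)] has to be uniform in time, since it is summed over [2^n] steps of length
    [2^-n]. The constant is a product: with [k = lam * pi], the first-order term is
    [2 k v h (4 / pi^2) E sqrt a], where [a] is exponential of rate [k] and
    [E sqrt a = sqrt pi / (2 sqrt k)].

    Neither finiteness nor measurability of the number of handovers is given. It is replaced off a
    null set by a lower limit of dyadic counts; Fatou bounds its mean from above, and each dyadic
    count bounds it from below. *)

Section image_measure.
Context d1 d2 (T1 : measurableType d1) (T2 : measurableType d2) (R : realType).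
Variables (m : {measure set T1 -> \bar R}) (f : T1 -> T2).
Hypothesis mf : measurable_fun [set: T1] f.

(* Unlike the instance on [pushforward], this one carries the proof [mf], so that
   it is found by unification. *)
Definition image_measure of measurable_fun [set: T1] f := pushforward m f.

HB.instance Definition _ := isMeasure.Build _ _ _ (image_measure mf)
  (@measure0 _ _ _ (measure_function_pushforward__canonical__measure_function_Measure m mf))
  (@measure_ge0 _ _ _ (measure_function_pushforward__canonical__measure_function_Measure m mf))
  (@measure_semi_sigma_additive _ _ _ (measure_function_pushforward__canonical__measure_function_Measure m mf)).

Lemma ge0_integral_image_measure (g : T2 -> \bar R) :
  measurable_fun [set: T2] g -> (forall y, 0 <= g y)%E ->
  (\int[image_measure mf]_y g y = \int[m]_x g (f x))%E.
Proof. by move=> mg g0; rewrite ge0_integral_pushforward. Qed.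

End image_measure.

Section measurable_comp.
Context d (T : measurableType d) {R : realType}.
Implicit Types (D : set T) (f : T -> R).

Lemma measurable_funsqrt D f :
  measurable_fun D f -> measurable_fun D (fun x => Num.sqrt (f x)).
Proof.
exact: (measurableT_comp (continuous_measurable_fun (@sqrt_continuous R))).
Qed.

Lemma measurable_funcos D f :
  measurable_fun D f -> measurable_fun D (fun x => cos (f x)).
Proof.
exact: (measurableT_comp (continuous_measurable_fun (@continuous_cos R))).
Qed.

Lemma measurable_funsin D f :
  measurable_fun D f -> measurable_fun D (fun x => sin (f x)).
Proof.
exact: (measurableT_comp (continuous_measurable_fun (@continuous_sin R))).
Qed.

End measurable_comp.

Section Bridge.
Context {R : realType}.
Local Open Scope ereal_scope.

(* The library measures live on [measurableTypeR R], whose display differs from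
   the one of [R] used in [is_homogeneous_PPP]; these copies live on [R]. *)
Definition lebR : set R -> \bar R := @lebesgue_measure R.

HB.instance Definition _ := isMeasure.Build _ R _ lebR
  (@measure0 _ _ _ (@lebesgue_measure R))
  (@measure_ge0 _ _ _ (@lebesgue_measure R))
  (@measure_semi_sigma_additive _ _ _ (@lebesgue_measure R)).

Lemma lebR_sigma_finite : sigma_finite setT lebR.
Proof. exact: (sigma_finiteT (@lebesgue_measure R)). Qed.

HB.instance Definition _ := Measure_isSigmaFinite.Build _ _ _ lebR
  lebR_sigma_finite.

Definition unif (a b : R) (ab : (a < b)%R) : set R -> \bar R := uniform_prob ab.

Section unif.
Variables (a b : R) (ab : (a < b)%R).

HB.instance Definition _ := isMeasure.Build _ R _ (unif ab)
  (@measure0 _ _ _ (uniform_prob ab))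
  (@measure_ge0 _ _ _ (uniform_prob ab))
  (@measure_semi_sigma_additive _ _ _ (uniform_prob ab)).

HB.instance Definition _ := @Measure_isProbability.Build _ _ R
  (unif ab) (@probability_setT _ _ _ (uniform_prob ab)).
End unif.

Let idR : measurableTypeR R -> R := idfun.

Let midR : measurable_fun [set: measurableTypeR R] idR.
Proof. by move=> _ A mA; rewrite setTI. Qed.

Lemma integral_lebR (D : set R) (f : R -> \bar R) :
  measurable D -> measurable_fun D f -> (forall x, 0 <= f x) ->
  \int[lebR]_(x in D) f x = \int[lebesgue_measure]_(x in D) f x.
Proof.
move=> mD mf f0.
by rewrite -(@ge0_integral_pushforward _ _ _ _ _ idR midR lebesgue_measure D f)//.
Qed.

Lemma integral_unif (a b : R) (ab : (a < b)%R) (f : R -> \bar R) :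
  measurable_fun [set: R] f -> (forall x, 0 <= f x) ->
  \int[unif ab]_x f x = (b - a)^-1%:E * \int[lebR]_(x in `[a, b]) f x.
Proof.
move=> mf f0; rewrite integral_lebR//; last exact: measurable_funTS.
rewrite -(integral_uniform ab)//.
by rewrite -(@ge0_integral_pushforward _ _ _ _ _ idR midR (uniform_prob ab) setT f)//.
Qed.

Lemma lebR_itv (i : interval R) : lebR [set` i] = lebesgue_measure [set` i].
Proof. by []. Qed.

(** Each change of variable below (shift, reflection, scaling, squared norm) is reduced by this
    lemma to the lengths of half-open intervals. *)
Lemma lebR_unique (mu : {measure set R -> \bar R}) :
  (forall a b : R, (a <= b)%R -> mu `]a, b]%classic = (b - a)%:E) ->
  forall A, measurable A -> lebR A = mu A.
Proof.
move=> h A mA.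
pose m : set (measurableTypeR R) -> \bar R := fun A => mu A.
pose mm := isMeasure.Build _ (measurableTypeR R) _ m
  (@measure0 _ _ _ mu) (@measure_ge0 _ _ _ mu)
  (@measure_semi_sigma_additive _ _ _ mu).
pose M : {measure set (measurableTypeR R) -> \bar R} := HB.pack m mm.
suff hM X : ocitv X -> lebesgue_measure X = M X.
  exact: (@lebesgue_measure_unique R M hM A mA).
move=> [[a b]] _ <-.
rewrite /M/= /m lebesgue_measure_itv/= lte_fin.
have [ab|ba] := ltP a b; first by rewrite h ?ltW.
by rewrite set_itv_ge ?measure0//= bnd_simp -leNgt.
Qed.

Definition leb2 : set (R * R) -> \bar R := lebR \x lebR.

HB.instance Definition _ := isMeasure.Build _ (R * R)%type _ leb2
  (@measure0 _ _ _ (lebR \x lebR))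
  (@measure_ge0 _ _ _ (lebR \x lebR))
  (@measure_semi_sigma_additive _ _ _ (lebR \x lebR)).

Lemma leb2_sigma_finite : sigma_finite setT leb2.
Proof.
have /sigma_finiteP[F [FT Fnd Foo]] := sigma_finiteT (@lebR).
exists (fun n => F n `*` F n).
  apply/seteqP; split=> -[x y] // _.
  have : [set: R] x by []. have : [set: R] y by [].
  rewrite FT => -[n _ Fny] [m _ Fmx]; exists (maxn m n) => //; split => /=.
    by move: x Fmx; apply/subsetPset/Fnd/leq_maxl.
  by move: y Fny; apply/subsetPset/Fnd/leq_maxr.
move=> n; have [mF Fn] := Foo n; split; first exact: measurableX.
by rewrite /leb2 product_measure1E// lte_mul_pinfty// ge0_fin_numE.
Qed.

HB.instance Definition _ := Measure_isSigmaFinite.Build _ _ _ leb2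
  leb2_sigma_finite.

Lemma fubini_leb2 (f : R * R -> \bar R) :
  measurable_fun [set: R * R] f -> (forall x, 0 <= f x) ->
  \int[leb2]_z f z = \int[lebR]_x \int[lebR]_y f (x, y).
Proof. exact: fubini_tonelli1. Qed.

Lemma Leb2E (B : set (R * R)) : measurable B -> Leb2 B = leb2 B.
Proof.
move=> mB; rewrite /Leb2 /leb2 /product_measure1 integral_lebR//.
exact: (@measurable_fun_xsection _ _ _ _ _ lebR).
Qed.

End Bridge.

Section Geometry.
Context {R : realType}.
Local Open Scope ereal_scope.

Lemma ge0_integral_shift (c : R) (f : R -> \bar R) :
  measurable_fun [set: R] f -> (forall x, 0 <= f x) ->
  \int[lebR]_x f (x + c)%R = \int[lebR]_x f x.
Proof.
move=> mf f0.
pose s (x : R) := (x + c)%R.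
have ms : measurable_fun [set: R] s by apply: measurable_funD.
rewrite -(@ge0_integral_pushforward _ _ _ _ _ s ms lebR setT f)//=.
apply: eq_measure_integral => A mA _ /=.
apply/esym/lebR_unique => // a b ab.
transitivity (lebR [set` `](a - c)%R, (b - c)%R]%R]).
  congr (lebR _).
  by apply/seteqP; split=> x /=; rewrite /s !in_itv/= ltrBlDr lerBrDr.
rewrite lebR_itv lebesgue_measure_itv/= lte_fin ltrD2r.
case: ltgtP ab => // [ab|->] _; last by rewrite subrr.
by rewrite -EFinB; congr (_%:E); ring.
Qed.

Lemma ge0_integral_leb2_shift (c : R * R) (F : R * R -> \bar R) :
  measurable_fun [set: R * R] F -> (forall x, 0 <= F x) ->
  \int[leb2]_x F (x.1 + c.1, x.2 + c.2)%R = \int[leb2]_x F x.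
Proof.
move=> mF F0; rewrite !fubini_leb2//; last first.
  by apply: measurableT_comp => //; apply/measurable_fun_pairP; split;
    apply: measurable_funD.
rewrite -[RHS](ge0_integral_shift c.1)//=; last 2 first.
- exact: measurable_fun_fubini_tonelli_F.
- by move=> x; exact: integral_ge0.
apply: eq_integral => x _.
rewrite -[RHS](ge0_integral_shift c.2)//=.
exact: measurableT_comp.
Qed.

End Geometry.

(** * Discs and polar angles *)

Section Disc.
Context {R : realType}.
Local Open Scope ereal_scope.

Lemma integral_FTC (F f : R -> R) (a b : R) : (a <= b)%R -> continuous f ->
  (forall x, is_derive x (1%R : R) F (f x)) ->
  \int[lebesgue_measure]_(x in `[a, b]) (f x)%:E = (F b - F a)%:E.
Proof.
rewrite le_eqVlt => /predU1P[<- _ _|ab cf dF].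
  by rewrite set_itv1 integral_set1 subrr.
have cF : continuous F.
  move=> x; apply/differentiable_continuous/derivable1_diffP.
  by have [] := dF x.
rewrite (@continuous_FTC2 R f F a b)//.
- exact: continuous_subspaceT.
- split; first by move=> x _; have [] := dF x.
    exact/cvg_at_right_filter/cF.
  exact/cvg_at_left_filter/cF.
- by move=> x _; rewrite derive1E; exact: derive_val.
Qed.

(** Substitution [x = r sin t]; then [2 r^2 cos^2 t] has the primitive [r^2 (t + sin t cos t)]. The
    integrand is the length of a vertical chord of the disc of radius [r]. *)
Lemma integral_half_disc (r : R) : (0 < r)%R ->
  \int[lebesgue_measure]_(x in `[(- r)%R, r]) (2 * Num.sqrt (r ^+ 2 - x ^+ 2))%:E
  = (pi * r ^+ 2)%:E.
Proof.
move=> r0; pose F (t : R) := (r * sin t)%R.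
have dF (t : R) : is_derive t (1%R : R) F (r * cos t)%R.
  exact: (@is_deriveZ _ _ _ sin).
have F' : F^`()%classic = fun t : R => (r * cos t)%R.
  by apply/funext => t; rewrite derive1E derive_val.
have cF : continuous F.
  move=> x; apply/differentiable_continuous/derivable1_diffP.
  by have [] := dF x.
have cF' : continuous (fun t : R => r * cos t)%R.
  by move=> t; apply: cvgM; [exact: cvg_cst|exact: continuous_cos].
have pi2 : (- (pi / 2) <= pi / 2 :> R)%R by have := pi_gt0 R; lra.
have -> : `[(- r)%R, r]%classic = `[F (- (pi / 2))%R, F (pi / 2)%R]%classic.
  by rewrite /F sinN sin_pihalf mulrN mulr1.
rewrite integration_by_substitution_increasing//.
- rewrite F'.
  transitivity (\int[lebesgue_measure]_(x in `[(- (pi / 2))%R, (pi / 2)%R])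
                   ((2 * r ^+ 2 * cos x ^+ 2)%:E : \bar R)).
    apply: eq_integral => t /[!inE]/=; rewrite in_itv/= => tI.
    rewrite !fctE /F; congr (_%:E).
    have c0 := cos_ge0_pihalf tI.
    rewrite (_ : r ^+ 2 - _ = (r * cos t) ^+ 2)%R; last first.
      by rewrite !exprMn cos2sin2; ring.
    rewrite sqrtr_sqr ger0_norm; first by ring.
    by rewrite mulr_ge0// ltW.
  have dG (t : R) : is_derive t (1%R : R) (fun t => r ^+ 2 * (t + sin t * cos t))%R
      (2 * r ^+ 2 * cos t ^+ 2)%R.
    have d1 := @is_deriveM _ _ _ _ t 1%R _ _ (is_derive_sin t) (is_derive_cos t).
    have d2 := @is_deriveZ _ _ _ _ (r ^+ 2)%R t 1%R _
      (is_deriveD (is_derive_id t 1%R) d1).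
    apply: (is_derive_eq d2); rewrite /GRing.scale/= mulrN -!expr2.
    by rewrite sin2cos2; ring.
  rewrite (@integral_FTC _ _ _ _ pi2 _ dG).
    by rewrite sinN cosN sin_pihalf cos_pihalf; congr (_%:E); field.
  move=> t; apply: cvgM; first exact: cvg_cst.
  by apply: cvgM; exact: continuous_cos.
- by move=> x y xI yI xy; rewrite /F ltr_pM2l// ltr_sin.
- by rewrite F' => x _; exact: cF'.
- by rewrite F'; apply/cvg_ex; eexists; apply: cvg_at_right_filter; exact: cF'.
- by rewrite F'; apply/cvg_ex; eexists; apply: cvg_at_left_filter; exact: cF'.
- split; first by move=> x _; have [] := dF x.
    exact/cvg_at_right_filter/cF.
  exact/cvg_at_left_filter/cF.
- apply: continuous_subspaceT => x; apply: cvgM; first exact: cvg_cst.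
  apply: (@cvg_comp _ _ _ (fun x : R => r ^+ 2 - x ^+ 2)%R (@Num.sqrt R)).
    apply: cvgB; [exact: cvg_cst|exact: exprn_continuous].
  exact: sqrt_continuous.
Qed.

End Disc.

Section NormSq.
Context {R : realType}.
Local Open Scope ereal_scope.

Definition nsq (x : R * R) : R := (x.1 ^+ 2 + x.2 ^+ 2)%R.

Lemma nsq_ge0 x : (0 <= nsq x)%R.
Proof. by rewrite addr_ge0// sqr_ge0. Qed.

Lemma measurable_nsq : measurable_fun [set: R * R] nsq.
Proof. by apply: measurable_funD; apply: measurable_funX. Qed.

Lemma leb2_disc (r : R) : (0 <= r)%R ->
  leb2 [set x : R * R | nsq x <= r]%R = (pi * r)%:E.
Proof.
move=> r0; rewrite /leb2 /product_measure1.
(* Since [Num.sqrt] vanishes on negative numbers, this formula is the length of the slice for every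
   [x], also outside the disc. *)
pose f (x : R) : R := (2 * Num.sqrt (r - x ^+ 2))%R.
have xE (x : R) : lebR (xsection [set x : R * R | nsq x <= r]%R x) = (f x)%:E.
  have [xr|rx] := leP (x ^+ 2)%R r.
    rewrite (_ : xsection _ _ = `[(- Num.sqrt (r - x ^+ 2))%R, Num.sqrt (r - x ^+ 2)%R]%classic).
      rewrite lebR_itv lebesgue_measure_itv/= lte_fin.
      rewrite /f; set s := Num.sqrt _.
      have : (0 <= s)%R by exact: sqrtr_ge0.
      rewrite le_eqVlt => /predU1P[<-|s0]; first by rewrite oppr0 ltxx mulr0.
      rewrite ifT; last by lra.
      by rewrite -EFinB; congr (_%:E); ring.
    apply/seteqP; split=> y; rewrite /xsection/= inE/= in_itv/= /nsq/=.
      rewrite -ler_norml => h; rewrite -sqrtr_sqr ler_wsqrtr//.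
      by rewrite lerBrDl.
    rewrite -ler_norml -sqrtr_sqr ler_sqrt ?subr_ge0//.
    by rewrite lerBrDl.
  rewrite (_ : xsection _ _ = set0).
    by rewrite measure0 /f ler0_sqrtr ?mulr0// subr_le0 ltW.
  apply/seteqP; split=> y //; rewrite /xsection/= inE/= /nsq/=.
  by rewrite leNgt => /negP; apply; rewrite (lt_le_trans rx)// lerDl sqr_ge0.
transitivity (\int[lebR]_x (f x)%:E); first by apply: eq_integral => x _; exact: xE.
have mf : measurable_fun [set: R] (fun x => (f x)%:E).
  apply/measurable_EFinP; apply: measurable_funM => //.
  apply: measurable_funsqrt.
  by apply: measurable_funB => //; exact: measurable_funX.
have f0 x : 0 <= (f x)%:E by rewrite lee_fin mulr_ge0// sqrtr_ge0.
rewrite integral_lebR//.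
rewrite (_ : (fun x => (f x)%:E) = (fun x => (f x)%:E) \_ `[(- Num.sqrt r)%R, Num.sqrt r]); last first.
  apply/funext => x; rewrite patchE; case: ifPn => //.
  rewrite notin_setE/= in_itv/= -ler_norml => /negP; rewrite -ltNge => h.
  rewrite /f ler0_sqrtr ?mulr0// subr_le0.
  by rewrite -(sqr_sqrtr r0) -[leRHS]real_normK ?num_real// ler_sqr ?nnegrE ?sqrtr_ge0// ltW.
rewrite -integral_mkcond.
have := r0; rewrite le_eqVlt => /predU1P[<-|rgt0].
  by rewrite sqrtr0 oppr0 set_itv1 integral_set1 mulr0.
rewrite -[in RHS](sqr_sqrtr r0) -integral_half_disc ?sqrtr_gt0//.
by rewrite sqr_sqrtr.
Qed.

(** The area of a disc is linear in its squared radius, so the image of the plane measure under the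
    squared norm is a multiple of Lebesgue measure on the half-line. *)
Lemma ge0_integral_normsq (G : R -> \bar R) :
  measurable_fun [set: R] G -> (forall x, 0 <= G x) ->
  \int[leb2]_x G (nsq x) = pi%:E * \int[lebR]_(a in `[0%R, +oo[) G a.
Proof.
move=> mG G0.
have pi0 : (0 <= pi^-1 :> R)%R by rewrite invr_ge0 pi_ge0.
pose m1 := mscale (NngNum pi0) (image_measure leb2 measurable_nsq).
(* Lebesgue measure of the missing negative half-line: [m1] and [m2] add up to a measure on the
   whole line, to which [lebR_unique] applies. *)
pose m2 := mrestr lebR (measurable_itv `]-oo, (0 : R)%R[).
have m1itv (a b : R) : (0 <= a)%R -> (a <= b)%R -> m1 `]a, b]%classic = (b - a)%:E.
  move=> a0 ab; have b0 := le_trans a0 ab.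
  rewrite /m1/= /mscale/= /image_measure /pushforward.
  rewrite (_ : _ @^-1` _ = [set x | nsq x <= b]%R `\` [set x | nsq x <= a]%R); last first.
    apply/seteqP; split=> x /=; rewrite in_itv/=.
      by move=> /andP[h1 h2]; split => //; apply/negP; rewrite -ltNge.
    by move=> [h1 /negP]; rewrite -ltNge => ->.
  have md (c : R) : measurable [set x : R * R | nsq x <= c]%R.
    rewrite -[X in measurable X]setTI.
    exact: (measurable_nsq measurableT (measurable_itv `]-oo, c])).
  rewrite measureD//=; last by move: (leb2_disc b0) => /= ->; rewrite ltry.
  rewrite (_ : _ `&` _ = [set x | nsq x <= a]%R); last first.
    by apply/seteqP; split=> x /= => [[]//|h]; split=> //; exact: le_trans ab.
  move: (leb2_disc a0) (leb2_disc b0) => /= -> ->.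
  rewrite -EFinB -EFinM; congr (_%:E).
  by rewrite -mulrBr mulKf// gt_eqF ?pi_gt0.
have E (A : set R) : measurable A -> lebR A = measure_add m1 m2 A.
  apply: lebR_unique => a b ab.
  transitivity (m1 `]a, b]%classic + m2 `]a, b]%classic); first exact: measure_addE.
  have [a0|a0] := leP 0%R a.
    rewrite m1itv// /m2/= /mrestr (_ : _ `&` _ = set0) ?measure0 ?adde0//.
    apply/seteqP; split=> x //=; rewrite !in_itv/= => -[/andP[ax _]].
    by rewrite ltNge (le_trans a0 (ltW ax)).
  have [b0|b0] := ltP b 0%R.
    rewrite [X in X + _](_ : _ = 0) ?add0e.
      rewrite /m2/= /mrestr setIidl.
        rewrite lebR_itv lebesgue_measure_itv/= lte_fin.
        by case: ltgtP ab => // -> _; rewrite subrr.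
      by move=> x /=; rewrite !in_itv/= => /andP[_ xb]; exact: le_lt_trans b0.
    rewrite /m1/= /mscale/= /image_measure /pushforward (_ : _ @^-1` _ = set0).
      by rewrite measure0 mule0.
    apply/seteqP; split=> x //=; rewrite in_itv/= => /andP[_ xb].
    by have := le_trans (nsq_ge0 x) xb; rewrite leNgt b0.
  rewrite [X in X + _](_ : _ = b%:E).
    rewrite /m2/= /mrestr (_ : _ `&` _ = `]a, 0%R[%classic).
      rewrite lebR_itv lebesgue_measure_itv/= lte_fin a0.
      by rewrite -!EFinD; congr (_%:E); ring.
    apply/seteqP; split=> x /=; rewrite !in_itv/=.
      by move=> [/andP[-> _] ->].
    by move=> /andP[ax x0]; rewrite ax x0 (le_trans (ltW x0) b0).
  rewrite /m1/= /mscale/= /image_measure /pushforward.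
  rewrite (_ : _ @^-1` _ = [set x | nsq x <= b]%R).
    by rewrite leb2_disc// -EFinM; congr (_%:E); rewrite mulKf// gt_eqF ?pi_gt0.
  apply/seteqP; split=> x /=; rewrite in_itv/=; first by move=> /andP[].
  by move=> ->; rewrite andbT (lt_le_trans a0)// nsq_ge0.
transitivity (pi%:E * \int[m1]_(a in `[0%R, +oo[) G a).
  rewrite ge0_integral_mscale//; last exact: measurable_funTS.
  rewrite muleA -EFinM divff ?gt_eqF ?pi_gt0// mul1e.
  rewrite (@ge0_integral_pushforward _ _ _ _ _ _ measurable_nsq)//; last exact: measurable_funTS.
  rewrite (_ : _ @^-1` _ = setT)//.
  by apply/seteqP; split=> x //= _; rewrite in_itv/= nsq_ge0.
congr (_ * _); apply: eq_measure_integral => A mA AD.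
rewrite [RHS]E// measure_addE [X in _ + X](_ : _ = 0) ?adde0//.
rewrite /m2/= /mrestr (_ : _ `&` _ = set0) ?measure0//.
apply/seteqP; split=> x //= -[/AD/=]; rewrite !in_itv/= andbT.
by rewrite leNgt => /negbTE ->.
Qed.

End NormSq.

(** * Uniform angles and rotation invariance *)

Section Circle.
Context {R : realType}.
Local Open Scope ereal_scope.
Implicit Types (f : R -> \bar R) (a b c : R).

Lemma ge0_integral_opp f :
  measurable_fun [set: R] f -> (forall x, 0 <= f x) ->
  \int[lebR]_x f (- x)%R = \int[lebR]_x f x.
Proof.
move=> mf f0.
have ms : measurable_fun [set: R] (-%R : R -> R) by exact: measurable_funN.
rewrite -(@ge0_integral_image_measure _ _ _ _ _ lebR _ ms f)//.
apply: eq_measure_integral => A mA _.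
apply/esym/lebR_unique => // a b ab.
transitivity (lebR [set` `[(- b)%R, (- a)%R[%R]).
  congr (lebR _).
  by apply/seteqP; split=> x /=; rewrite !in_itv/= lerNl ltrNr andbC.
rewrite lebR_itv lebesgue_measure_itv/= lte_fin ltrN2.
case: ltgtP ab => // [ab|->] _; last by rewrite subrr.
by rewrite -EFinB; congr (_%:E); ring.
Qed.

Lemma integral_itvcc_co f a b :
  measurable_fun [set: R] f -> (forall x, 0 <= f x) ->
  \int[lebR]_(x in `[a, b]) f x = \int[lebR]_(x in `[a, b[) f x.
Proof.
move=> mf f0; rewrite !integral_lebR//; try exact: measurable_funTS.
by rewrite integral_itv_bndo_bndc//; exact: measurable_funTS.
Qed.

Lemma ge0_integral_itv_shift f a b c :
  measurable_fun [set: R] f -> (forall x, 0 <= f x) ->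
  \int[lebR]_(x in `[a, b[) f (x + c)%R =
  \int[lebR]_(x in `[(a + c)%R, (b + c)%R[) f x.
Proof.
move=> mf f0.
rewrite integral_mkcond [RHS]integral_mkcond.
rewrite -[RHS](ge0_integral_shift c); last 2 first.
- exact/(measurable_restrictT _ _).1/measurable_funTS.
- by move=> x; rewrite patchE; case: ifP.
apply: eq_integral => x _; rewrite !patchE; congr (if _ then _ else _).
by apply/idP/idP; rewrite !inE/= !in_itv/= lerD2r ltrD2r.
Qed.

Lemma ge0_integral_itv_split f a b c : (a <= b)%R -> (b <= c)%R ->
  measurable_fun [set: R] f -> (forall x, 0 <= f x) ->
  \int[lebR]_(x in `[a, c[) f x =
  \int[lebR]_(x in `[a, b[) f x + \int[lebR]_(x in `[b, c[) f x.
Proof.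
move=> ab bc mf f0; rewrite -ge0_integral_setU//; last 2 first.
- exact: measurable_funTS.
- apply/disj_setPS => x [/=]; rewrite !in_itv/= => /andP[_ xb] /andP[bx _].
  by move: xb; rewrite ltNge bx.
congr (integral _ _ _); apply/seteqP; split=> x /=; rewrite !in_itv/=.
  by move=> /andP[-> xc] /=; have [] := ltP x b; [left|right].
move=> [/andP[-> xb]|/andP[bx ->]]; first by rewrite (lt_le_trans xb).
by rewrite (le_trans ab).
Qed.

(** The shift by [a] pushes a piece of the period beyond [- pi]; periodicity brings it back, and
    evenness of the cosine folds the negative half of the period onto the positive one. *)
Lemma ge0_integral_cos (g : R -> \bar R) a :
  measurable_fun [set: R] g -> (forall x, 0 <= g x) -> (0 <= a <= pi)%R ->
  \int[lebR]_(t in `[(- pi)%R, pi]) g (cos (t - a)) =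
  2%:E * \int[lebR]_(t in `[0%R, pi]) g (cos t).
Proof.
move=> mg g0 /andP[a0 api].
pose G t := g (cos t).
have pi0 := pi_ge0 R.
have mG : measurable_fun [set: R] G.
  apply: (measurableT_comp mg); apply: measurable_funcos; exact: measurable_id.
have G0 t : 0 <= G t by exact: g0.
have Gper t : G (t + pi *+ 2)%R = G t by rewrite /G cosD2pi.
have Gopp t : G (- t)%R = G t by rewrite /G cosN.
rewrite !integral_itvcc_co//; last 1 first.
  apply: (measurableT_comp mg); apply: measurable_funcos.
  by apply: measurable_funB.
rewrite (@ge0_integral_itv_shift G _ _ (- a)%R)//.
rewrite (@ge0_integral_itv_split G (- pi - a)%R (- pi)%R (pi - a)%R)//; [|lra|lra].
have -> : \int[lebR]_(x in `[(- pi - a)%R, (- pi)%R[) G x =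
          \int[lebR]_(x in `[(pi - a)%R, pi[) G x.
  transitivity (\int[lebR]_(x in `[(- pi - a)%R, (- pi)%R[) G (x + pi *+ 2)%R).
    by apply: eq_integral => x _; rewrite Gper.
  rewrite ge0_integral_itv_shift//.
  have -> : (- pi - a + pi *+ 2 = pi - a :> R)%R by rewrite mulr2n; lra.
  by have -> : (- pi + pi *+ 2 = pi :> R)%R by rewrite mulr2n; lra.
rewrite addeC -(@ge0_integral_itv_split G (- pi)%R (pi - a)%R pi)//; [|lra..].
rewrite (@ge0_integral_itv_split G (- pi)%R 0%R pi)//; [|lra..].
have -> : \int[lebR]_(x in `[(- pi)%R, 0%R[) G x = \int[lebR]_(x in `[0%R, pi[) G x.
  rewrite -integral_itvcc_co// -[RHS]integral_itvcc_co//.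
  rewrite integral_mkcond [RHS]integral_mkcond.
  rewrite -[RHS]ge0_integral_opp; last 2 first.
  - exact/(measurable_restrictT _ _).1/measurable_funTS.
  - by move=> x; rewrite patchE; case: ifP.
  apply: eq_integral => x _; rewrite !patchE Gopp.
  rewrite (_ : (_ \in `[0%R, pi]%classic) = (x \in `[(- pi)%R, 0%R]%classic))//.
  by apply/idP/idP; rewrite !inE/= !in_itv/= oppr_ge0 lerNl andbC.
by rewrite -mule2n mule_natl.
Qed.

(** The angle is an arc cosine, hence in [[0, pi]], and the sign of the second coordinate stays
    open. This is harmless below, where the angle is averaged over a symmetric interval. *)
Lemma polar (x : R * R) : exists2 a : R, (0 <= a <= pi)%R &
  x.1 = (Num.sqrt (nsq x) * cos a)%R /\
  (x.2 = (Num.sqrt (nsq x) * sin a)%R \/ x.2 = (- (Num.sqrt (nsq x) * sin a))%R).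
Proof.
set r := Num.sqrt _.
have r2 : (r ^+ 2 = x.1 ^+ 2 + x.2 ^+ 2)%R by rewrite sqr_sqrtr ?nsq_ge0.
have r0 : (0 <= r)%R by exact: sqrtr_ge0.
have [rE|rN0] := eqVneq r 0%R.
  move: r2; rewrite rE expr0n/= => /esym/eqP; rewrite paddr_eq0 ?sqr_ge0//.
  rewrite !sqrf_eq0 => /andP[/eqP -> /eqP ->].
  by exists 0%R; rewrite ?lexx ?pi_ge0// !mul0r; split=> //; left.
have rgt0 : (0 < r)%R by rewrite lt_neqAle eq_sym rN0.
have x1r : (`|x.1| <= r)%R.
  by rewrite -(ger0_norm r0) -ler_sqr ?nnegrE// !real_normK ?num_real// r2 lerDl sqr_ge0.
have xI : (-1 <= x.1 / r <= 1)%R.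
  by rewrite -ler_norml normrM normfV (ger0_norm r0) ler_pdivrMr// mul1r.
exists (acos (x.1 / r)); first by rewrite acos_ge0 ?acos_lepi.
rewrite acosK ?in_itv//= mulrCA divff// mulr1; split=> //.
rewrite sin_acos//.
have -> : (r * Num.sqrt (1 - (x.1 / r) ^+ 2) = `|x.2|)%R.
  rewrite -{1}(ger0_norm r0) -sqrtr_sqr -sqrtrM ?sqr_ge0// -sqrtr_sqr.
  congr (Num.sqrt _); rewrite mulrBr mulr1 -exprMn mulrCA divff// mulr1 r2; ring.
by have [x2|x2] := ger0P x.2; [left|right; rewrite opprK].
Qed.

(** In polar coordinates the inner product is the norm of [x] times [cos (t - a)] or [cos (t + a)],
    and a uniform angle absorbs the shift. Only the norm of [x] survives. *)
Lemma integral_unif_dot (g : R -> \bar R) (pp : (- pi < pi :> R)%R)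
    (p0 : (0 < pi :> R)%R) (x : R * R) :
  measurable_fun [set: R] g -> (forall x, 0 <= g x) ->
  \int[unif pp]_t g (x.1 * cos t + x.2 * sin t)%R =
  \int[unif p0]_t g (Num.sqrt (nsq x) * cos t)%R.
Proof.
move=> mg g0.
have mG (r : R) : measurable_fun [set: R] (fun y => g (r * y)%R).
  by apply: (measurableT_comp mg); apply: measurable_funM.
rewrite !integral_unif//; last 2 first.
- apply: (measurableT_comp (mG _)); apply: measurable_funcos; exact: measurable_id.
- apply: (measurableT_comp mg); apply: measurable_funD; apply: measurable_funM => //.
    by apply: measurable_funcos; exact: measurable_id.
  by apply: measurable_funsin; exact: measurable_id.
have key a : (0 <= a <= pi)%R ->
    (pi - - pi)^-1%:E * \int[lebR]_(t in `[(- pi)%R, pi])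
        g (Num.sqrt (nsq x) * cos (t - a))%R =
    (pi - 0)^-1%:E * \int[lebR]_(t in `[0%R, pi]) g (Num.sqrt (nsq x) * cos t)%R.
  move=> aI; rewrite (ge0_integral_cos (mG _))// muleA -EFinM.
  congr (_%:E * _); rewrite subr0 opprK (_ : pi + pi = 2 * pi)%R; last by ring.
  by rewrite invfM mulrAC mulVf ?mul1r.
have [a aI [x1 x2]] := polar x.
rewrite -(key a aI); congr (_ * _).
have [x2E|x2E] := x2.
  by apply: eq_integral => t _; rewrite {1}x1 {1}x2E cosB; congr g; ring.
transitivity (\int[lebR]_(t in `[(- pi)%R, pi]) g (Num.sqrt (nsq x) * cos (t + a))%R).
  by apply: eq_integral => t _; rewrite {1}x1 {1}x2E cosD; congr g; ring.
rewrite integral_mkcond [RHS]integral_mkcond.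
rewrite -[RHS]ge0_integral_opp; last 2 first.
- apply/(measurable_restrictT _ _).1 => //; apply/measurable_funTS.
  apply: (measurableT_comp (mG _)); apply: measurable_funcos.
  by apply: measurable_funB.
- by move=> y; rewrite patchE; case: ifP.
apply: eq_integral => t _; rewrite !patchE.
rewrite (_ : ((- t)%R \in _) = (t \in `[(- pi)%R, pi]%classic)).
  by rewrite -opprD cosN.
by apply/idP/idP; rewrite !inE/= !in_itv/= lerN2 lerNl andbC.
Qed.

End Circle.

(** * Joint law of the squared distances at two times *)

Section KeyLaw.
Context {R : realType}.
Local Open Scope ereal_scope.

Definition sqdist (v t : R) (y : (R * R) * R) : R :=
  nsq (y.1.1 + v * t * cos y.2, y.1.2 + v * t * sin y.2)%R.

Lemma sqdist_ge0 v t y : (0 <= sqdist v t y)%R.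
Proof. exact: nsq_ge0. Qed.

Lemma measurable_sqdist v t : measurable_fun [set: (R * R) * R] (sqdist v t).
Proof.
apply: (measurableT_comp measurable_nsq); apply/measurable_fun_pairP; split;
  apply: measurable_funD.
- exact: (measurableT_comp measurable_fst).
- by apply: measurable_funM => //; exact: measurable_funcos.
- exact: (measurableT_comp measurable_snd).
- by apply: measurable_funM => //; exact: measurable_funsin.
Qed.

(** For a fixed direction, passing from the initial position to the position at time [t] is a
    translation; this is why the integral over the plane is performed inside the one over the mark.
    Afterwards the order is exchanged: for a fixed position the mark only enters through an inner
    product, whose law depends on the norm alone. *)
Lemma key_law (pp : (- pi < pi :> R)%R) (p0 : (0 < pi :> R)%R) (v t h : R)
    (F : R * R -> \bar R) :
  measurable_fun [set: R * R] F -> (forall z, 0 <= F z) ->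
  \int[leb2 \x unif pp]_y F (sqdist v t y, sqdist v (t + h) y) =
  pi%:E * \int[lebR]_(a in `[0%R, +oo[) \int[unif p0]_u
     F (a, a + 2 * (v * h) * (Num.sqrt a * cos u) + (v * h) ^+ 2)%R.
Proof.
move=> mF F0.
rewrite fubini_tonelli2//; last first.
  apply: (measurableT_comp mF); apply/measurable_fun_pairP.
  by split; exact: measurable_sqdist.
rewrite /fubini_G.
(* Here [w.1] is the position at time [t], and the second squared distance is expanded around it. *)
pose H (w : (R * R) * R) := F (nsq w.1, nsq w.1 + 2 * (v * h) *
  (w.1.1 * cos w.2 + w.1.2 * sin w.2) + (v * h) ^+ 2)%R.
have mn : measurable_fun [set: (R * R) * R] (fun w => nsq w.1).
  exact: (measurableT_comp measurable_nsq).
have mH : measurable_fun [set: (R * R) * R] H.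
  apply: (measurableT_comp mF); apply/measurable_fun_pairP; split => //.
  apply: measurable_funD => //; apply: measurable_funD => //.
  apply: measurable_funM => //; apply: measurable_funD; apply: measurable_funM.
  - exact: (measurableT_comp measurable_fst).
  - exact: measurable_funcos.
  - exact: (measurableT_comp measurable_snd).
  - exact: measurable_funsin.
transitivity (\int[unif pp]_u \int[leb2]_x H (x, u)).
  apply: eq_integral => u _.
  pose c : R * R := (v * t * cos u, v * t * sin u)%R.
  rewrite -(ge0_integral_leb2_shift c (F := fun x => H (x, u))); last 2 first.
  - exact: (measurableT_comp mH (pair2_measurable u)).
  - by move=> x; exact: F0.
  apply: eq_integral => x _; rewrite /H/= /sqdist/= /nsq/=.
  congr F; congr pair.
  have E : (cos u ^+ 2 = 1 - sin u ^+ 2)%R by exact: cos2sin2.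
  ring: E.
have H0 z : 0 <= H z by exact: F0.
rewrite -(@fubini_tonelli _ _ _ _ R leb2 (unif pp) H)//.
pose G (a : R) := \int[unif p0]_u
  F (a, a + 2 * (v * h) * (Num.sqrt a * cos u) + (v * h) ^+ 2)%R.
have mG : measurable_fun [set: R] G.
  pose K (w : R * R) :=
    F (w.1, w.1 + 2 * (v * h) * (Num.sqrt w.1 * cos w.2) + (v * h) ^+ 2)%R.
  have mK : measurable_fun [set: R * R] K.
    apply: (measurableT_comp mF); apply/measurable_fun_pairP.
    split; first exact: measurable_fst.
    apply: measurable_funD => //; apply: measurable_funD => //.
    apply: measurable_funM => //; apply: measurable_funM.
      exact: measurable_funsqrt.
    exact: measurable_funcos.
  apply: (@measurable_fun_fubini_tonelli_F _ _ _ _ R (unif p0) K); [exact: mK|by move=> w; exact: F0].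
have G0 a : 0 <= G a by exact: integral_ge0.
transitivity (\int[leb2]_x G (nsq x)); last exact: ge0_integral_normsq.
apply: eq_integral => x _.
rewrite /H/= (@integral_unif_dot _
  (fun s => F (nsq x, nsq x + 2 * (v * h) * s + (v * h) ^+ 2)%R) _ p0 x)//.
apply: (measurableT_comp mF); apply/measurable_fun_pairP.
split; first exact: measurable_cst.
by apply: measurable_funD => //; apply: measurable_funD => //; apply: measurable_funM.
Qed.

End KeyLaw.

(** * Poisson laws and Laplace functionals *)

Section Independence.
Context d (T : measurableType d) (R : realType) (P : probability T R).
Local Open Scope ereal_scope.

Lemma measurable_fun_big_prod (I : Type) (s : seq I) (f : I -> T -> R) :
  (forall i, measurable_fun setT (f i)) ->
  measurable_fun setT (fun w => \prod_(i <- s) f i w)%R.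
Proof.
move=> mf; elim: s => [|i s IH].
  by under eq_fun do rewrite big_nil; exact: measurable_cst.
by under eq_fun do rewrite big_cons; exact: measurable_funM.
Qed.

(** Each [f j] is a nonnegative series of indicators of the sets [F j n]. The indicators are
    replaced by these series one index at a time, sum and integral being exchanged by positivity. *)
Lemma integral_prod_indep (k : nat) (F : 'I_k -> nat -> set T)
    (c p : 'I_k -> nat -> R) (f : 'I_k -> T -> R) (e : 'I_k -> R) :
  (forall j n, measurable (F j n)) ->
  (forall j n, (0 <= c j n)%R) -> (forall j n, (0 <= p j n)%R) ->
  (forall n : 'I_k -> nat, P (\bigcap_(j in [set: 'I_k]) F j (n j)) =
     (\prod_(j < k) p j (n j))%:E) ->
  (forall j w, \sum_(n <oo) (c j n * \1_(F j n) w)%:E = (f j w)%:E) ->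
  (forall j, \sum_(n <oo) (c j n * p j n)%:E = (e j)%:E) ->
  \int[P]_w (\prod_(j < k) f j w)%:E = (\prod_(j < k) e j)%:E.
Proof.
move=> mF c0 p0 PF fE eE.
have f0 j w : (0 <= f j w)%R.
  rewrite -lee_fin -fE; apply: nneseries_ge0 => n _ _.
  by rewrite lee_fin mulr_ge0// indicE.
have mf j : measurable_fun setT (f j).
  apply/measurable_EFinP.
  rewrite (_ : _ \o _ = fun w => \sum_(n <oo) (c j n * \1_(F j n) w)%:E); last first.
    by apply/funext => w /=; rewrite fE.
  apply: ge0_emeasurable_sum => [n w _ _|n _]; first by rewrite lee_fin mulr_ge0// indicE.
  by apply/measurable_EFinP; apply: measurable_funM => //; exact: measurable_indic.
(* The first [l] factors have already become functions [f j]; the remaining ones are still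
   indicators. The induction is on [l]. *)
pose g l (n : 'I_k -> nat) (j : 'I_k) w : R :=
  if (j < l)%N then f j w else \1_(F j (n j)) w.
pose a l (n : 'I_k -> nat) (j : 'I_k) : R := if (j < l)%N then e j else p j (n j).
have g0 l n j w : (0 <= g l n j w)%R by rewrite /g; case: ifP; rewrite // indicE.
have mg l n j : measurable_fun setT (g l n j).
  by rewrite /g; case: (j < l)%N => //; exact: measurable_indic.
suff H l n : \int[P]_w (\prod_(j < k) g l n j w)%:E = (\prod_(j < k) a l n j)%:E.
  transitivity (\int[P]_w (\prod_(j < k) g k (fun=> 0%N) j w)%:E).
    apply: eq_integral => w _; congr (_%:E); apply: eq_bigr => j _.
    by rewrite /g ltn_ord.
  by rewrite H; congr (_%:E); apply: eq_bigr => j _; rewrite /a ltn_ord.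
elim: l n => [|l IH] n.
  rewrite -PF -[X in P X]setIT -integral_indic//; last first.
    by apply: fin_bigcap_measurable => // j _; exact: mF.
  apply: eq_integral => w _; congr (_%:E); rewrite /g/=.
  rewrite indicE; have [wF|wF] := boolP (w \in _).
    rewrite big1// => j _; rewrite indicE mem_set//.
    by move: wF; rewrite inE; exact.
  apply/eqP; rewrite prodf_seq_eq0.
  move: wF; rewrite notin_setE => /existsNP[j /not_implyP[_ wF]].
  apply/hasP; exists j; first by rewrite mem_index_enum.
  by rewrite /= indicE memNset//= eqxx.
have [lk|kl] := ltnP l k; last first.
  transitivity (\int[P]_w (\prod_(j < k) g l n j w)%:E).
    apply: eq_integral => w _; congr (_%:E); apply: eq_bigr => j _.
    by rewrite /g ltnS !(leq_trans (ltn_ord j)) ?leqW// ltnW// (leq_trans (ltn_ord j)).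
  rewrite IH; congr (_%:E); apply: eq_bigr => j _.
  by rewrite /a ltnS !(leq_trans (ltn_ord j)) ?leqW// ltnW// (leq_trans (ltn_ord j)).
pose i := Ordinal lk.
pose upd m (j : 'I_k) := if j == i then m else n j.
have gE w m : (\prod_(j < k) g l (upd m) j w = \1_(F i m) w * \prod_(j < k | j != i) g l n j w)%R.
  rewrite (bigD1 i)//=; congr (_ * _)%R; first by rewrite /g ltnn /upd eqxx.
  by apply: eq_bigr => j ji; rewrite /g /upd (negbTE ji).
have gE' w : (\prod_(j < k) g l.+1 n j w = f i w * \prod_(j < k | j != i) g l n j w)%R.
  rewrite (bigD1 i)//=; congr (_ * _)%R; first by rewrite /g ltnSn.
  by apply: eq_bigr => j ji; rewrite /g ltnS leq_eqVlt (_ : (j == l :> nat) = false)//; apply/negbTE.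
have aE m : (\prod_(j < k) a l (upd m) j = p i m * \prod_(j < k | j != i) a l n j)%R.
  rewrite (bigD1 i)//=; congr (_ * _)%R; first by rewrite /a ltnn /upd eqxx.
  by apply: eq_bigr => j ji; rewrite /a /upd (negbTE ji).
have aE' : (\prod_(j < k) a l.+1 n j = e i * \prod_(j < k | j != i) a l n j)%R.
  rewrite (bigD1 i)//=; congr (_ * _)%R; first by rewrite /a ltnSn.
  by apply: eq_bigr => j ji; rewrite /a ltnS leq_eqVlt (_ : (j == l :> nat) = false)//; apply/negbTE.
transitivity (\int[P]_w \sum_(m <oo) (c i m * \prod_(j < k) g l (upd m) j w)%:E).
  apply: eq_integral => w _; rewrite gE' mulrC EFinM -fE -nneseriesZl; last first.
    by move=> m _; rewrite lee_fin mulr_ge0// indicE.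
  apply: eq_eseriesr => m _; rewrite gE -EFinM; congr (_%:E); ring.
rewrite integral_nneseries//; last 2 first.
- move=> m; apply/measurable_EFinP; apply: measurable_funM => //.
  exact: measurable_fun_big_prod.
- by move=> m w _; rewrite lee_fin mulr_ge0// prodr_ge0.
transitivity (\sum_(m <oo) (\prod_(j < k | j != i) a l n j)%:E * (c i m * p i m)%:E).
  apply: eq_eseriesr => m _.
  under eq_integral do rewrite EFinM.
  rewrite ge0_integralZl_EFin//; last 2 first.
  - by move=> w _; rewrite lee_fin prodr_ge0.
  - by apply/measurable_EFinP; exact: measurable_fun_big_prod.
  by rewrite IH aE -!EFinM; congr (_%:E); ring.
rewrite nneseriesZl//; last by move=> m _; rewrite lee_fin mulr_ge0.
by rewrite eE aE' -EFinM mulrC.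
Qed.

End Independence.

Section Counts.
Context d (T : measurableType d) (R : realType) (P : probability T R).
Context (X : nat -> T -> R * R) (mX : forall i, measurable_fun setT (X i)).
Local Open Scope ereal_scope.

Lemma count_eq_unique (B : set (R * R)) m n w :
  count_eq X B m w -> count_eq X B n w -> m = n.
Proof.
move=> [s [us <- hs]] [t [ut <- ht]]; apply/eqP.
rewrite -(uniq_size_uniq ut)// => i.
by apply/idP/idP => [/ht /hs|/hs /ht].
Qed.

Lemma measurable_count_eq (B : set (R * R)) n :
  measurable B -> measurable (count_eq X B n).
Proof.
move=> mB.
rewrite (_ : count_eq X B n = \bigcup_(s in [set: seq nat])
   (if uniq s && (size s == n) then
      \bigcap_(i in [set: nat]) (if i \in s then X i @^-1` B else ~` (X i @^-1` B))
    else set0)).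
  apply: countable_bigcupT_measurable => // s; case: ifP => // _.
  apply: bigcap_measurableType => i _.
  have mXB : measurable (X i @^-1` B) by rewrite -[X in measurable X]setTI; exact: mX.
  by case: ifP => // _; exact: measurableC.
apply/seteqP; split=> w.
  move=> [s [us sn hs]]; exists s => //; rewrite us sn eqxx => i _ /=.
  by case: ifPn => [/hs//|/negP nis /=]; rewrite -hs.
move=> [s _]; case: ifP => // /andP[us /eqP sn] hs; exists s; split=> // i.
by have := hs i I; case: ifPn.
Qed.

(** Only the [n] indices of points in [B] contribute a factor [1 - q], so the product is constant
    once [K] exceeds all of them. *)
Lemma prod_thin (B : set (R * R)) (q : R) n w : count_eq X B n w ->
  \forall K \near \oo,
    (\prod_(i < K) (1 - q * \1_B (X i w)) = (1 - q) ^+ n)%R.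
Proof.
move=> [s [us <- hs]]; exists (\max_(i <- s) i).+1 => // K /= sK.
transitivity (\prod_(i < K | nat_of_ord i \in s) (1 - q))%R.
  rewrite [RHS]big_mkcond/=; apply: eq_bigr => i _; rewrite indicE.
  have [/hs iB|/negP ins] := boolP (nat_of_ord i \in s); first by rewrite mem_set ?mulr1.
  by rewrite memNset ?mulr0 ?subr0// -hs.
rewrite -(big_mkord (fun i => i \in s) (fun=> 1 - q)%R) big_const_seq iter_mulr_1.
congr (_ ^+ _)%R; rewrite -size_filter.
apply/perm_size/uniq_perm => //; first by rewrite filter_uniq ?iota_uniq.
move=> i; rewrite mem_filter mem_index_iota /= andb_idr// => si.
by rewrite (leq_trans _ sK)// ltnS (@leq_bigmax_seq _ s xpredT id).
Qed.

End Counts.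

Section PoissonSums.
Context (R : realType).
Local Open Scope ereal_scope.

Lemma poisson_mass_ge0 (m : R) n : (0 <= m)%R -> (0 <= poisson_mass m n)%R.
Proof. by move=> m0; rewrite /poisson_mass divr_ge0// mulr_ge0 ?expR_ge0// exprn_ge0. Qed.

(** The exponential series. Besides giving the Laplace functional, the value at [z = 1] shows that
    the Poisson masses add up to one. *)
Lemma poisson_gen (m z : R) : (0 <= m)%R -> (0 <= z)%R ->
  \sum_(n <oo) (z ^+ n * poisson_mass m n)%:E = (expR (- m * (1 - z)))%:E.
Proof.
move=> m0 z0.
have E n : (z ^+ n * poisson_mass m n = expR (- m) * exp_coeff (m * z) n)%R.
  by rewrite /poisson_mass exp_coeffE/= exprMn; ring.
under eq_eseriesr do rewrite E EFinM.
rewrite nneseriesZl; last by move=> n _; rewrite lee_fin exp_coeff_ge0// mulr_ge0.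
have -> : (expR (- m * (1 - z)) = expR (- m) * expR (m * z))%R.
  by rewrite -expRD; congr expR; ring.
rewrite EFinM; congr (_ * _).
apply/cvg_lim => //.
under eq_fun do rewrite sumEFin.
apply: cvg_EFin; first exact: nearW.
exact: (is_cvg_series_exp_coeff (m * z)).
Qed.

End PoissonSums.

Section BoundedConvergence.
Context d (T : measurableType d) (R : realType) (P : probability T R).
Local Open Scope ereal_scope.

Lemma bounded_cvg (N : set T) (f_ : nat -> T -> R) (f : T -> R) :
  measurable N -> P N = 0 ->
  (forall n, measurable_fun setT (f_ n)) -> measurable_fun setT f ->
  (forall n w, (0 <= f_ n w <= 1)%R) -> (forall w, (0 <= f w)%R) ->
  (forall w, ~ N w -> f_ n w @[n --> \oo] --> f w) ->
  \int[P]_w (f_ n w)%:E @[n --> \oo] --> \int[P]_w (f w)%:E.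
Proof.
move=> mN N0 mf_ mf f_01 f0 cf.
have mE (g : T -> R) : measurable_fun setT g -> measurable_fun setT (fun w => (g w)%:E).
  by move=> mg; exact/measurable_EFinP.
rewrite (ge0_negligible_integral mN _ (mE _ mf))//; last by move=> w _; rewrite lee_fin.
under eq_fun.
  move=> n; rewrite (ge0_negligible_integral mN _ (mE _ (mf_ n)))//; last first.
    by move=> w _; rewrite lee_fin; have /andP[] := f_01 n w.
  over.
have mTN : measurable (setT `\` N) by exact: measurableD.
apply: (@dominated_cvg _ _ _ P _ mTN
  (fun n w => (f_ n w)%:E) (fun w => (f w)%:E) (cst 1)).
- by move=> n; apply: measurable_funTS; exact: mE.
- by move=> w [_ Nw]; apply: cvg_EFin; [exact: nearW|exact: cf].
- by [].
- exact: finite_measure_integrable_cst.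
- by move=> n w _ /=; have /andP[a b] := f_01 n w; rewrite lee_fin ger0_norm.
Qed.

End BoundedConvergence.

Lemma measure_bigcup_eq0 d (T : measurableType d) (R : realType)
    (P : {measure set T -> \bar R}) (I : finType) (A : I -> set T) :
  (forall i, measurable (A i)) -> (forall i, P (A i) = 0)%E ->
  P (\bigcup_(i in [set: I]) A i) = 0%E.
Proof.
move=> mA A0.
rewrite (_ : [set: I] = [set` index_enum I]); last first.
  by apply/seteqP; split=> i //= _; rewrite mem_index_enum.
rewrite bigcup_seq; elim: (index_enum I) => [|i s IH]; first by rewrite big_nil.
rewrite big_cons; apply/eqP; rewrite -measure_le0 -(adde0 0%E).
rewrite -{1}(A0 i) -IH; apply: measureU2 => //.
by apply: bigsetU_measurable.
Qed.

Section LaplaceSimple.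
Context d (T : measurableType d) (R : realType) (P : probability T R).
Context (X : nat -> T -> R * R) (lam : R) (hX : is_homogeneous_PPP P X lam).
Hypothesis lam0 : (0 < lam)%R.
Local Open Scope ereal_scope.

Let mX i : measurable_fun setT (X i). Proof. by have [] := hX. Qed.

Lemma fine_leb2_ge0 (B : set (R * R)) : (0 <= fine (leb2 B))%R.
Proof. exact: fine_ge0. Qed.

Lemma probability_count_eq (B : set (R * R)) n : measurable B -> leb2 B < +oo ->
  P (count_eq X B n) = (poisson_mass (lam * fine (leb2 B)) n)%:E.
Proof.
move=> mB Boo; have [_ h] := hX.
have := h 1%N (fun=> B) (fun=> n); rewrite big_ord1 Leb2E//.
move=> <- //; last by move=> i j; rewrite !ord1.
by congr (P _); apply/seteqP; split=> w; [move=> + _ _|move=> /(_ ord0 I)].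
Qed.

(** The Poisson masses sum to one. Almost sure finiteness of the number of points in a set of finite
    measure is derived here from the counting laws. *)
Lemma count_eq_exists_ae (B : set (R * R)) : measurable B -> leb2 B < +oo ->
  P (\bigcup_n count_eq X B n) = 1.
Proof.
move=> mB Boo.
rewrite measure_semi_bigcup//; last 3 first.
- by move=> n; exact: measurable_count_eq.
- by move=> m n _ _ [w []]; exact: count_eq_unique.
- by apply: bigcupT_measurable => n; exact: measurable_count_eq.
transitivity (\sum_(n <oo) (poisson_mass (lam * fine (leb2 B)) n)%:E).
  by apply: eq_eseriesr => n _; exact: probability_count_eq.
have m0 : (0 <= lam * fine (leb2 B))%R by rewrite mulr_ge0 ?fine_leb2_ge0 ?ltW.
have := poisson_gen m0 (@ler01 R); rewrite subrr mulr0 expR0 => <-.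
by apply: eq_eseriesr => n _; rewrite expr1n mul1r.
Qed.

(** Grouped by [j], the product over the points is eventually the product of the [(1 - q j)^(N_j)],
    where the [N_j] are the independent Poisson counts of the sets [B j]; bounded convergence then
    passes to the mean. *)
Lemma laplace_simple (k : nat) (B : 'I_k -> set (R * R)) (q : 'I_k -> R) :
  (forall j, measurable (B j)) -> (forall j, leb2 (B j) < +oo) ->
  (forall i j, i != j -> B i `&` B j = set0) ->
  (forall j, (0 <= q j <= 1)%R) ->
  \int[P]_w (\prod_(i < K) \prod_(j < k) (1 - q j * \1_(B j) (X i w)))%:E
    @[K --> \oo] -->
  (expR (- lam * \sum_(j < k) q j * fine (leb2 (B j))))%:E.
Proof.
move=> mB Boo tB q01.
pose F (j : 'I_k) n := count_eq X (B j) n.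
have mF j n : measurable (F j n) by exact: measurable_count_eq.
pose m (j : 'I_k) := (lam * fine (leb2 (B j)))%R.
have m0 j : (0 <= m j)%R by rewrite mulr_ge0 ?fine_leb2_ge0 ?ltW.
have q0 j : (0 <= 1 - q j)%R by rewrite subr_ge0; have /andP[] := q01 j.
(* The value 0 is taken where [B j] contains infinitely many points, an event of probability
   zero. *)
pose f (j : 'I_k) w : R := if pselect (exists n, F j n w) is left h
  then ((1 - q j) ^+ (projT1 (cid h)))%R else 0%R.
have fE j w : \sum_(n <oo) ((1 - q j) ^+ n * \1_(F j n) w)%:E = (f j w)%:E.
  rewrite /f; case: pselect => [h|nh].
    case: cid => n0 /= Fn0.
    rewrite (@nneseriesD1 _ _ n0)//; last first.
      by move=> n _; rewrite lee_fin mulr_ge0 ?exprn_ge0// indicE.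
    rewrite indicE mem_set// mulr1 eseries0 ?adde0// => n _ /andP[_ nn0].
    rewrite indicE memNset ?mulr0// => Fn.
    by move: nn0; rewrite (_ : n = n0) ?eqxx//; exact: (@count_eq_unique _ _ _ X (B j) _ _ w Fn Fn0).
  rewrite eseries0// => n _ _; rewrite indicE memNset ?mulr0// => Fn.
  by apply: nh; exists n.
have -> : (expR (- lam * \sum_(j < k) q j * fine (leb2 (B j))))%:E =
    \int[P]_w (\prod_(j < k) f j w)%:E.
  rewrite (@integral_prod_indep _ _ _ P k F (fun j n => (1 - q j) ^+ n)%R
    (fun j n => poisson_mass (m j) n) f (fun j => expR (- m j * q j)))//.
  - rewrite mulr_sumr expR_sum; congr (_%:E); apply: eq_bigr => j _.
    by congr expR; rewrite /m; ring.
  - by move=> j n; rewrite exprn_ge0.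
  - by move=> j n; exact: poisson_mass_ge0.
  - move=> n; have [_ h] := hX; rewrite h//; last by move=> j; rewrite Leb2E.
    by congr (_%:E); apply: eq_bigr => j _; rewrite Leb2E.
  - move=> j; rewrite poisson_gen//; congr (expR _)%:E; ring.
pose N := \bigcup_(j in [set: 'I_k]) ~` (\bigcup_n F j n).
have mUF j : measurable (\bigcup_n F j n) by exact: bigcupT_measurable.
have mN : measurable N.
  by apply: fin_bigcup_measurable => // j _; exact: measurableC.
have f0 j w : (0 <= f j w)%R.
  by rewrite /f; case: pselect => // h; rewrite exprn_ge0.
have f1 (x : R * R) j : (0 <= 1 - q j * \1_(B j) x <= 1)%R.
  have /andP[a b] := q01 j; rewrite indicE; case: (_ \in _); rewrite ?mulr1 ?mulr0 ?subr0 ?ler01 ?lexx//.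
  by rewrite subr_ge0 b gerBl a.
apply: (@bounded_cvg _ _ _ P N) => //.
- apply: measure_bigcup_eq0 => j; first exact: measurableC.
  by rewrite -[LHS]/(P _) probability_setC// count_eq_exists_ae// subee.
- move=> K; apply: measurable_fun_big_prod => i; apply: measurable_fun_big_prod => j.
  apply: measurable_funB => //; apply: measurable_funM => //.
  exact: (measurableT_comp (measurable_indic (mB j))).
- apply: measurable_fun_big_prod => j; apply/measurable_EFinP.
  rewrite (_ : _ \o _ = fun w => \sum_(n <oo) ((1 - q j) ^+ n * \1_(F j n) w)%:E); last first.
    by apply/funext => w /=; rewrite fE.
  apply: ge0_emeasurable_sum => [n w _ _|n _].
    by rewrite lee_fin mulr_ge0 ?exprn_ge0// indicE.
  by apply/measurable_EFinP; apply: measurable_funM => //; exact: measurable_indic.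
- move=> K w; rewrite prodr_ge0/=; last first.
    by move=> i _; apply: prodr_ge0 => j _; have /andP[] := f1 (X i w) j.
  apply: prodr_ile1 => i _; rewrite prodr_ge0/=; last first.
    by move=> j _; have /andP[] := f1 (X i w) j.
  by apply: prodr_ile1 => j _.
- by move=> w; apply: prodr_ge0.
move=> w Nw.
have Fw j : exists n, F j n w.
  by apply: contrapT => h; apply: Nw; exists j => //= -[n _ Fn]; apply: h; exists n.
apply: cvg_near_cst.
have H j : \forall K \near \oo, (\prod_(i < K) (1 - q j * \1_(B j) (X i w)) = f j w)%R.
  rewrite /f; case: pselect => // h; case: cid => n Fn /=; exact: prod_thin.
have {}H : \forall K \near \oo, forall j, (\prod_(i < K) (1 - q j * \1_(B j) (X i w)) = f j w)%R.
  exact: filter_forall.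
near=> K; rewrite exchange_big/=; apply: eq_bigr => j _.
by move: j; near: K.
Unshelve. all: by end_near.
Qed.

End LaplaceSimple.

(** * Approximation of a weight by step functions *)

Section Discretize.
Context {R : realType} (T : Type) (g : T -> R).
Hypothesis g01 : forall x, 0 <= g x <= 1.

(** Numbering starts at the threshold [1 / (n + 1)]: without the lowest slab, all level sets of an
    integrable [g] have finite measure. *)
Definition level_set (n : nat) (j : nat) : set T :=
  [set x | j.+1%:R / n.+1%:R <= g x < j.+2%:R / n.+1%:R].

Definition discretize (n : nat) (x : T) : R :=
  \sum_(j < n.+1) j.+1%:R / n.+1%:R * \1_(level_set n j) x.

Lemma level_set_disjoint n i j : i != j -> level_set n i `&` level_set n j = set0.
Proof.
move=> ij; apply/seteqP; split=> // x [/andP[a b] /andP[c e]].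
have := le_lt_trans a e; have := le_lt_trans c b.
rewrite !ltr_pM2r ?invr_gt0// !ltr_nat !ltnS => ji ij'.
by move: ij; rewrite eqn_leq ij' ji.
Qed.

(** The level sets are disjoint, so at most one factor differs from one. This turns the product form
    of the step case into a single weight. *)
Lemma prod_discretize n x :
  \prod_(j < n.+1) (1 - j.+1%:R / n.+1%:R * \1_(level_set n j) x) =
  1 - discretize n x.
Proof.
rewrite /discretize.
have [[j xj]|h] := pselect (exists j : 'I_n.+1, level_set n j x).
  have H (i : 'I_n.+1) : i != j -> \1_(level_set n i) x = 0 :> R.
    move=> ij; rewrite indicE memNset// => xi.
    by have := level_set_disjoint n ij => /seteqP[+ _] => /(_ x); apply.
  rewrite (bigD1 j)//= big1 ?mulr1; last by move=> i /H ->; rewrite mulr0 subr0.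
  rewrite (bigD1 j)//= [X in _ = 1 - (_ + X)]big1 ?addr0// => i /H ->.
  by rewrite mulr0.
have H (i : 'I_n.+1) : \1_(level_set n i) x = 0 :> R.
  by rewrite indicE memNset// => xi; apply: h; exists i.
rewrite big1; last by move=> i _; rewrite H mulr0 subr0.
by rewrite big1 ?subr0// => i _; rewrite H mulr0.
Qed.

Lemma discretize_bounds n x : g x - n.+1%:R^-1 <= discretize n x <= g x.
Proof.
rewrite /discretize.
have [[j xj]|h] := pselect (exists j : 'I_n.+1, level_set n j x).
  rewrite (bigD1 j)//= [X in _ <= _ + X <= _]big1 ?addr0; last first.
    move=> i ij; rewrite indicE memNset ?mulr0// => xi.
    by have := level_set_disjoint n ij => /seteqP[+ _] => /(_ x); apply.
  rewrite indicE mem_set// mulr1; case/andP: xj => -> gj; rewrite andbT.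
  by rewrite lerBlDr -[X in _ + X]mul1r -mulrDl natr1 ltW.
rewrite big1; last first.
  by move=> i _; rewrite indicE memNset ?mulr0// => xi; apply: h; exists i.
have /andP[g0 g1] := g01 x; rewrite g0 andbT subr_le0 leNgt; apply/negP => gn.
(* The level containing [x] is [m.-1] because thresholds are numbered from one; [m] is positive
   since [g x] exceeds the first threshold. *)
apply: h; pose m := Num.truncn (n.+1%:R * g x).
have gg0 : 0 <= n.+1%:R * g x by rewrite mulr_ge0.
have /andP[m1 m2] := truncn_itv gg0.
have m0 : (0 < m)%N.
  by rewrite /m truncn_gt0 mulrC -ler_pdivrMr// div1r ltW.
have mn : (m.-1 < n.+1)%N.
  rewrite -ltnS prednK// ltnS -(ler_nat R) (le_trans m1)//.
  by rewrite -[leRHS]mulr1 ler_pM2l.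
exists (Ordinal mn); rewrite /level_set/= prednK// ler_pdivrMr// mulrC m1/=.
by rewrite ltr_pdivlMr// mulrC.
Qed.

Lemma discretize_ge0 n x : 0 <= discretize n x.
Proof. by apply: sumr_ge0 => j _; rewrite mulr_ge0// indicE. Qed.

Lemma cvg_discretize x : discretize n x @[n --> \oo] --> g x.
Proof.
apply: (@squeeze_cvgr _ _ _ _ (fun n => g x - n.+1%:R^-1) (cst (g x))).
- by apply: nearW => n; exact: discretize_bounds.
- rewrite -[X in _ --> X]subr0; apply: cvgB; [exact: cvg_cst|exact: cvg_harmonic].
- exact: cvg_cst.
Qed.

End Discretize.

Lemma measurable_level_set d (T : measurableType d) {R : realType} (g : T -> R) n j :
  measurable_fun setT g -> measurable (level_set g n j).
Proof.
move=> mg; rewrite -[X in measurable X]setTI.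
exact: (mg measurableT _ (measurable_itv `[(j.+1%:R / n.+1%:R), (j.+2%:R / n.+1%:R)[)).
Qed.

Section Laplace.
Context d (T : measurableType d) (R : realType) (P : probability T R).
Context (X : nat -> T -> R * R) (lam : R) (hX : is_homogeneous_PPP P X lam).
Hypothesis lam0 : (0 < lam)%R.
Local Open Scope ereal_scope.

Let mX i : measurable_fun setT (X i). Proof. by have [] := hX. Qed.

(** The limits in [K] and in the level [n] are exchanged by monotonicity. Since the step functions
    lie below [g], the limit in [K] is at most each [L n]. Conversely, products decrease in [K], so
    for fixed [K] the step version is at least [L n], and [n] may tend to infinity first. *)
Lemma laplace_points (g : R * R -> R) : measurable_fun setT g ->
  (forall x, 0 <= g x <= 1)%R -> \int[leb2]_x (g x)%:E < +oo ->
  \int[P]_w (\prod_(i < K) (1 - g (X i w)))%:E @[K --> \oo] -->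
  (expR (- lam * fine (\int[leb2]_x (g x)%:E)))%:E.
Proof.
move=> mg g01 goo.
have ml n j : measurable (level_set g n j) by exact: measurable_level_set.
have mgn n : measurable_fun setT (discretize g n).
  by apply: measurable_sum => j; apply: measurable_funM.
have gn01 n x : (0 <= discretize g n x <= 1)%R.
  rewrite discretize_ge0/=; have /andP[_ h] := discretize_bounds g01 n x.
  by rewrite (le_trans h)//; have /andP[] := g01 x.
have mEg : measurable_fun setT (fun x => (g x)%:E) by exact/measurable_EFinP.
have mEgn n : measurable_fun setT (fun x => (discretize g n x)%:E) by exact/measurable_EFinP.
have g0 x : 0 <= (g x)%:E by rewrite lee_fin; have /andP[] := g01 x.
have gn0 n x : 0 <= (discretize g n x)%:E by rewrite lee_fin discretize_ge0.
have igi : leb2.-integrable setT (fun x => (g x)%:E).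
  apply/integrableP; split=> //; apply: le_lt_trans goo.
  by apply: ge0_le_integral => //; [exact: measurableT_comp|move=> x _; rewrite gee0_abs].
have ign n : \int[leb2]_x (discretize g n x)%:E <= \int[leb2]_x (g x)%:E.
  apply: ge0_le_integral => // x _; rewrite lee_fin.
  by have /andP[] := discretize_bounds g01 n x.
have ignE n : \int[leb2]_x (discretize g n x)%:E =
    \sum_(j < n.+1) (j.+1%:R / n.+1%:R)%:E * leb2 (level_set g n j).
  rewrite /discretize; under eq_integral do rewrite -sumEFin.
  rewrite ge0_integral_sum//; last first.
    by move=> j; apply/measurable_EFinP; apply: measurable_funM.
  apply: eq_bigr => j _; under eq_integral do rewrite EFinM.
  by rewrite ge0_integralZl_EFin// ?integral_indic// ?setIT//; apply/measurable_EFinP.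
have lfin n (j : 'I_n.+1) : leb2 (level_set g n j) < +oo.
  have : (j.+1%:R / n.+1%:R)%:E * leb2 (level_set g n j) < +oo.
    apply: le_lt_trans (le_lt_trans (ign n) goo); rewrite ignE (bigD1 j)//=.
    by rewrite leeDl// sume_ge0// => i _; rewrite mule_ge0// lee_fin.
  move=> H; rewrite ltey; apply/eqP => E; move: H.
  by rewrite E gt0_muley ?ltxx// lte_fin divr_gt0.
have igfin : \int[leb2]_x (g x)%:E \is a fin_num.
  by rewrite ge0_fin_numE// integral_ge0.
have Ln n : \int[P]_w (\prod_(i < K) (1 - discretize g n (X i w)))%:E @[K --> \oo]
    --> (expR (- lam * fine (\int[leb2]_x (discretize g n x)%:E)))%:E.
  have := @laplace_simple _ _ _ P X lam hX lam0 n.+1 (level_set g n)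
    (fun j => (j.+1%:R / n.+1%:R)%R) _ _ _ _.
  have -> : (\sum_(j < n.+1) j.+1%:R / n.+1%:R * fine (leb2 (level_set g n j)) =
      fine (\int[leb2]_x (discretize g n x)%:E))%R.
    rewrite ignE -sum_fine; last first.
      by move=> j _; rewrite fin_numM// ge0_fin_numE.
    by apply: eq_bigr => j _; rewrite fineM// ge0_fin_numE.
  under eq_fun.
    move=> K; under eq_integral.
      move=> w _; under eq_bigr do rewrite prod_discretize.
      over.
    over.
  apply=> //.
  - by move=> i j; exact: level_set_disjoint.
  - move=> j; rewrite divr_ge0//= ler_pdivrMr// mul1r ler_nat.
    exact: ltn_ord.
have bound (f : R * R -> R) : (forall x, 0 <= f x <= 1)%R -> forall K w,
    (0 <= \prod_(i < K) (1 - f (X i w)) <= 1)%R.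
  move=> f01 K w; have H i : (0 <= 1 - f (X i w) <= 1)%R.
    by have /andP[a b] := f01 (X i w); rewrite subr_ge0 b gerBl a.
  rewrite prodr_ge0/=; last by move=> i _; have /andP[] := H i.
  by apply: prodr_ile1 => i _.
have mprod (f : R * R -> R) K : measurable_fun setT f ->
    measurable_fun setT (fun w => \prod_(i < K) (1 - f (X i w)))%R.
  move=> mf; apply: measurable_fun_big_prod => i.
  by apply: measurable_funB => //; exact: measurableT_comp.
have anti (f : R * R -> R) : measurable_fun setT f -> (forall x, 0 <= f x <= 1)%R ->
    {homo (fun K => \int[P]_w (\prod_(i < K) (1 - f (X i w)))%:E) :
      m n / (m <= n)%N >-> n <= m}.
  move=> mf f01; apply/nonincreasing_seqP => K; apply: ge0_le_integral => //.
  - by move=> w _; rewrite lee_fin; have /andP[] := bound f f01 K.+1 w.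
  - by apply/measurable_EFinP; exact: mprod.
  - by apply/measurable_EFinP; exact: mprod.
  move=> w _; rewrite lee_fin big_ord_recr/=; have /andP[a b] := bound f f01 K w.
  by rewrite ler_piMr//; have /andP[c e] := f01 (X K w); rewrite gerBl c.
have acvg := ereal_nonincreasing_is_cvgn (anti g mg g01).
pose L n := expR (- lam * fine (\int[leb2]_x (discretize g n x)%:E)).
have LL : (L n)%:E @[n --> \oo] --> (expR (- lam * fine (\int[leb2]_x (g x)%:E)))%:E.
  apply: cvg_EFin; first exact: nearW.
  apply: (@cvg_comp _ _ _ (fun n => - lam * fine (\int[leb2]_x (discretize g n x)%:E))%R expR);
    last exact: continuous_expR.
  apply: cvgM; first exact: cvg_cst.
  apply: (@fine_cvg _ _ _ _ (fun n => \int[leb2]_x (discretize g n x)%:E)).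
  rewrite fineK//.
  apply: (@dominated_cvg _ _ _ leb2 _ measurableT
    (fun n x => (discretize g n x)%:E) (fun x => (g x)%:E) (fun x => (g x)%:E)) => //.
  - by move=> x _; apply: cvg_EFin; [exact: nearW|exact: cvg_discretize].
  - move=> n x _; rewrite gee0_abs// lee_fin.
    by have /andP[] := discretize_bounds g01 n x.
have anK K : \int[P]_w (\prod_(i < K) (1 - discretize g n (X i w)))%:E @[n --> \oo]
    --> \int[P]_w (\prod_(i < K) (1 - g (X i w)))%:E.
  apply: (@bounded_cvg _ _ _ P set0) => //.
  - by move=> n; exact: mprod.
  - exact: mprod.
  - by move=> n w; exact: bound.
  - by move=> w; have /andP[] := bound g g01 K w.
  - move=> w _; elim: K => [|K IH].
      by under eq_fun do rewrite big_ord0; rewrite big_ord0; exact: cvg_cst.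
    under eq_fun do rewrite big_ord_recr/=; rewrite big_ord_recr/=.
    apply: cvgM => //.
    by apply: cvgB; [exact: cvg_cst|exact: cvg_discretize].
apply: cvg_toP => //; apply/eqP; rewrite eq_le; apply/andP; split.
  apply: (cvge_to_ge LL); apply: nearW => n.
  rewrite -(cvg_lim _ (Ln n))//; apply: lee_lim => //.
    by apply/cvg_ex; eexists; exact: Ln.
  apply: nearW => K; apply: ge0_le_integral => //.
  - by move=> w _; rewrite lee_fin; have /andP[] := bound g g01 K w.
  - by apply/measurable_EFinP; exact: mprod.
  - by apply/measurable_EFinP; exact: mprod.
  - move=> w _; rewrite lee_fin; apply: ler_prod => i _.
    rewrite subr_ge0; have /andP[_ ->] /= := g01 (X i w).
    by rewrite lerD2l lerN2; have /andP[] := discretize_bounds g01 n (X i w).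
apply: lime_ge => //; apply: nearW => K.
apply: (lee_cvg_to LL (anK K)); apply: nearW => n.
rewrite /L -(cvg_lim _ (Ln n))//; apply: lime_le.
  by apply/cvg_ex; eexists; exact: Ln.
by exists K => // K' /= KK'; exact: anti.
Qed.

End Laplace.

(** * Marked points *)

Section image_probability.
Context d1 d2 (T1 : measurableType d1) (T2 : measurableType d2) (R : realType).
Variables (P : probability T1 R) (f : T1 -> T2) (mf : measurable_fun [set: T1] f).

Let image_setT : image_measure P mf [set: T2] = 1%E.
Proof. by rewrite /image_measure /pushforward preimage_setT; exact: probability_setT. Qed.

HB.instance Definition _ := @Measure_isProbability.Build _ _ R
  (image_measure P mf) image_setT.
End image_probability.

Section IndependentPair.
Context d (T : measurableType d) (R : realType) (P : probability T R).
Context d' (S : measurableType d') (xi : T -> S) (th : T -> R).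
Hypotheses (mxi : measurable_fun [set: T] xi) (mth : measurable_fun [set: T] th).
Context (U : probability R R).
Local Open Scope ereal_scope.
Hypothesis indep : forall F A, measurable F -> measurable A ->
  P (xi @^-1` F `&` th @^-1` A) = P (xi @^-1` F) * U A.

(** Independence on rectangles identifies the joint law with the product measure, after which Fubini
    integrates the mark separately. *)
Lemma ge0_integral_indep_pair (h : S * R -> \bar R) :
  measurable_fun [set: S * R] h -> (forall z, 0 <= h z) ->
  \int[P]_w h (xi w, th w) = \int[P]_w \int[U]_t h (xi w, t).
Proof.
move=> mh h0.
have mpair : measurable_fun [set: T] (fun w => (xi w, th w)).
  by apply/measurable_fun_pairP; split.
rewrite -(ge0_integral_image_measure P mpair mh h0).
transitivity (\int[image_measure P mxi \x U]_z h z).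
  apply: eq_measure_integral => A mA _; exact/esym/product_measure_unique.
rewrite fubini_tonelli1// ge0_integral_image_measure//.
- exact: measurable_fun_fubini_tonelli_F.
- by move=> x; exact: integral_ge0.
Qed.

End IndependentPair.

Section Marks.
Context d (T : measurableType d) (R : realType) (P : probability T R).
Context (X : nat -> T -> R * R) (Th : nat -> T -> R).
Hypothesis mX : forall i, measurable_fun [set: T] (X i).
Hypothesis hTh : iid_uniform_marks_indep P X Th.
Variable pp : (- pi < pi :> R)%R.
Local Open Scope ereal_scope.

Let mTh i : measurable_fun [set: T] (Th i). Proof. by have [] := hTh. Qed.

Lemma unif_piE (A : set R) : measurable A ->
  lebesgue_measure (A `&` `[(- pi)%R, pi%R[) / (2 * pi)%:E = unif pp A.
Proof.
move=> mA.
transitivity (\int[unif pp]_x (\1_A x)%:E); last by rewrite integral_indic// setIT.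
rewrite integral_unif//; try by apply/measurable_EFinP.
rewrite integral_itvcc_co//; try by apply/measurable_EFinP.
rewrite integral_indic// muleC inver.
rewrite (_ : pi - - pi = 2 * pi :> R)%R; last by ring.
by rewrite gt_eqF ?mulr_gt0 ?pi_gt0.
Qed.

(** A pi-system generating the sigma-algebra of all positions and the first [K] marks. *)
Definition marked_events (K : nat) : set (set T) :=
  [set F | exists E, exists A : nat -> set R,
    [/\ sigma_of_points X E, forall i, measurable (A i) &
       F = E `&` \bigcap_(i in [set i | (i < K)%N]) Th i @^-1` A i]].

Lemma sigma_of_points_measurable E : sigma_of_points X E -> measurable E.
Proof.
apply: smallest_sub; first exact: sigma_algebra_measurable.
move=> _ [i _ [B mB <-]]; rewrite -[X in measurable X]setTI; exact: mX.
Qed.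

Let bigcap_lt (K : nat) (A : nat -> set R) :
  \bigcap_(i in [set i | (i < K)%N]) Th i @^-1` A i =
  \bigcap_(i in [set i | i \in iota 0 K]) Th i @^-1` A i.
Proof. by congr bigcap; apply/seteqP; split=> i /=; rewrite mem_iota add0n. Qed.

Lemma measurable_marked_events K F : marked_events K F -> measurable F.
Proof.
move=> [E [A [sE mA ->]]]; apply: measurableI; first exact: sigma_of_points_measurable.
by apply: bigcap_measurableType => i _; rewrite -[X in measurable X]setTI; exact: mTh.
Qed.

Lemma probability_marked_events K (E : set T) (A : nat -> set R) :
  sigma_of_points X E -> (forall i, measurable (A i)) ->
  P (E `&` \bigcap_(i in [set i | (i < K)%N]) Th i @^-1` A i) =
  P E * \prod_(i < K) unif pp (A i).
Proof.
move=> sE mA; rewrite bigcap_lt; have [_ ->]// := hTh; last exact: iota_uniq.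
congr (_ * _); rewrite -(big_mkord xpredT (fun i => unif pp (A i))) /index_iota subn0.
by apply: eq_bigr => i _; exact: unif_piE.
Qed.

Lemma sigma_of_points_setI : setI_closed (sigma_of_points X).
Proof.
move=> A B sA sB.
exact: (@measurableI _ (g_sigma_algebraType
  (\bigcup_(i in [set: nat]) [set X i @^-1` B | B in @measurable _ (R * R)%type]))).
Qed.

Lemma sigma_of_points_setT : sigma_of_points X setT.
Proof.
exact: (@measurableT _ (g_sigma_algebraType
  (\bigcup_(i in [set: nat]) [set X i @^-1` B | B in @measurable _ (R * R)%type]))).
Qed.

Lemma marked_events_setI K : setI_closed (marked_events K).
Proof.
move=> _ _ [E [A [sE mA ->]]] [E' [A' [sE' mA' ->]]].
exists (E `&` E'), (fun i => A i `&` A' i); split.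
- exact: sigma_of_points_setI.
- by move=> i; exact: measurableI.
apply/seteqP; split=> w /=.
  by move=> [[? h] [? h']]; split=> // i iK; split; [exact: h|exact: h'].
by move=> [[? ?] h]; do 2?split=> //; move=> i iK; have [] := h i iK.
Qed.

(** Both sides are finite measures in [F]. They agree on the pi-system [marked_events], where
    intersecting with an event on mark [K] is again a product event, now with [K + 1] marks. *)
Lemma marked_events_indep K (F : set T) (A : set R) :
  <<s marked_events K >> F -> measurable A ->
  P (F `&` Th K @^-1` A) = P F * unif pp A.
Proof.
move=> sF mA.
have mTA : measurable (Th K @^-1` A) by rewrite -[X in measurable X]setTI; exact: mTh.
have u0 : (0 <= fine (unif pp A))%R by exact: fine_ge0.
have uE : (fine (unif pp A))%:E = unif pp A by rewrite fineK// fin_num_measure.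
pose m1 := mrestr P mTA.
pose m2 := mscale (NngNum u0) P.
suff : m1 F = m2 F by rewrite /m1/= /m2/= /mrestr/= /mscale/= uE muleC.
apply: (@g_sigma_algebra_measure_unique _ _ _ (marked_events K) _ (fun=> setT)) => //.
- exact: measurable_marked_events.
- move=> _; exists setT, (fun=> setT); split=> //; first exact: sigma_of_points_setT.
  by apply/seteqP; split.
- by rewrite bigcup_const.
- exact: marked_events_setI.
- move=> _ [E [B [sE mB ->]]].
  rewrite /m1/= /m2/= /mrestr/= /mscale/= uE probability_marked_events//.
  pose B' i := if i == K then A else B i.
  rewrite (_ : _ `&` _ = E `&` \bigcap_(i in [set i | (i < K.+1)%N]) Th i @^-1` B' i).
    rewrite probability_marked_events//; last by move=> i; rewrite /B'; case: ifP.
    rewrite big_ord_recr/= {2}/B' eqxx muleA muleC; congr (_ * (_ * _)).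
    by apply: eq_bigr => i _; rewrite /B' ltn_eqF.
  rewrite -setIA; congr (_ `&` _); apply/seteqP; split=> w /=.
    move=> [h hA] i /=; rewrite ltnS leq_eqVlt => /predU1P[->|iK].
      by rewrite /B' eqxx.
    by rewrite /B' ltn_eqF//; exact: h.
  move=> h; split.
    by move=> i /= iK; have := h i (ltnW iK); rewrite /B' ltn_eqF.
  by have := h K (ltnSn K); rewrite /B' eqxx.
- by move=> k; rewrite /m1 /mrestr/= (le_lt_trans (probability_le1 _ _))// ?ltry//; exact: measurableI.
Qed.

End Marks.

Section MarkedLaplace.
Context d (T : measurableType d) (R : realType) (P : probability T R).
Context (X : nat -> T -> R * R) (Th : nat -> T -> R).
Hypothesis mX : forall i, measurable_fun [set: T] (X i).
Hypothesis hTh : iid_uniform_marks_indep P X Th.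
Variable pp : (- pi < pi :> R)%R.
Local Open Scope ereal_scope.

Let mTh i : measurable_fun [set: T] (Th i). Proof. by have [] := hTh. Qed.

Definition average_mark (w : (R * R) * R -> R) (x : R * R) : R :=
  fine (\int[unif pp]_t (w (x, t))%:E).

Section fixed_weight.
Variable w : (R * R) * R -> R.
Hypotheses (mw : measurable_fun [set: (R * R) * R] w) (w01 : forall y, (0 <= w y <= 1)%R).

Let mEw : measurable_fun [set: (R * R) * R] (fun y => (w y)%:E).
Proof. exact/measurable_EFinP. Qed.

Let w0 y : 0 <= (w y)%:E. Proof. by rewrite lee_fin; have /andP[] := w01 y. Qed.

Lemma average_markE x : (average_mark w x)%:E = \int[unif pp]_t (w (x, t))%:E.
Proof.
rewrite fineK// ge0_fin_numE ?integral_ge0//.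
apply: (@le_lt_trans _ _ (\int[unif pp]_t (cst 1 t))); last first.
  by rewrite integral_cst//= probability_setT mul1e ltry.
apply: ge0_le_integral => //.
- exact: (measurableT_comp mEw (pair1_measurable x)).
- by move=> t _; rewrite lee_fin; have /andP[] := w01 (x, t).
Qed.

Lemma average_mark01 x : (0 <= average_mark w x <= 1)%R.
Proof.
rewrite -!lee_fin average_markE integral_ge0//=.
apply: (@le_trans _ _ (\int[unif pp]_t (cst 1 t))); last first.
  by rewrite integral_cst//= probability_setT mul1e.
apply: ge0_le_integral => //.
- exact: (measurableT_comp mEw (pair1_measurable x)).
- by move=> t _; rewrite lee_fin; have /andP[] := w01 (x, t).
Qed.

Lemma measurable_average_mark : measurable_fun [set: R * R] (average_mark w).
Proof.
apply/measurable_EFinP.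
rewrite (_ : _ \o _ = fun x => \int[unif pp]_t (w (x, t))%:E); last first.
  by apply/funext => x /=; rewrite average_markE.
exact: (@measurable_fun_fubini_tonelli_F _ _ _ _ R (unif pp) (fun y => (w y)%:E)).
Qed.

(** Mark [K] is independent of all positions and of the previous marks, so the marks can be averaged
    out one at a time, from the last to the first. *)
Lemma integral_prod_marks N :
  \int[P]_o (\prod_(i < N) w (X i o, Th i o))%:E =
  \int[P]_o (\prod_(i < N) average_mark w (X i o))%:E.
Proof.
pose f K (i : nat) o : R := if (i < K)%N then w (X i o, Th i o) else average_mark w (X i o).
have f0 K i o : (0 <= f K i o)%R.
  rewrite /f; case: ifP => _; first by have /andP[] := w01 (X i o, Th i o).
  by have /andP[] := average_mark01 (X i o).
suff H K : (K <= N)%N -> \int[P]_o (\prod_(i < N) f K i o)%:E =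
    \int[P]_o (\prod_(i < N) average_mark w (X i o))%:E.
  apply: etrans (H N (leqnn N)); apply: eq_integral => o _; congr (_%:E).
  by apply: eq_bigr => i _; rewrite /f ltn_ord.
elim: K => [_|K IH KN]; first by apply: eq_integral.
apply: etrans (IH (ltnW KN)).
(* The space [T] with the smaller sigma-algebra: the identity [T -> S] is the random element of
   which mark [K] is independent, and the other factors are measurable on [S]. *)
pose S := g_sigma_algebraType (marked_events X Th K).
have mid : measurable_fun [set: T] (id : T -> S).
  move=> _ F sF; rewrite setTI preimage_id; move: F sF; apply: smallest_sub.
    exact: sigma_algebra_measurable.
  by move=> F FK; exact: (measurable_marked_events mX hTh FK).
have mXS i : measurable_fun [set: S] (X i : S -> R * R).
  move=> _ B mB; rewrite setTI; apply: sub_sigma_algebra.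
  exists (X i @^-1` B), (fun=> setT); split=> //.
    by apply: sub_sigma_algebra; exists i => //; exists B.
  by rewrite (_ : \bigcap_(i in _) _ = setT) ?setIT//; apply/seteqP; split.
have mThS i : (i < K)%N -> measurable_fun [set: S] (Th i : S -> R).
  move=> iK _ B mB; rewrite setTI; apply: sub_sigma_algebra.
  exists setT, (fun j => if j == i then B else setT); split.
  - exact: sigma_of_points_setT.
  - by move=> j; case: ifP.
  rewrite setTI; apply/seteqP; split=> o /=.
    by move=> Bo j jK /=; case: eqP => // ->.
  by move=> /(_ i iK)/=; rewrite eqxx.
have mfS i : (i < N)%N -> i != K -> measurable_fun [set: S] (f K i : S -> R).
  move=> iN iK; rewrite /f; have [iK'|_] := boolP (i < K)%N.
    by apply: (measurableT_comp mw); apply/measurable_fun_pairP; split;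
      [exact: mXS|exact: mThS].
  exact: (measurableT_comp measurable_average_mark).
pose oK : 'I_N := Ordinal KN.
pose rest (o : S) := (\prod_(i < N | i != oK) f K i o)%R.
have mrest : measurable_fun [set: S] rest.
  rewrite /rest; under eq_fun do rewrite -big_filter.
  have : all (fun i : 'I_N => i != oK) [seq i <- index_enum 'I_N | i != oK].
    exact: filter_all.
  elim: [seq _ <- _ | _] => [_|i s IHs /= /andP[iK sK]].
    by under eq_fun do rewrite big_nil; exact: measurable_cst.
  under eq_fun do rewrite big_cons.
  by apply: measurable_funM; [exact: mfS|exact: IHs].
have rest0 o : (0 <= rest o)%R by exact: prodr_ge0.
pose h (z : S * R) := (w (X K z.1, z.2) * rest z.1)%:E.
have mh : measurable_fun [set: S * R] h.
  apply/measurable_EFinP; apply: measurable_funM; last exact: (measurableT_comp mrest).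
  apply: (measurableT_comp mw); apply/measurable_fun_pairP.
  by split; [exact: (measurableT_comp (mXS K))|exact: measurable_snd].
have h0 z : 0 <= h z.
  by rewrite lee_fin mulr_ge0//; have /andP[] := w01 (X K z.1, z.2).
transitivity (\int[P]_o h (o, Th K o)).
  apply: eq_integral => o _; rewrite /h/= (bigD1 oK)//= {1}/f ltnSn; congr (_ * _)%:E.
  apply: eq_bigr => i iK; rewrite /f ltnS leq_eqVlt.
  by rewrite (_ : (i == K :> nat) = false)//; apply/negbTE.
rewrite (@ge0_integral_indep_pair _ _ _ P _ S id (Th K) mid (mTh K) (unif pp))//; last first.
  by move=> F A mF mA; exact: (marked_events_indep mX hTh).
apply: eq_integral => o _; rewrite /h/= (bigD1 oK)//= {1}/f ltnn.
rewrite mulrC EFinM average_markE.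
rewrite -ge0_integralZl_EFin//; last 2 first.
- exact: (measurableT_comp mEw (pair1_measurable _)).
- exact: prodr_ge0.
by apply: eq_integral => t _; rewrite -EFinM mulrC.
Qed.

End fixed_weight.

End MarkedLaplace.

Section MarkedPoisson.
Context d (T : measurableType d) (R : realType) (P : probability T R).
Context (X : nat -> T -> R * R) (Th : nat -> T -> R) (lam : R).
Hypothesis lam0 : (0 < lam)%R.
Hypothesis hX : is_homogeneous_PPP P X lam.
Hypothesis hTh : iid_uniform_marks_indep P X Th.
Variable pp : (- pi < pi :> R)%R.
Local Open Scope ereal_scope.

Let mX i : measurable_fun [set: T] (X i). Proof. by have [] := hX. Qed.
Let mTh i : measurable_fun [set: T] (Th i). Proof. by have [] := hTh. Qed.

Definition marked (i : nat) (o : T) : (R * R) * R := (X i o, Th i o).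

Lemma measurable_marked i : measurable_fun [set: T] (marked i).
Proof. by apply/measurable_fun_pairP; split; [exact: mX|exact: mTh]. Qed.

Notation mu := (leb2 \x unif pp).

Variable C : set ((R * R) * R).
Hypotheses (mC : measurable C) (Coo : mu C < +oo).

Let m := (lam * fine (mu C))%R.

Let m0 : (0 <= m)%R. Proof. by rewrite mulr_ge0 ?fine_ge0 ?(ltW lam0)//; exact: measure_ge0. Qed.

Let mYC i : measurable (marked i @^-1` C).
Proof. by rewrite -[X in measurable X]setTI; exact: measurable_marked. Qed.

Let mthin (c : R) i : measurable_fun [set: T] (fun o => 1 - c * \1_C (marked i o))%R.
Proof.
apply: measurable_funB => //; apply: measurable_funM => //.
exact: (measurableT_comp (measurable_indic mC) (measurable_marked i)).
Qed.

Let thin01 (c : R) y : (0 <= c <= 1)%R -> (0 <= 1 - c * \1_C y <= 1)%R.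
Proof.
move=> /andP[a b]; rewrite indicE; case: (_ \in _); rewrite ?mulr1 ?mulr0 ?subr0 ?ler01 ?lexx//.
by rewrite subr_ge0 b gerBl a.
Qed.

(** Averaging over the mark leaves at each position [x] the weight [c] times the probability that
    the mark sends [x] into [C]. By Fubini this weight has integral [c] times the measure of [C],
    and [laplace_points] applies to it. *)
Lemma laplace_marked (c : R) : (0 <= c <= 1)%R ->
  \int[P]_o (\prod_(i < N) (1 - c * \1_C (marked i o)))%:E @[N --> \oo]
  --> (expR (- c * m))%:E.
Proof.
move=> c01; pose w y : R := (1 - c * \1_C y)%R.
have mw : measurable_fun [set: (R * R) * R] w.
  apply: measurable_funB => //; apply: measurable_funM => //.
have w01 y : (0 <= w y <= 1)%R by exact: thin01.
have c0 : (0 <= c)%R by have /andP[] := c01.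
pose g x : R := (1 - average_mark pp w x)%R.
have mg : measurable_fun [set: R * R] g.
  by apply: measurable_funB => //; exact: measurable_average_mark.
have gE x : (g x)%:E = c%:E * unif pp (xsection C x).
  have mCx : measurable (xsection C x) by exact: measurable_xsection.
  rewrite /g EFinB average_markE//.
  have -> : \int[unif pp]_t (w (x, t))%:E = 1 - c%:E * unif pp (xsection C x).
    have -> : \int[unif pp]_t (w (x, t))%:E = \int[unif pp]_t (1 - c%:E * (\1_(xsection C x) t)%:E).
      apply: eq_integral => t _; rewrite /w EFinB EFinM; congr (_ - _ * _%:E).
      by rewrite !indicE mem_xsection.
    rewrite integralB//; last 2 first.
    - exact: finite_measure_integrable_cst.
    - by apply: integrableZl => //; exact: integrable_indic.
    rewrite integral_cst//= probability_setT mule1 integralZl//; last exact: integrable_indic.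
    by rewrite integral_indic// setIT.
  have ufin : c%:E * unif pp (xsection C x) \is a fin_num.
    by rewrite fin_numM// fin_num_measure.
  by rewrite -(fineK ufin) -!EFinB opprB addrC subrK.
have g01 x : (0 <= g x <= 1)%R.
  by have /andP[a b] := average_mark01 pp mw w01 x; rewrite subr_ge0 b gerBl a.
have igE : \int[leb2]_x (g x)%:E = c%:E * mu C.
  under eq_integral do rewrite gE.
  rewrite ge0_integralZl_EFin//; exact: (measurable_fun_xsection (unif pp)).
have igoo : \int[leb2]_x (g x)%:E < +oo.
  by rewrite igE lte_mul_pinfty.
have := laplace_points hX lam0 mg g01 igoo.
rewrite igE fineM//; last by rewrite ge0_fin_numE.
rewrite (_ : - lam * (c * fine (mu C)) = - c * m)%R; last by rewrite /m; ring.
under eq_fun.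
  move=> K; under eq_integral.
    move=> o _; under eq_bigr do rewrite /g opprB addrC subrK.
    over.
  rewrite -(integral_prod_marks mX hTh pp mw w01).
  over.
by [].
Qed.

Let one01 : (0 <= (1 : R) <= 1)%R. Proof. by rewrite ler01 lexx. Qed.

(** The case [c = 1]: the product is the indicator that the first [N] marked points avoid [C]. *)
Lemma void_probability :
  P (\bigcap_(i in [set: nat]) ~` (marked i @^-1` C)) = (expR (- m))%:E.
Proof.
set A := \bigcap_(i in _) _.
have mA : measurable A by apply: bigcap_measurableType => i _; exact: measurableC.
have h1 : \int[P]_o (\prod_(i < N) (1 - 1 * \1_C (marked i o)))%:E @[N --> \oo]
    --> (expR (- m))%:E.
  have -> : (- m = - 1 * m)%R by rewrite mulN1r.
  exact: laplace_marked.
have h2 : \int[P]_o (\prod_(i < N) (1 - 1 * \1_C (marked i o)))%:E @[N --> \oo]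
    --> \int[P]_o (\1_A o)%:E.
  apply: (@bounded_cvg _ _ _ P set0) => //.
  - by move=> N; apply: measurable_fun_big_prod.
  - move=> N o; rewrite prodr_ge0/=; last first.
      by move=> i _; have /andP[] := thin01 (marked i o) one01.
    by apply: prodr_ile1 => i _; exact: thin01.
  move=> o _; apply: cvg_near_cst; have [oA|oA] := pselect (A o).
    apply: nearW => N; rewrite indicE mem_set// big1// => i _.
    by rewrite indicE memNset ?mulr0 ?subr0//; exact: oA.
  move/existsNP : (oA) => [i /not_implyP[_ /contrapT oi]].
  exists i.+1 => // N /= iN; rewrite indicE memNset//.
  by rewrite (bigD1 (Ordinal iN))//= indicE mem_set// mulr1 subrr mul0r.
by rewrite -(cvg_lim _ h1)// (cvg_lim _ h2)// integral_indic// setIT.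
Qed.

Let half01 : (0 <= (2^-1 : R) <= 1)%R. Proof. by lra. Qed.

Lemma two_points_probability :
  P [set o | exists i j, [/\ i != j, C (marked i o) & C (marked j o)]] <=
  (m ^+ 2)%:E.
Proof.
set S := [set _ | _].
pose E N := \bigcup_(p in [set p : nat * nat | (p.1 < N)%N && (p.2 < N)%N && (p.1 != p.2)])
  (marked p.1 @^-1` C `&` marked p.2 @^-1` C).
have mE N : measurable (E N).
  rewrite /E bigcup_mkcond; apply: countable_bigcupT_measurable => // p.
  by case: ifP => // _; exact: measurableI.
have EU : S = \bigcup_N E N.
  apply/seteqP; split=> o /=.
    move=> [i [j [ij Ci Cj]]]; exists (maxn i j).+1 => //; exists (i, j) => //=.
    by rewrite !ltnS leq_maxl leq_maxr.
  by move=> [N _ [[i j] /= /andP[_ ij] [Ci Cj]]]; exists i, j.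
pose a c N o : R := (\prod_(i < N) (1 - c * \1_C (marked i o)))%R.
have ma c N : measurable_fun [set: T] (a c N) by exact: measurable_fun_big_prod.
have a0 c N o : (0 <= c <= 1)%R -> (0 <= a c N o)%R.
  by move=> c01; apply: prodr_ge0 => i _; have /andP[] := @thin01 c (marked i o) c01.
have a1 c N o : (0 <= c <= 1)%R -> (a c N o <= 1)%R.
  by move=> c01; apply: prodr_ile1 => i _; exact: thin01.
(* [(1/2)^n] and [0^n] detect [n >= 2] since [1 - 2 (1/2)^n + 0^n] vanishes for
   [n = 0, 1] and is at least [1/2] afterwards *)
have key N o : (\1_(E N) o + 4 * a 2^-1 N o <= 2 + 2 * a 1 N o)%R.
  have [oE|oE] := pselect (E N o).
    rewrite indicE mem_set//; case: oE => -[i j]/= /andP[/andP[iN jN] ij] [Ci Cj].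
    have : (a 2^-1 N o <= 2^-1 * 2^-1)%R.
      rewrite /a (bigD1 (Ordinal iN))//= (bigD1 (Ordinal jN))/=; last first.
        by rewrite -val_eqE/= eq_sym.
      rewrite !indicE !mem_set// mulrA.
      apply: (@le_trans _ _ ((1 - 2^-1 * true%:R) * (1 - 2^-1 * true%:R))%R); last by rewrite mulr1; lra.
      apply: ler_piMr; first by rewrite mulr1; lra.
      by apply: prodr_ile1 => k _; exact: thin01.
    by have := @a0 1%R N o one01; lra.
  rewrite (_ : \1_(E N) o = 0%R); last by rewrite indicE memNset.
  have [[i Ci]|h] := pselect (exists i : 'I_N, C (marked i o)).
    have H c : a c N o = (1 - c)%R.
      rewrite /a (bigD1 i)//= indicE mem_set// mulr1 big1 ?mulr1// => j ji.
      rewrite indicE memNset ?mulr0 ?subr0// => Cj; apply: oE.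
      by exists (nat_of_ord i, nat_of_ord j) => //=; rewrite !ltn_ord/= eq_sym.
    by rewrite !H; lra.
  have H c : a c N o = 1%R.
    rewrite /a big1// => j _; rewrite indicE memNset ?mulr0 ?subr0// => Cj.
    by apply: h; exists j.
  by rewrite !H; lra.
have ikey N : P (E N) + 4%:E * \int[P]_o (a 2^-1 N o)%:E <=
    2%:E + 2%:E * \int[P]_o (a 1 N o)%:E.
  have -> : P (E N) + 4%:E * \int[P]_o (a 2^-1 N o)%:E =
      \int[P]_o (\1_(E N) o + 4 * a 2^-1 N o)%:E.
    under [RHS]eq_integral do rewrite EFinD EFinM.
    rewrite ge0_integralD//; last 3 first.
    - by apply/measurable_EFinP; exact: measurable_indic.
    - by move=> o _; rewrite mule_ge0// lee_fin a0.
    - by apply/measurable_EFinP; apply: measurable_funM.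
    rewrite integral_indic// setIT ge0_integralZl_EFin//; last 2 first.
    - by move=> o _; rewrite lee_fin a0.
    - exact/measurable_EFinP.
  have -> : 2%:E + 2%:E * \int[P]_o (a 1 N o)%:E = \int[P]_o (2 + 2 * a 1 N o)%:E.
    under [RHS]eq_integral do rewrite EFinD EFinM.
    rewrite ge0_integralD//; last 2 first.
    - by move=> o _; rewrite mule_ge0// lee_fin a0.
    - by apply/measurable_EFinP; apply: measurable_funM.
    rewrite integral_cst//= probability_setT mule1 ge0_integralZl_EFin//; last 2 first.
    - by move=> o _; rewrite lee_fin a0.
    - exact/measurable_EFinP.
  apply: ge0_le_integral => //.
  - by move=> o _; rewrite lee_fin addr_ge0 ?indicE// mulr_ge0// a0.
  - apply/measurable_EFinP; apply: measurable_funD; first exact: measurable_indic.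
    exact: measurable_funM.
  - by apply/measurable_EFinP; apply: measurable_funD => //; exact: measurable_funM.
  - by move=> o _; rewrite lee_fin key.
have mUE : measurable (\bigcup_N E N) by exact: bigcupT_measurable.
have l1 : P (E N) @[N --> \oo] --> P (\bigcup_N E N).
  apply: nondecreasing_cvg_mu => // M M' MM'; apply/subsetPset => o [p /= /andP[/andP[p1 p2] p12] Hp].
  by exists p => //=; rewrite (leq_trans p1)// (leq_trans p2).
have l2 := laplace_marked half01.
have l3 := laplace_marked one01.
rewrite EU.
have ufin : P (\bigcup_N E N) \is a fin_num by exact: fin_num_measure.
have : P (\bigcup_N E N) + 4%:E * (expR (- 2^-1 * m))%:E <= 2%:E + 2%:E * (expR (- 1 * m))%:E.
  apply: (@lee_cvg_to _ \oo _ _ (fun N => P (E N) + 4%:E * \int[P]_o (a 2^-1 N o)%:E)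
    (fun N => 2%:E + 2%:E * \int[P]_o (a 1 N o)%:E)); last by apply: nearW => N; exact: ikey.
  - apply: cvgeD; [by rewrite fin_num_adde_defl| exact: l1|].
    by apply: cvgeZl.
  - apply: cvgeD; [by rewrite fin_num_adde_defl| exact: cvg_cst|].
    by apply: cvgeZl.
rewrite -(fineK ufin) -!EFinM -!EFinD !lee_fin.
(* With [x = exp (- m / 2)] the inequality reads [p <= 2 (1 - x)^2], and [1 - x <= m / 2]. *)
set p := fine _; set x := expR (- 2^-1 * m).
have -> : (expR (- 1 * m) = x ^+ 2)%R.
  by rewrite /x -expRM_natl; congr expR; field.
have m2_ge0 : (0 <= m / 2)%R by rewrite divr_ge0.
have x1 : (1 - m / 2 <= x)%R.
  by rewrite /x (le_trans _ (expR_ge1Dx _))// mulNr mulrC.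
have x2 : (x <= 1)%R by rewrite /x -[leRHS]expR0 ler_expR mulNr oppr_le0 mulrC.
move=> H; have : ((1 - x) ^+ 2 <= (m / 2) ^+ 2)%R.
  by rewrite ler_sqr ?nnegrE; lra.
have := sqr_ge0 m; rewrite !expr2 => m2.
by move: H; rewrite !expr2 => H H2; nra.
Qed.

End MarkedPoisson.

(** * Almost sure properties of the configuration *)

Lemma measurable_indicE d (T : measurableType d) {R : realType} (A : set T) :
  measurable A -> measurable_fun [set: T] (fun x => (\1_A x : R)%:E).
Proof. by move=> mA; apply/measurable_EFinP; exact: measurable_indic. Qed.

Section KeyMeasure.
Context {R : realType} (pp : (- pi < pi :> R)%R).
Local Open Scope ereal_scope.
Notation mu := (leb2 \x unif pp).

Lemma sqdist_measure (v t : R) (A : set R) : measurable A ->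
  mu (sqdist v t @^-1` A) = pi%:E * lebR (A `&` `[0%R, +oo[).
Proof.
move=> mA.
have mfA : measurable (sqdist v t @^-1` A).
  by rewrite -[X in measurable X]setTI; exact: measurable_sqdist.
have mF : measurable_fun [set: R * R] (fun z => (\1_A z.1 : R)%:E).
  exact: (measurableT_comp (measurable_indicE mA) measurable_fst).
(* Only one time matters, so the time lag is taken to be 0. *)
have := @key_law R pp (pi_gt0 R) v t 0%R _ mF (fun z => _).
move=> /(_ _) H.
transitivity (\int[mu]_y (\1_A (sqdist v t y))%:E).
  transitivity (\int[mu]_y (\1_(sqdist v t @^-1` A) y)%:E).
    by rewrite (integral_indic _ measurableT mfA) setIT.
  apply: eq_integral => y _; rewrite !indicE.
  have -> : (y \in sqdist v t @^-1` A) = (sqdist v t y \in A).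
    by apply/idP/idP => /set_mem ?; exact: mem_set.
  by [].
rewrite H; last by move=> z; rewrite lee_fin indicE.
congr (_ * _).
under eq_integral do rewrite /= integral_cst//= probability_setT mule1.
by rewrite integral_indic.
Qed.

Lemma sqdist_measure_itv (v t a b : R) : (0 <= a)%R -> (a <= b)%R ->
  mu [set y | a <= sqdist v t y < b]%R = (pi * (b - a))%:E.
Proof.
move=> a0 ab.
rewrite -[LHS]/(mu (sqdist v t @^-1` `[a, b[%classic)) sqdist_measure//.
rewrite setIidl; last first.
  by move=> x /=; rewrite !in_itv/= andbT => /andP[ax _]; exact: le_trans ax.
rewrite lebR_itv lebesgue_measure_itv/= lte_fin.
by case: ltgtP ab => // -> _; rewrite subrr mulr0 mule0.
Qed.

Lemma sqdist_measure_lt (v t b : R) : (0 <= b)%R ->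
  mu [set y | sqdist v t y < b]%R = (pi * b)%:E.
Proof.
move=> b0; transitivity (mu [set y | 0 <= sqdist v t y < b]%R).
  by congr (mu _); apply/seteqP; split=> y /=; rewrite sqdist_ge0.
by rewrite sqdist_measure_itv// subr0.
Qed.

End KeyMeasure.

Section GoodEvents.
Context d (T : measurableType d) (R : realType) (P : probability T R).
Context (X : nat -> T -> R * R) (Th : nat -> T -> R) (lam v : R).
Hypothesis lam0 : (0 < lam)%R.
Hypothesis hX : is_homogeneous_PPP P X lam.
Hypothesis hTh : iid_uniform_marks_indep P X Th.
Local Open Scope ereal_scope.

Let mX i : measurable_fun [set: T] (X i). Proof. by have [] := hX. Qed.
Let mTh i : measurable_fun [set: T] (Th i). Proof. by have [] := hTh. Qed.
Let mY := measurable_marked hX hTh.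

Notation dist i t o := (sqdist v t (marked X Th i o)).

Definition loc_finite : set T :=
  \bigcap_(r in [set: nat]) \bigcup_n count_eq X [set x | nsq x <= r%:R]%R n.

Let mdisc (r : R) : measurable [set x : R * R | nsq x <= r]%R.
Proof.
rewrite -[X in measurable X]setTI.
exact: (measurable_nsq measurableT (measurable_itv `]-oo, r])).
Qed.

Lemma measurable_loc_finite : measurable loc_finite.
Proof.
apply: bigcap_measurableType => r _; apply: bigcupT_measurable => n.
exact: measurable_count_eq.
Qed.

Lemma loc_finite_ae : P (~` loc_finite) = 0.
Proof.
rewrite /loc_finite setC_bigcap.
have mD (r : nat) : measurable (~` \bigcup_n count_eq X [set x | nsq x <= r%:R]%R n).
  by apply: measurableC; apply: bigcupT_measurable => n; exact: measurable_count_eq.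
have D0 (r : nat) : P (~` \bigcup_n count_eq X [set x | nsq x <= r%:R]%R n) = 0.
  rewrite probability_setC; last first.
    by apply: bigcupT_measurable => n; exact: measurable_count_eq.
  rewrite (count_eq_exists_ae hX)// ?subee//.
  by rewrite leb2_disc// ltry.
apply: measure_negligible; first by apply: bigcupT_measurable.
apply: negligible_bigcup => r.
by exists (~` \bigcup_n count_eq X [set x | nsq x <= r%:R]%R n); split; [exact: mD|exact: D0|].
Qed.

(** A station within squared distance [r] at a time of [[- b, b]] started in a fixed disc, which
    contains finitely many. The radius comes from [|x|^2 <= 2 |x + w e|^2 + 2 w^2] for a unit vector
    [e], with [w = v t]. *)
Lemma loc_finite_dist o (r b : R) : loc_finite o ->
  exists N, forall i t, (N <= i)%N -> (`|t| <= b)%R -> (r < dist i t o)%R.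
Proof.
move=> oLF; pose m : nat := (Num.truncn (2 * r + 2 * (v * b) ^+ 2)%R).+1.
have [n _ [s [_ _ hs]]] := oLF m I.
exists (\max_(i <- s) i).+1 => i t iN tb; rewrite ltNge; apply/negP => ir.
have is_ : i \in s.
  apply/hs => /=; apply: (@le_trans _ _ (2 * r + 2 * (v * b) ^+ 2)%R); last first.
    exact/ltW/truncnS_gt.
  have t2 : ((v * t) ^+ 2 <= (v * b) ^+ 2)%R.
    rewrite !exprMn ler_wpM2l ?sqr_ge0// -[leLHS]real_normK ?num_real//.
    by rewrite ler_sqr ?nnegrE// (le_trans _ tb).
  move: ir t2; rewrite /sqdist /nsq/=; set x := (X i o).1; set y := (X i o).2.
  have := cos2Dsin2 (Th i o); set c := cos _; set s' := sin _; set w := (v * t)%R.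
  move=> cs ir t2.
  apply: (@le_trans _ _ (2 * ((x + w * c) ^+ 2 + (y + w * s') ^+ 2) + 2 * w ^+ 2 * (c ^+ 2 + s' ^+ 2))%R).
    rewrite -subr_ge0 [X in (0 <= X)%R](_ : _ = (x + 2 * w * c) ^+ 2 + (y + 2 * w * s') ^+ 2)%R; last by ring.
    by rewrite addr_ge0 ?sqr_ge0.
  by rewrite cs; lra.
by move: iN; rewrite ltnNge => /negP; apply; rewrite (@leq_bigmax_seq _ s xpredT id).
Qed.

Definition ties (t : R) : set T :=
  [set o | exists i j, i != j /\ dist i t o = dist j t o].

Lemma measurable_ties t : measurable (ties t).
Proof.
rewrite (_ : ties t = \bigcup_(p in [set: nat * nat])
   (if p.1 != p.2 then [set o | dist p.1 t o = dist p.2 t o] else set0)).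
  apply: countable_bigcupT_measurable => // p; case: ifP => // _.
  rewrite (_ : [set o | _] = (fun o => dist p.1 t o - dist p.2 t o)%R @^-1` [set 0%R]); last first.
    by apply/seteqP; split=> o /= => [->|/eqP]; [rewrite subrr|rewrite subr_eq0 => /eqP].
  rewrite -[X in measurable X]setTI; apply: measurable_funB => //;
    exact: (measurableT_comp (measurable_sqdist v t) (mY _)).
apply/seteqP; split=> o.
  by move=> [i [j [ij e]]]; exists (i, j) => //=; rewrite ij.
by move=> [[i j] _ /=]; case: ifP => // ij e; exists i, j.
Qed.

(** Squared distances below [r] are cut into [r (n + 1)] cells of width [1 / (n + 1)]. A tie puts
    two stations in one cell, which has probability at most [(k / (n + 1))^2]; the sum over the
    cells is [r k^2 / (n + 1)] and tends to 0. *)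
Lemma ties_ae t : P (ties t) = 0.
Proof.
have pp : (- pi < pi :> R)%R by have := pi_gt0 R; lra.
pose k : R := (lam * pi)%R.
pose Tr (r : nat) := [set o | exists i j,
  [/\ i != j, dist i t o = dist j t o & (dist i t o < r%:R)%R]].
suff T0 r : P.-negligible (Tr r).
  apply: measure_negligible; first exact: measurable_ties.
  apply: (negligibleS _ (negligible_bigcup T0)) => o [i [j [ij e]]].
  exists (Num.truncn (dist i t o)).+1 => //; exists i, j; split=> //.
  exact: truncnS_gt.
pose C n l := [set y | l%:R / n.+1%:R <= sqdist v t y < l.+1%:R / n.+1%:R]%R.
have CE n l : (leb2 \x unif pp) (C n l) = (pi / n.+1%:R)%:E.
  rewrite sqdist_measure_itv ?divr_ge0//.
    by rewrite -mulrBl -natr1 addrAC subrr add0r div1r.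
  by rewrite ler_pM2r ?invr_gt0// ler_nat.
have mC n l : measurable (C n l).
  rewrite -[X in measurable X]setTI.
  exact: (measurable_sqdist v t measurableT
    (measurable_itv `[(l%:R / n.+1%:R), (l.+1%:R / n.+1%:R)[%R)).
pose Z n l := [set o | exists i j, [/\ i != j, C n l (marked X Th i o) & C n l (marked X Th j o)]].
have mZ n l : measurable (Z n l).
  rewrite (_ : Z n l = \bigcup_(p in [set: nat * nat]) (if p.1 != p.2 then
      marked X Th p.1 @^-1` C n l `&` marked X Th p.2 @^-1` C n l else set0)).
    apply: countable_bigcupT_measurable => // p; case: ifP => // _.
    apply: measurableI; rewrite -[X in measurable X]setTI; exact: mY.
  apply/seteqP; split=> o.
    by move=> [i [j [ij a b]]]; exists (i, j) => //=; rewrite ij.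
  by move=> [[i j] _ /=]; case: ifP => // ij [a b]; exists i, j.
have ZP n l : P (Z n l) <= ((k / n.+1%:R) ^+ 2)%:E.
  have Coo : (leb2 \x unif pp) (C n l) < +oo by rewrite CE ltry.
  have := two_points_probability lam0 hX hTh (mC n l) Coo.
  by rewrite CE /= mulrA.
have TZ n : Tr r `<=` \big[setU/set0]_(l < r * n.+1) Z n l.
  move=> o [i [j [ij e ir]]]; rewrite -bigcup_mkord.
  have p0 : (0 <= dist i t o * n.+1%:R)%R by rewrite mulr_ge0// sqdist_ge0.
  have /andP[h1 h2] := truncn_itv p0.
  exists (Num.truncn (dist i t o * n.+1%:R)) => /=.
    by rewrite truncn_lt_nat// natrM ltr_pM2r.
  have H : C n (Num.truncn (dist i t o * n.+1%:R)) (marked X Th i o).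
    by rewrite /C/= ler_pdivrMr// h1 ltr_pdivlMr.
  by exists i, j; split=> //; move: H; rewrite /C/= e.
pose N := \bigcap_n \big[setU/set0]_(l < r * n.+1) Z n l.
have mN : measurable N by apply: bigcap_measurableType => n _; exact: bigsetU_measurable.
exists N; split=> //; last by move=> o oT n _; exact: TZ.
have NP n : P N <= ((r%:R * k ^+ 2) / n.+1%:R)%:E.
  apply: (@le_trans _ _ (P (\big[setU/set0]_(l < r * n.+1) Z n l))).
    by apply: le_measure; rewrite ?inE//; [exact: bigsetU_measurable|exact: bigcap_inf].
  apply: (@le_trans _ _ (\sum_(l < r * n.+1) P (Z n l))).
    by apply: Boole_inequality => l _.
  apply: (@le_trans _ _ (\sum_(l < r * n.+1) ((k / n.+1%:R) ^+ 2)%:E)).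
    by apply: lee_sum => l _.
  rewrite sumEFin lee_fin sumr_const card_ord -[leLHS]mulr_natl natrM.
  rewrite le_eqVlt; apply/orP; left; apply/eqP; field.
  by rewrite addrC natr1.
apply/eqP; rewrite -measure_le0.
have h : ((r%:R * k ^+ 2) / n.+1%:R)%:E @[n --> \oo] --> (0 : \bar R).
  apply: cvg_EFin; first exact: nearW.
  rewrite -(mulr0 (r%:R * k ^+ 2)%R); apply: cvgM; [exact: cvg_cst|exact: cvg_harmonic].
by apply: (cvge_to_ge h); exact: nearW.
Qed.

End GoodEvents.

(** * Probability of a common winner *)

Section GridProbability.
Context d (T : measurableType d) (R : realType) (P : probability T R).
Context d' (S : measurableType d') (Y : nat -> T -> S).
Hypothesis mY : forall i, measurable_fun [set: T] (Y i).
Context (mu : {measure set S -> \bar R}) (lam : R).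
Hypothesis lam0 : (0 < lam)%R.
Local Open Scope ereal_scope.

Let void (A : set S) := \bigcap_(i in [set: nat]) ~` (Y i @^-1` A).

Hypothesis void_probability : forall A, measurable A -> mu A < +oo ->
  P (\bigcap_(i in [set: nat]) ~` (Y i @^-1` A)) = (expR (- (lam * fine (mu A))))%:E.

Variables (q : S -> nat) (D : nat -> set S) (delta : R).
Let C k := q @^-1` [set k].
Hypotheses (mC : forall k, measurable (C k)) (mD : forall k, measurable (D k)).
Hypotheses (Coo : forall k, mu (C k) < +oo) (Doo : forall k, mu (D k) < +oo).
Hypothesis CD : forall k, C k `&` D k = set0.
Hypothesis hdelta : forall k, (lam * fine (mu (C k)) <= delta)%R.

(** In the application [D k] consists of the points beating the lower corner of cell [k], so the
    cell then contains a winner at the precision of the grid. *)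
Definition cell_hit (k : nat) : set T :=
  [set o | (exists i, q (Y i o) = k) /\ forall i, ~ D k (Y i o)].

Hypothesis trivW : trivIset setT cell_hit.

Definition grid_density (y : S) : R :=
  (lam * expR (- (lam * fine (mu (D (q y))))))%R.

Let mvoid A : measurable A -> measurable (void A).
Proof.
move=> mA; apply: bigcap_measurableType => i _; apply: measurableC.
by rewrite -[X in measurable X]setTI; exact: mY.
Qed.

(** Writing the event as a difference of two void events makes its probability accessible. *)
Let cell_hitE k : cell_hit k = void (D k) `\` void (D k `|` C k).
Proof.
apply/seteqP; split=> o /=.
  move=> [[i Ci] nD]; split; first by move=> i' _; exact: nD.
  by move=> /(_ i I); apply; right.
move=> [nD nDC]; have nD' i : ~ D k (Y i o) by exact: nD.
split=> //; apply: contrapT => nC; apply: nDC => i _ [Di|Ci]; first exact: (nD' i).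
by apply: nC; exists i.
Qed.

Lemma measurable_cell_hit k : measurable (cell_hit k).
Proof.
by rewrite cell_hitE; apply: measurableD; apply: mvoid => //; exact: measurableU.
Qed.

Let a k := (lam * fine (mu (D k)))%R.
Let c k := (lam * fine (mu (C k)))%R.

Let c0 k : (0 <= c k)%R.
Proof. by rewrite /c mulr_ge0 ?(ltW lam0)// fine_ge0. Qed.

Lemma cell_hit_probability k : P (cell_hit k) = (expR (- a k) * (1 - expR (- c k)))%:E.
Proof.
have mDC : measurable (D k `|` C k) by exact: measurableU.
have muDC : mu (D k `|` C k) = mu (D k) + mu (C k).
  by rewrite measureU// setIC.
have DCoo : mu (D k `|` C k) < +oo by rewrite muDC lte_add_pinfty.
have sub : void (D k `|` C k) `<=` void (D k).
  by move=> o h i _ Di; apply: (h i I); left.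
transitivity (P (void (D k)) - P (void (D k `|` C k))).
  rewrite cell_hitE measureD//; [|exact: mvoid|exact: mvoid|]; last first.
    by rewrite (le_lt_trans (probability_le1 _ (mvoid (mD k))))// ltry.
  by rewrite setIidr.
rewrite !void_probability// -EFinB; congr (_%:E).
have -> : (lam * fine (mu (D k `|` C k)) = a k + c k)%R.
  by rewrite muDC fineD ?ge0_fin_numE// mulrDr.
by rewrite opprD expRD /a; ring.
Qed.

Let tC : trivIset setT C.
Proof. by move=> i j _ _ [y [<- <-]]. Qed.

Let mq : measurable_fun [set: S] q.
Proof.
move=> _ A _; rewrite setTI.
rewrite (_ : q @^-1` A = \bigcup_(k in A) C k).
  by apply: bigcup_measurable => k _; exact: mC.
by apply/seteqP; split=> y /=; [move=> Ay; exists (q y)|move=> [k Ak ->]].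
Qed.

Lemma measurable_grid_density : measurable_fun [set: S] grid_density.
Proof.
pose f (k : nat) : R := (lam * expR (- (lam * fine (mu (D k)))))%R.
exact: (@measurableT_comp _ _ _ _ _ _ f).
Qed.

Lemma grid_density_ge0 y : (0 <= grid_density y)%R.
Proof. by rewrite mulr_ge0 ?expR_ge0 ?ltW. Qed.

Lemma integral_grid_density :
  \int[mu]_y (grid_density y)%:E = \sum_(k <oo) (expR (- a k) * c k)%:E.
Proof.
have UC : \bigcup_k C k = [set: S].
  by apply/seteqP; split=> // y _; exists (q y).
rewrite -UC ge0_integral_bigcup//; last 2 first.
- rewrite UC; apply/measurable_EFinP; exact: measurable_grid_density.
- by move=> y _; rewrite lee_fin grid_density_ge0.
apply: eq_eseriesr => k _.
transitivity (\int[mu]_(y in C k) (cst (lam * expR (- a k))%:E y)).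
  by apply: eq_integral => y; rewrite inE => Cy; rewrite /grid_density Cy.
rewrite integral_cst//= -[mu (C k)]fineK ?ge0_fin_numE// -EFinM; congr (_%:E).
by rewrite /c; ring.
Qed.

(** Cell by cell, [1 - exp (- c)] lies between [c exp (- c)] and [c], and [c <= delta]. The events
    of different cells are disjoint, so their probabilities add up to a Riemann sum of
    [grid_density]. *)
Lemma grid_probability_bounds :
  (expR (- delta))%:E * \int[mu]_y (grid_density y)%:E <= P (\bigcup_k cell_hit k)
  <= \int[mu]_y (grid_density y)%:E.
Proof.
rewrite measure_semi_bigcup//; last 2 first.
- exact: measurable_cell_hit.
- by apply: bigcupT_measurable; exact: measurable_cell_hit.
rewrite integral_grid_density.
have -> : \sum_(k <oo) P (cell_hit k) = \sum_(k <oo) (expR (- a k) * (1 - expR (- c k)))%:E.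
  by apply: eq_eseriesr => k _; exact: cell_hit_probability.
have h k : (0 <= expR (- a k) * (1 - expR (- c k)))%R.
  by rewrite mulr_ge0 ?expR_ge0// subr_ge0 -[leRHS]expR0 ler_expR oppr_le0.
rewrite -nneseriesZl; last by move=> k _; rewrite lee_fin mulr_ge0 ?expR_ge0 ?c0.
apply/andP; split.
  apply: lee_nneseries => k; first by move=> _ _; rewrite -EFinM lee_fin; apply: mulr_ge0; rewrite ?expR_ge0//; apply: mulr_ge0 => //; exact: expR_ge0.
  move=> _; rewrite -EFinM lee_fin mulrCA ler_wpM2l ?expR_ge0//.
  apply: (@le_trans _ _ (expR (- c k) * c k)%R).
    by rewrite ler_wpM2r// ler_expR lerN2 hdelta.
  rewrite -(ler_pM2l (expR_gt0 (c k))) mulrA -expRD subrr expR0 mul1r.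
  rewrite mulrBr mulr1 -expRD subrr expR0 lerBrDr addrC; exact: expR_ge1Dx.
apply: lee_nneseries => k; first by move=> _ _; rewrite lee_fin.
move=> _; rewrite lee_fin ler_wpM2l ?expR_ge0//.
by have := expR_ge1Dx (- c k); lra.
Qed.

End GridProbability.

Section DyadicFloor.
Context {R : realType}.

(** Powers of two make the grids nested, so that the lower corners increase with [n]. *)
Definition dyadic_index (n : nat) (x : R) : nat := Num.truncn (2 ^+ n * x).
Definition dyadic_floor (n : nat) (x : R) : R := (dyadic_index n x)%:R / 2 ^+ n.

Let p0 n : 0 < 2 ^+ n :> R. Proof. by rewrite exprn_gt0. Qed.

Lemma dyadic_floor_ge0 n x : 0 <= dyadic_floor n x.
Proof. by rewrite divr_ge0// ltW. Qed.

Lemma dyadic_floor_le n x : 0 <= x -> dyadic_floor n x <= x.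
Proof.
move=> x0; rewrite ler_pdivrMr// mulrC.
by have /andP[] : (dyadic_index n x)%:R <= 2 ^+ n * x < (dyadic_index n x).+1%:R;
  first by apply: truncn_itv; rewrite mulr_ge0// ltW.
Qed.

Lemma dyadic_floor_gt n x : 0 <= x -> x - 2 ^- n < dyadic_floor n x.
Proof.
move=> x0; rewrite ltrBlDr /dyadic_floor -[X in _ + X]mul1r -mulrDl natr1 ltr_pdivlMr// mulrC.
by have /andP[] : (dyadic_index n x)%:R <= 2 ^+ n * x < (dyadic_index n x).+1%:R;
  first by apply: truncn_itv; rewrite mulr_ge0// ltW.
Qed.

Lemma dyadic_floor_mono n x y : 0 <= y -> dyadic_floor n x <= y ->
  (dyadic_index n x <= dyadic_index n y)%N.
Proof.
move=> y0; rewrite ler_pdivrMr// mulrC => h.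
by rewrite {2}/dyadic_index truncn_ge_nat// mulr_ge0// ltW.
Qed.

Lemma dyadic_floor_homo x : 0 <= x -> {homo dyadic_floor^~ x : m n / (m <= n)%N >-> m <= n}.
Proof.
move=> x0; apply/nondecreasing_seqP => n.
rewrite [leRHS]/dyadic_floor ler_pdivlMr// [in leLHS]exprS mulrCA divfK ?gt_eqF//.
rewrite -natrM ler_nat /(dyadic_index n.+1 x) truncn_ge_nat; last first.
  by rewrite mulr_ge0// ltW.
rewrite natrM exprS -mulrA ler_pM2l//.
by have := dyadic_floor_le n x0; rewrite ler_pdivrMr// mulrC.
Qed.

Lemma cvg_dyadic_step : 2 ^- n @[n --> \oo] --> (0 : R).
Proof.
have -> : (fun n : nat => 2 ^- n : R) = geometric 1 2^-1.
  by apply/funext => n; rewrite /geometric/= mul1r exprVn.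
by apply: cvg_geometric; rewrite ger0_norm ?invr_ge0// invf_lt1// ltr1n.
Qed.

Lemma dyadic_floor_near x y : 0 <= x -> y < x -> exists n, y < dyadic_floor n x.
Proof.
move=> x0 yx.
have xy0 : 0 < x - y by rewrite subr_gt0.
have /cvgrPdist_lt/(_ _ xy0)[n _ /(_ n (leqnn n))] := cvg_dyadic_step.
rewrite sub0r normrN ger0_norm ?invr_ge0 ?ltW// => h.
by exists n; apply: lt_trans (dyadic_floor_gt n x0); lra.
Qed.

Lemma dyadic_index_preimage n l (S : Type) (f : S -> R) : (forall y, 0 <= f y) ->
  [set y | dyadic_index n (f y) = l] =
  f @^-1` `[(l%:R / 2 ^+ n), (l.+1%:R / 2 ^+ n)[%classic.
Proof.
move=> f0; apply/seteqP; split=> y /=; rewrite in_itv/= ler_pdivrMr// ltr_pdivlMr//.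
  by rewrite mulrC => <-; apply: truncn_itv; rewrite mulr_ge0// ltW.
by rewrite mulrC => h; exact: truncn_def.
Qed.

End DyadicFloor.

Section CommonWinner.
Context d (T : measurableType d) (R : realType) (P : probability T R).
Context d' (S : measurableType d') (Y : nat -> T -> S).
Hypothesis mY : forall i, measurable_fun [set: T] (Y i).
Context (mu : {measure set S -> \bar R}) (lam : R).
Hypothesis lam0 : (0 < lam)%R.
Local Open Scope ereal_scope.
Hypothesis void_probability : forall A, measurable A -> mu A < +oo ->
  P (\bigcap_(i in [set: nat]) ~` (Y i @^-1` A)) = (expR (- (lam * fine (mu A))))%:E.
Variables (f g : S -> R) (c : R).
Hypotheses (mf : measurable_fun [set: S] f) (mg : measurable_fun [set: S] g).
Hypotheses (f0 : forall y, (0 <= f y)%R) (g0 : forall y, (0 <= g y)%R).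
Hypothesis c0 : (0 < c)%R.
Hypothesis mu_f : forall a b, (0 <= a)%R -> (a <= b)%R ->
  mu [set y | a <= f y < b]%R = (c * (b - a))%:E.
Hypothesis mu_g : forall b, (0 <= b)%R -> mu [set y | g y < b]%R < +oo.
Hypothesis int_f : \int[mu]_y (expR (- (lam * c * f y)))%:E < +oo.
Variable N0 : set T.
Hypotheses (mN0 : measurable N0) (PN0 : P N0 = 0).
Hypothesis far : forall o, ~ N0 o -> forall r, exists N, forall i, (N <= i)%N ->
  (r < f (Y i o))%R.

Definition below (r s : R) : set S := [set y | f y < r \/ g y < s]%R.

Definition common_winner : set T :=
  [set o | exists i, forall k, (f (Y i o) <= f (Y k o) /\ g (Y i o) <= g (Y k o))%R].

Lemma measurable_f_itv (a b : R) : measurable [set y | a <= f y < b]%R.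
Proof.
rewrite -[X in measurable X]setTI; exact: (mf measurableT (measurable_itv `[a, b[)).
Qed.

Let mflt (r : R) : measurable [set y | f y < r]%R.
Proof.
rewrite -[X in measurable X]setTI; exact: (mf measurableT (measurable_itv `]-oo, r[)).
Qed.

Let mglt (r : R) : measurable [set y | g y < r]%R.
Proof.
rewrite -[X in measurable X]setTI; exact: (mg measurableT (measurable_itv `]-oo, r[)).
Qed.

Let mu_flt r : (0 <= r)%R -> mu [set y | f y < r]%R = (c * r)%:E.
Proof.
move=> r0; rewrite -[in RHS](subr0 r) -mu_f//; congr (mu _).
by apply/seteqP; split=> y /=; rewrite f0.
Qed.

Lemma measurable_below r s : measurable (below r s).
Proof.
have -> : below r s = [set y | f y < r]%R `|` [set y | g y < s]%R by [].
exact: measurableU.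
Qed.

Lemma mu_below_lty r s : (0 <= r)%R -> (0 <= s)%R -> mu (below r s) < +oo.
Proof.
move=> r0 s0; have -> : below r s = [set y | f y < r]%R `|` [set y | g y < s]%R by [].
apply: le_lt_trans (measureU2 _ _ _) _ => //.
have h1 : mu [set y | f y < r]%R < +oo by rewrite mu_flt// ltry.
exact: (lte_add_pinfty h1 (mu_g s0)).
Qed.

Let fl := @dyadic_floor R.

Let cell n y : nat := pickle (dyadic_index n (f y), dyadic_index n (g y)).

(** Numbers coding no pair belong to empty cells; for them the default [(0, 0)] keeps the corner
    nonnegative and the measure of [D n k] finite. *)
Let corner n (k : nat) : R * R :=
  if unpickle k is Some p then (p.1%:R / 2 ^+ n, p.2%:R / 2 ^+ n)%R else (0, 0)%R.

Let corner_cell n y : corner n (cell n y) = (fl n (f y), fl n (g y)).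
Proof. by rewrite /corner /cell pickleK. Qed.

Let corner_ge0 n k : (0 <= (corner n k).1)%R /\ (0 <= (corner n k).2)%R.
Proof. by rewrite /corner; case: unpickle => [p|]//=; rewrite !divr_ge0// ltW// exprn_gt0. Qed.

Let D n k := below (corner n k).1 (corner n k).2.

Let mcell n k : measurable (cell n @^-1` [set k]).
Proof.
rewrite (_ : _ @^-1` _ = \bigcup_(l in [set: nat]) \bigcup_(m in [set: nat])
   if pickle (l, m) == k then [set y | dyadic_index n (f y) = l] `&`
     [set y | dyadic_index n (g y) = m] else set0); last first.
  apply/seteqP; split=> y.
    move=> /= yk; exists (dyadic_index n (f y)) => //; exists (dyadic_index n (g y)) => //.
    by rewrite ifT//; apply/eqP.
  by move=> [l _ [m _]]; case: ifP => // /eqP lm /= [h1 h2]; rewrite /cell h1 h2.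
apply: bigcupT_measurable => l; apply: bigcupT_measurable => m; case: ifP => // _.
rewrite !dyadic_index_preimage//; apply: measurableI; rewrite -[X in measurable X]setTI.
- exact: mf.
- exact: mg.
Qed.

Let cell_sub n y : cell n @^-1` [set cell n y] `<=`
  [set z | fl n (f y) <= f z < fl n (f y) + 2 ^- n]%R.
Proof.
move=> z /= zy; have : corner n (cell n z) = corner n (cell n y) by rewrite zy.
rewrite !corner_cell => -[<- _]; rewrite dyadic_floor_le//=.
by have := dyadic_floor_gt n (f0 z); rewrite ltrBlDr.
Qed.

Let mu_cell n k : mu (cell n @^-1` [set k]) <= (c * 2 ^- n)%:E.
Proof.
have [h|h] := pselect (exists y, cell n y = k); last first.
  rewrite (_ : _ @^-1` _ = set0) ?measure0 ?lee_fin ?mulr_ge0 ?(ltW c0)// ?invr_ge0 ?exprn_ge0//.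
  by apply/seteqP; split=> // y /= yk; apply: h; exists y.
case: h => y <-.
have fl0 := dyadic_floor_ge0 n (f y).
have e0 : (0 <= 2 ^- n :> R)%R by rewrite invr_ge0 exprn_ge0.
have -> : (c * 2 ^- n = c * ((fl n (f y) + 2 ^- n) - fl n (f y)))%R by rewrite addrAC subrr add0r.
rewrite -mu_f ?lerDl//; apply: le_measure; rewrite ?inE//.
exact: measurable_f_itv.
Qed.

Let W n := cell_hit Y (cell n) (D n).

(** If two cells are hit, neither point beats the lower corner of the cell of the other, which
    forces both dyadic indices to agree. *)
Let trivW n : trivIset setT (W n).
Proof.
move=> k1 k2 _ _ [ o []]; case=> [[i <-] nD]; case=> [[j <-] nD'].
have H (h : S -> R) : (forall y, 0 <= h y)%R ->
    ~ (h (Y i o) < fl n (h (Y j o)))%R -> ~ (h (Y j o) < fl n (h (Y i o)))%R ->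
    dyadic_index n (h (Y i o)) = dyadic_index n (h (Y j o)).
  move=> h0 /negP; rewrite -leNgt => ab /negP; rewrite -leNgt => ba.
  by apply/eqP; rewrite eqn_leq !dyadic_floor_mono.
rewrite /cell; congr pickle; congr pair; apply: H => //.
- by move=> lt; apply: (nD' i); rewrite /D corner_cell; left.
- by move=> lt; apply: (nD j); rewrite /D corner_cell; left.
- by move=> lt; apply: (nD' i); rewrite /D corner_cell; right.
- by move=> lt; apply: (nD j); rewrite /D corner_cell; right.
Qed.

Let U n := \bigcup_k W n k.

Let UE n o : U n o <-> exists i, forall k,
  (fl n (f (Y i o)) <= f (Y k o))%R /\ (fl n (g (Y i o)) <= g (Y k o))%R.
Proof.
split.
  move=> [_ _ [[i <-] nD]]; exists i => k; rewrite !leNgt; split; apply/negP => lt.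
    by apply: (nD k); rewrite /D corner_cell; left.
  by apply: (nD k); rewrite /D corner_cell; right.
move=> [i h]; exists (cell n (Y i o)) => //; split; first by exists i.
move=> k; rewrite /D corner_cell => -[]/=; have [h1 h2] := h k.
  by rewrite ltNge h1.
by rewrite ltNge h2.
Qed.

Let mU n : measurable (U n).
Proof.
apply: bigcupT_measurable => k; apply: measurable_cell_hit => // j.
exact: measurable_below.
Qed.

Lemma measurable_common_winner : measurable common_winner.
Proof.
rewrite (_ : common_winner = \bigcup_(i in [set: nat]) \bigcap_(k in [set: nat])
  ([set o | f (Y i o) <= f (Y k o)]%R `&` [set o | g (Y i o) <= g (Y k o)]%R)).
  have H (h : S -> R) i k : measurable_fun [set: S] h ->
      measurable [set o | h (Y i o) <= h (Y k o)]%R.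
    move=> mh; rewrite (_ : [set o | _] = (fun o => h (Y k o) - h (Y i o))%R @^-1` `[0%R, +oo[%classic).
      rewrite -[X in measurable X]setTI; apply: measurable_funB => //;
      exact: (measurableT_comp mh (mY _)).
    by apply/seteqP; split=> o /=; rewrite in_itv/= subr_ge0 andbT.
  by apply: bigcupT_measurable => i; apply: bigcap_measurableType => k _; apply: measurableI; exact: H.
apply/seteqP; split=> o /=.
  by move=> [i h]; exists i => // k _; exact: h.
by move=> [i _ h]; exists i => k; have := h k I.
Qed.

(** Without a common winner, each point is refuted from some grid level on, because its strict
    defeat by another point survives a fine enough rounding. Points of large index are too far to
    qualify at any level, so finitely many levels have to be compared. *)
Let cvg_U : P (U n) @[n --> \oo] --> P common_winner.
Proof.
have iE A : measurable A -> P A = \int[P]_o (\1_A o)%:E.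
  by move=> mA; rewrite integral_indic// setIT.
rewrite (iE _ measurable_common_winner); under eq_fun do rewrite iE//.
apply: (@bounded_cvg _ _ _ P N0 (fun n o => \1_(U n) o) (fun o => \1_common_winner o)) => //.
- move=> n; exact: measurable_indic.
- exact: (measurable_indic measurable_common_winner).
- by move=> n o; rewrite indicE; case: (_ \in _); rewrite ?ler01 ?lexx.
move=> o oN; apply: cvg_near_cst.
have [oc|oc] := pselect (common_winner o).
  apply: nearW => n; rewrite !indicE !mem_set//; apply/UE.
  by case: oc => i h; exists i => k; have [h1 h2] := h k; split;
    [exact: le_trans (dyadic_floor_le _ _) h1|exact: le_trans (dyadic_floor_le _ _) h2].
(* The margin [1] covers the rounding error [2^-m] at every level. *)
have [N farN] := far oN (f (Y 0%N o) + 1)%R.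
pose good n i := forall k, (fl n (f (Y i o)) <= f (Y k o))%R /\ (fl n (g (Y i o)) <= g (Y k o))%R.
have bad i : exists n, forall m, (n <= m)%N -> ~ good m i.
  move: oc => /forallNP/(_ i)/existsNP[k /not_andP].
  move=> -[/negP|/negP]; rewrite -ltNge => lt.
    have [n hn] := dyadic_floor_near (f0 _) lt; exists n => m nm /(_ k)[+ _].
    by apply/negP; rewrite -ltNge (lt_le_trans hn)// dyadic_floor_homo.
  have [n hn] := dyadic_floor_near (g0 _) lt; exists n => m nm /(_ k)[_].
  by apply/negP; rewrite -ltNge (lt_le_trans hn)// dyadic_floor_homo.
have [n hn] : exists n, forall i m, (i < N)%N -> (n <= m)%N -> ~ good m i.
  elim: (N) => [|N' [n hn]]; first by exists 0%N.
  have [n' hn'] := bad N'; exists (maxn n n') => i m; rewrite ltnS leq_eqVlt.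
  move=> /predU1P[->|iN']; rewrite geq_max => /andP[h1 h2]; first exact: hn'.
  exact: hn.
exists n => // m /= nm; rewrite !indicE !memNset// => /UE[i gi].
have [iN|Ni] := ltnP i N; first exact: (hn i m).
have := farN i Ni; have [+ _] := gi 0%N; have := dyadic_floor_gt m (f0 (Y i o)).
have : (2 ^- m <= 1 :> R)%R by rewrite invf_le1 ?exprn_gt0// exprn_ege1// ler1n.
by rewrite /fl; lra.
Qed.

Let J n := \int[mu]_y (grid_density mu lam (cell n) (D n) y)%:E.

Let bounds n : (expR (- (lam * c * 2 ^- n)))%:E * J n <= P (U n) <= J n.
Proof.
apply: grid_probability_bounds => //.
- by move=> k; exact: measurable_below.
- by move=> k; apply: le_lt_trans (mu_cell n k) _; rewrite ltry.
- by move=> k; apply: mu_below_lty; have [] := corner_ge0 n k.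
- move=> k; apply/seteqP; split=> // y /= [yk]; rewrite /D -yk corner_cell => -[]/=.
    by rewrite ltNge dyadic_floor_le.
  by rewrite ltNge dyadic_floor_le.
- move=> k; rewrite -mulrA ler_pM2l//.
  have := mu_cell n k; rewrite -[X in X <= _]fineK ?lee_fin//.
  by rewrite ge0_fin_numE// (le_lt_trans (mu_cell n k))// ltry.
- exact: trivW.
Qed.

Definition winner_density (y : S) : R :=
  (lam * expR (- (lam * fine (mu (below (f y) (g y))))))%R.

Let densE n y : grid_density mu lam (cell n) (D n) y =
  (lam * expR (- (lam * fine (mu (below (fl n (f y)) (fl n (g y)))))))%R.
Proof. by rewrite /grid_density /D corner_cell. Qed.

(** The strict inequalities in [below] make it the increasing union of its versions at the rounded
    thresholds, so continuity from below applies. *)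
Let below_near y : mu (below (fl n (f y)) (fl n (g y))) @[n --> \oo] --> mu (below (f y) (g y)).
Proof.
rewrite (_ : below (f y) (g y) = \bigcup_n below (fl n (f y)) (fl n (g y))); last first.
  apply/seteqP; split=> z /=.
    move=> [/(dyadic_floor_near (f0 y))[n h]|/(dyadic_floor_near (g0 y))[n h]]; exists n => //.
      by left.
    by right.
  move=> [n _ [h|h]]; [left|right]; apply: lt_le_trans h _; exact: dyadic_floor_le.
apply: nondecreasing_cvg_mu.
- by move=> n; exact: measurable_below.
- by apply: bigcupT_measurable => n; exact: measurable_below.
- move=> m n mn; apply/subsetPset => z [h|h]; [left|right];
    apply: lt_le_trans h _; exact: dyadic_floor_homo.
Qed.

Let cvg_dens y : grid_density mu lam (cell n) (D n) y @[n --> \oo] --> winner_density y.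
Proof.
under eq_fun do rewrite densE.
apply: cvgM; first exact: cvg_cst.
apply: (@cvg_comp _ _ _ (fun n => - (lam * fine (mu (below (fl n (f y)) (fl n (g y))))))%R expR);
  last exact: continuous_expR.
apply: cvgN; apply: cvgM; first exact: cvg_cst.
apply: (@fine_cvg _ _ _ _ (fun n => mu (below (fl n (f y)) (fl n (g y))))).
rewrite fineK; first exact: below_near.
by rewrite ge0_fin_numE// mu_below_lty.
Qed.

Let mdens n : measurable_fun [set: S] (fun y => (grid_density mu lam (cell n) (D n) y)%:E).
Proof. by apply/measurable_EFinP; exact: measurable_grid_density. Qed.

(** A bound for all levels at once: rounding loses at most 1, so the excluded set has measure at
    least [c (f y - 1)]. This produces the factor [exp (lam c)]. *)
Let dom y : R := (lam * expR (lam * c) * expR (- (lam * c * f y)))%R.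

Let dens_dom n y : `|(grid_density mu lam (cell n) (D n) y)%:E| <= (dom y)%:E.
Proof.
rewrite gee0_abs ?lee_fin ?grid_density_ge0// densE /dom -mulrA ler_pM2l// -expRD ler_expR.
have h : (c * (f y - 1) <= fine (mu (below (fl n (f y)) (fl n (g y)))))%R.
  rewrite -lee_fin fineK; last by rewrite ge0_fin_numE// mu_below_lty// dyadic_floor_ge0.
  apply: (@le_trans _ _ (mu [set z | f z < fl n (f y)]%R)).
    rewrite mu_flt ?dyadic_floor_ge0// lee_fin ler_pM2l//.
    have : (2 ^- n <= 1 :> R)%R by rewrite invf_le1 ?exprn_gt0// exprn_ege1// ler1n.
    by have := dyadic_floor_gt n (f0 y); rewrite /fl; lra.
  by apply: le_measure; rewrite ?inE//; [exact: measurable_below|left].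
rewrite -subr_ge0 (_ : _ - _ = lam * (fine (mu (below (fl n (f y)) (fl n (g y)))) - c * (f y - 1)))%R; last by ring.
by rewrite mulr_ge0 ?(ltW lam0)// subr_ge0.
Qed.

Let int_dom : mu.-integrable setT (fun y => (dom y)%:E).
Proof.
have mexp : measurable_fun [set: S] (fun y => (expR (- (lam * c * f y)))%:E).
  apply/measurable_EFinP; apply: measurableT_comp => //; apply: measurable_funN => //.
  exact: measurable_funM.
apply/integrableP; split.
  by apply/measurable_EFinP; apply: measurable_funM => //; exact/measurable_EFinP.
under eq_integral.
  move=> y _; rewrite gee0_abs; last by rewrite lee_fin !mulr_ge0 ?expR_ge0 ?ltW.
  rewrite /dom EFinM; over.
rewrite ge0_integralZl_EFin//; last by rewrite mulr_ge0 ?expR_ge0 ?ltW.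
rewrite lte_mul_pinfty// lee_fin mulr_ge0 ?expR_ge0 ?ltW//.
Qed.

Let cvg_J : J n @[n --> \oo] --> \int[mu]_y (winner_density y)%:E.
Proof.
apply: (@dominated_cvg _ _ _ mu _ measurableT
  (fun n y => (grid_density mu lam (cell n) (D n) y)%:E) (fun y => (winner_density y)%:E)
  (fun y => (dom y)%:E)) => //.
by move=> y _; apply: cvg_EFin; [exact: nearW|exact: cvg_dens].
Qed.

(** The two bounds on [P (U n)] differ by the factor [exp (- lam c 2^-n)], which tends to 1, and the
    integrals [J n] converge by domination. *)
Lemma common_winner_probability :
  P common_winner = \int[mu]_y (winner_density y)%:E.
Proof.
have cvgJP : P (U n) @[n --> \oo] --> \int[mu]_y (winner_density y)%:E.
  apply: (squeeze_cvge (f := fun n => (expR (- (lam * c * 2 ^- n)))%:E * J n) (h := J)).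
  - by apply: nearW => n; exact: bounds.
  - rewrite -[X in _ --> X]mul1e; apply: cvgeM; last exact: cvg_J.
      by rewrite mule_defE eqe oner_eq0/= andbF.
    have -> : 1 = (expR (0 : R))%:E by rewrite expR0.
    apply: cvg_EFin; first exact: nearW.
    apply: (@cvg_comp _ _ _ (fun n => - (lam * c * 2 ^- n))%R expR);
      last exact: continuous_expR.
    rewrite -oppr0; apply: cvgN; rewrite -(mulr0 (lam * c)%R); apply: cvgM; first exact: cvg_cst.
    exact: cvg_dyadic_step.
  - exact: cvg_J.
by rewrite -(cvg_lim _ cvg_U)// (cvg_lim _ cvgJP).
Qed.

End CommonWinner.

(** * Asymptotics of the winner integral *)

Section CosGap.
Context {R : realType} (p0 : (0 < pi :> R)%R).
Local Open Scope ereal_scope.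

Lemma integral_unif_cst (a b : R) (ab : (a < b)%R) (c : R) :
  \int[unif ab]_x c%:E = c%:E.
Proof.
rewrite integral_cst//; transitivity (c%:E * 1); last exact: mule1.
by congr (_ * _); exact: (@probability_setT _ _ _ (unif ab)).
Qed.

Definition cos_gap (u w : R) : R := Num.max 0%R (cos u - cos w)%R.

Lemma cos_gap_ge0 u w : (0 <= cos_gap u w)%R.
Proof. by rewrite /cos_gap le_max lexx. Qed.

Lemma cos_gap_le2 u w : (cos_gap u w <= 2)%R.
Proof.
rewrite /cos_gap ge_max; have := cos_le1 u; have := cos_geN1 w; lra.
Qed.

Lemma measurable_cos_gap : measurable_fun [set: R * R] (fun z => cos_gap z.1 z.2).
Proof.
apply: measurable_maxr => //; apply: measurable_funB; exact: measurable_funcos.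
Qed.

Lemma measurable_cos_gap2 u : measurable_fun [set: R] (cos_gap u).
Proof. exact: (measurableT_comp measurable_cos_gap (pair1_measurable u)). Qed.

Definition mean_cos_gap (u : R) : R := fine (\int[unif p0]_w (cos_gap u w)%:E).

Lemma mean_cos_gapE u : (mean_cos_gap u)%:E = \int[unif p0]_w (cos_gap u w)%:E.
Proof.
rewrite fineK// ge0_fin_numE; last first.
  by apply: integral_ge0 => w _; rewrite lee_fin cos_gap_ge0.
apply: (@le_lt_trans _ _ (\int[unif p0]_w (2%:E : \bar R))).
  apply: ge0_le_integral => //.
  - by move=> w _; rewrite lee_fin cos_gap_ge0.
  - by apply/measurable_EFinP; exact: measurable_cos_gap2.
  - by move=> w _; rewrite lee_fin cos_gap_le2.
by rewrite integral_unif_cst ltry.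
Qed.

Lemma mean_cos_gap_ge0 u : (0 <= mean_cos_gap u)%R.
Proof. by apply/fine_ge0/integral_ge0 => w _; rewrite lee_fin cos_gap_ge0. Qed.

Lemma mean_cos_gap_le2 u : (mean_cos_gap u <= 2)%R.
Proof.
rewrite -lee_fin mean_cos_gapE -[leRHS](integral_unif_cst p0).
apply: ge0_le_integral => //.
- by move=> w _; rewrite lee_fin cos_gap_ge0.
- by apply/measurable_EFinP; exact: measurable_cos_gap2.
- by move=> w _; rewrite lee_fin cos_gap_le2.
Qed.

Lemma measurable_mean_cos_gap : measurable_fun [set: R] mean_cos_gap.
Proof.
apply/measurable_EFinP.
rewrite (_ : EFin \o _ = fun u => \int[unif p0]_w (cos_gap u w)%:E); last first.
  by apply/funext => u /=; rewrite mean_cos_gapE.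
apply: (@measurable_fun_fubini_tonelli_F _ _ _ _ R (unif p0) (fun z => (cos_gap z.1 z.2)%:E)).
  by apply/measurable_EFinP; exact: measurable_cos_gap.
by move=> z; rewrite lee_fin cos_gap_ge0.
Qed.

(** The cosine decreases on [[0, pi]], so the positive part vanishes for [w < u] and equals the
    plain difference for [w >= u]. *)
Lemma cos_gap_integral u : (0 <= u <= pi)%R ->
  \int[lebR]_(w in `[0%R, pi]) (cos_gap u w)%:E = ((pi - u) * cos u + sin u)%:E.
Proof.
move=> /andP[u0 upi].
rewrite integral_itvcc_co; last 2 first.
- by apply/measurable_EFinP; exact: measurable_cos_gap2.
- by move=> w; rewrite lee_fin cos_gap_ge0.
rewrite (ge0_integral_itv_split u0 upi); last 2 first.
- by apply/measurable_EFinP; exact: measurable_cos_gap2.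
- by move=> w; rewrite lee_fin cos_gap_ge0.
rewrite (_ : \int[lebR]_(x in `[0%R, u[) _ = 0) ?add0e; last first.
  apply: integral0_eq => w /=; rewrite in_itv/= => /andP[w0 wu].
  rewrite /cos_gap max_l// subr_le0; apply: ltW; rewrite ltr_cos// in_itv/=.
    by rewrite w0 (le_trans (ltW wu)).
  by rewrite u0.
rewrite -integral_itvcc_co; last 2 first.
- by apply/measurable_EFinP; exact: measurable_cos_gap2.
- by move=> w; rewrite lee_fin cos_gap_ge0.
rewrite integral_lebR//; last 2 first.
- by apply/measurable_EFinP; apply: measurable_funTS; exact: measurable_cos_gap2.
- by move=> w; rewrite lee_fin cos_gap_ge0.
transitivity (\int[lebesgue_measure]_(w in `[u, pi]) (cos u - cos w)%:E).
  apply: eq_integral => w; rewrite inE/= in_itv/= => /andP[uw wpi].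
  rewrite /cos_gap max_r// subr_ge0.
  move: uw; rewrite le_eqVlt => /predU1P[->//|uw].
  apply: ltW; rewrite ltr_cos// in_itv/= ?wpi ?upi ?u0//.
  by rewrite (le_trans u0 (ltW uw)).
pose F (w : R) := (w * cos u - sin w)%R.
have dF (w : R) : is_derive w (1%R : R) F (cos u - cos w)%R.
  rewrite /F; apply: is_derive_eq.
  rewrite /GRing.scale/=; ring.
have cF : continuous (fun w : R => cos u - cos w)%R.
  by move=> w; apply: cvgB; [exact: cvg_cst|exact: continuous_cos].
rewrite (@integral_FTC _ _ _ _ _ upi cF dF) /F sinpi; congr EFin; ring.
Qed.

Lemma mean_mean_cos_gap : \int[unif p0]_u (mean_cos_gap u)%:E = (4 / (pi : R) ^+ 2)%:E.
Proof.
rewrite integral_unif; last 2 first.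
- by apply/measurable_EFinP; exact: measurable_mean_cos_gap.
- by move=> u; rewrite lee_fin mean_cos_gap_ge0.
rewrite integral_lebR//; last 2 first.
- by apply/measurable_EFinP; apply: measurable_funTS; exact: measurable_mean_cos_gap.
- by move=> u; rewrite lee_fin mean_cos_gap_ge0.
rewrite subr0.
transitivity (((pi : R)^-1)%:E * \int[lebesgue_measure]_(u in `[0%R, pi])
    ((pi : R)^-1 * ((pi - u) * cos u + sin u))%:E).
  congr (_ * _); apply: eq_integral => u; rewrite inE/= in_itv/= => upi.
  rewrite mean_cos_gapE integral_unif; last 2 first.
  - by apply/measurable_EFinP; exact: measurable_cos_gap2.
  - by move=> w; rewrite lee_fin cos_gap_ge0.
  by rewrite subr0 cos_gap_integral.
(* The primitive takes the values [2 / pi] and [- 2 / pi] at the ends; the increment [4 / pi] and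
   the outer factor [1 / pi] give the constant. *)
pose F (u : R) := (pi^-1 * ((pi - u) * sin u - 2 * cos u))%R.
have dF (u : R) : is_derive u (1%R : R) F (pi^-1 * ((pi - u) * cos u + sin u))%R.
  rewrite /F; apply: is_derive_eq.
  rewrite /GRing.scale/=; ring.
have cF : continuous (fun u : R => pi^-1 * ((pi - u) * cos u + sin u))%R.
  move=> u; apply: cvgM; first exact: cvg_cst.
  apply: cvgD; last exact: continuous_sin.
  apply: cvgM; last exact: continuous_cos.
  by apply: cvgB; [exact: cvg_cst|exact: cvg_id].
rewrite (@integral_FTC _ _ _ _ _ (ltW p0) cF dF) /F sinpi cospi sin0 cos0 -EFinM; congr EFin.
rewrite expr2 invfM; ring.
Qed.

End CosGap.

(** * Moments of the exponential law *)

Section ExpMoments.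
Context {R : realType}.
Local Open Scope ereal_scope.

Lemma ge0_integral_scale (c : R) (f : R -> \bar R) : (0 < c)%R ->
  measurable_fun [set: R] f -> (forall x, 0 <= f x) ->
  \int[lebR]_x f x = c%:E * \int[lebR]_x f (c * x)%R.
Proof.
move=> c0 mf f0.
pose s (x : R) := (c * x)%R.
have ms : measurable_fun [set: R] s by apply: measurable_funM.
rewrite -(@ge0_integral_pushforward _ _ _ _ _ s ms lebR setT f)//=.
pose k : {nonneg R} := NngNum (ltW c0).
transitivity (\int[mscale k (image_measure lebR ms)]_x f x); last first.
  by rewrite ge0_integral_mscale.
apply: eq_measure_integral => A mA _ /=.
apply/lebR_unique => // a b ab.
rewrite /mscale/=; transitivity (c%:E * lebR [set` `](a / c)%R, (b / c)%R]%R]).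
  congr (_ * lebR _).
  by apply/seteqP; split=> x /=; rewrite /s !in_itv/= ltr_pdivrMr// ler_pdivlMr// mulrC.
rewrite lebR_itv lebesgue_measure_itv/= lte_fin ltr_pM2r ?invr_gt0//.
case: ltgtP ab => // [ab|->] _; last by rewrite subrr mule0.
by rewrite -EFinB -EFinM -mulrBl mulrC mulfVK// gt_eqF.
Qed.

Variables (k : R) (k0 : (0 < k)%R).

(** The exponential density of rate [k]; for [k = lam * pi] it is the law of the squared distance to
    the closest station. *)
Definition expd (a : R) : R := (k * expR (- (k * a)))%R.

Lemma expd_ge0 a : (0 <= expd a)%R.
Proof. by rewrite mulr_ge0 ?expR_ge0// ltW. Qed.

Lemma measurable_expd : measurable_fun [set: R] expd.
Proof.
apply: measurable_funM => //; apply: measurableT_comp => //; apply: measurable_funN.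
exact: measurable_funM.
Qed.

Let mexpdE D : measurable_fun D (EFin \o expd).
Proof. by apply: measurable_funTS; apply/measurable_EFinP; exact: measurable_expd. Qed.

Lemma integral_expd : \int[lebR]_(a in `[0%R, +oo[) (expd a)%:E = 1.
Proof.
rewrite integral_lebR//; last by move=> a; rewrite lee_fin expd_ge0.
rewrite -(integral_exponential_pdf k0) integral_mkcond; apply: eq_integral => a _.
rewrite /exponential_pdf /restrict/= patchE; case: ifP => // _.
by rewrite /expd -mulNr.
Qed.

Lemma integral_expd_tail (c : R) : (0 <= c)%R ->
  \int[lebR]_(a in `[c, +oo[) (expd a)%:E = (expR (- (k * c)))%:E.
Proof.
move=> c0; rewrite integral_mkcond.
rewrite -(ge0_integral_shift c); last 2 first.
- by apply/(measurable_restrictT _ _).1 => //; exact: mexpdE.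
- by move=> a; apply: erestrict_ge0 => x _; rewrite lee_fin expd_ge0.
transitivity ((expR (- (k * c)))%:E * \int[lebR]_(a in `[0%R, +oo[) (expd a)%:E);
  last by rewrite integral_expd mule1.
rewrite [in RHS]integral_mkcond -ge0_integralZl_EFin//; last 2 first.
- by move=> a _; apply: erestrict_ge0 => x _; rewrite lee_fin expd_ge0.
- by apply/(measurable_restrictT _ _).1 => //; exact: mexpdE.
apply: eq_integral => a _; rewrite /restrict/= !mem_setE !in_itv/= !andbT lerDr.
case: ifP => _; last by rewrite mule0.
by rewrite /expd -EFinM mulrCA -expRD; congr (_ * expR _)%:E; ring.
Qed.

(** Writing [sqrt a] as the length of [[0, sqrt a]] and exchanging the integrals, the exponential
    tail at [b^2] becomes the Gaussian function [exp (- k b^2)]. *)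
Lemma integral_expd_sqrt :
  \int[lebR]_(a in `[0%R, +oo[) (expd a * Num.sqrt a)%:E =
  (Num.sqrt pi / (2 * Num.sqrt k))%:E.
Proof.
pose A : set (R * R) := [set z | 0 <= z.2]%R `&` [set z | z.2 ^+ 2 <= z.1]%R.
have mA : measurable A.
  apply: measurableI.
    rewrite (_ : [set _ | _] = snd @^-1` `[0%R, +oo[%classic); last first.
      by apply/seteqP; split=> z /=; rewrite in_itv/= andbT.
    by rewrite -[X in measurable X]setTI; exact: measurable_snd.
  rewrite (_ : [set _ | _] = (fun z : R * R => z.1 - z.2 ^+ 2)%R @^-1` `[0%R, +oo[%classic); last first.
    by apply/seteqP; split=> z /=; rewrite in_itv/= andbT subr_ge0.
  rewrite -[X in measurable X]setTI; apply: measurable_funB => //.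
  by apply: measurable_funX; exact: measurable_snd.
pose K (z : R * R) : \bar R := (expd z.1 * \1_A z)%:E.
have mK : measurable_fun [set: R * R] K.
  apply/measurable_EFinP; apply: measurable_funM; last exact: measurable_indic.
  exact: (measurableT_comp measurable_expd measurable_fst).
have K0 z : 0 <= K z by rewrite lee_fin mulr_ge0 ?expd_ge0.
transitivity (\int[lebR]_a \int[lebR]_b K (a, b)).
  rewrite integral_mkcond; apply: eq_integral => a _.
  rewrite /restrict/= mem_setE in_itv/= andbT; case: ifPn => a0; last first.
    rewrite integral0_eq// => b _; rewrite /K/= indicE memNset ?mulr0// /A/= => -[_ ba].
    by move: a0; rewrite (le_trans (sqr_ge0 b) ba).
  transitivity (\int[lebR]_b ((expd a)%:E * (\1_`[0%R, Num.sqrt a] b)%:E)).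
    rewrite ge0_integralZl_EFin ?expd_ge0//; last first.
      apply/measurable_EFinP; apply: measurable_indic; exact: measurable_itv.
    rewrite integral_indic//= setIT EFinM; congr (_ * _).
    rewrite lebR_itv lebesgue_measure_itv/= lte_fin.
    case: ltgtP (sqrtr_ge0 a) => // [_|<-] _; by rewrite ?subr0// -EFinB subr0.
  apply: eq_integral => b _; rewrite /K/= -EFinM !indicE; congr (_ * _%:R)%:E.
  congr nat_of_bool; rewrite mem_setE in_itv/=; apply/idP/idP.
    by move=> /andP[b0 ba]; apply/mem_set; split => //=; rewrite -(sqr_sqrtr a0) ler_sqr ?nnegrE ?sqrtr_ge0.
  move=> /set_mem[/= b0]; rewrite b0/= => ba.
  by rewrite -(ger0_norm b0) -sqrtr_sqr ler_wsqrtr.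
rewrite (@fubini_tonelli _ _ _ _ R lebR lebR K)//.
transitivity (\int[lebR]_(b in `[0%R, +oo[) (gauss_fun (Num.sqrt k * b))%:E).
  rewrite [RHS]integral_mkcond; apply: eq_integral => b _.
  rewrite /restrict/= mem_setE in_itv/= andbT; case: ifPn => b0; last first.
    rewrite integral0_eq// => a _; rewrite /K/= indicE memNset ?mulr0// /A/= => -[b0' _].
    by rewrite b0' in b0.
  rewrite /gauss_fun exprMn sqr_sqrtr ?ltW// -integral_expd_tail ?sqr_ge0//.
  rewrite [RHS]integral_mkcond; apply: eq_integral => a _.
  rewrite /K/= indicE /restrict/= mem_setE in_itv/= andbT.
  case: ifPn => ba; first by rewrite mem_set ?mulr1.
  by rewrite memNset ?mulr0// /A/= => -[_]; exact/negP.
have sk : (0 < Num.sqrt k)%R by rewrite sqrtr_gt0.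
have mg : measurable_fun [set: R] ((fun b => (gauss_fun b)%:E) \_ `[0%R, +oo[).
  apply/(measurable_restrictT _ _).1 => //; apply: measurable_funTS.
  by apply/measurable_EFinP; exact: measurable_gauss_fun.
have := integral0y_gauss (R := R); rewrite -integral_lebR//; last 2 first.
- by apply: measurable_funTS; apply/measurable_EFinP; exact: measurable_gauss_fun.
- by move=> b; rewrite lee_fin gauss_fun_ge0.
rewrite integral_mkcond (ge0_integral_scale sk mg); last first.
  by move=> b; apply: erestrict_ge0 => x _; rewrite lee_fin gauss_fun_ge0.
move=> G.
rewrite [LHS]integral_mkcond (_ : \int[lebR]_x _ = ((Num.sqrt k)^-1)%:E * (Num.sqrt pi / 2)%:E).
  by rewrite -EFinM; congr EFin; rewrite invfM; ring.
rewrite -G muleA -EFinM mulVf ?mul1e ?gt_eqF//; apply: eq_integral => b _.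
by rewrite /restrict/= !mem_setE !in_itv/= !andbT pmulr_rge0.
Qed.

End ExpMoments.

Section ExpLinearMoment.
Local Open Scope ereal_scope.

(** From [x exp (- x) <= 1] at [x = k a / 2], half of the exponential decay being kept. The bound is
    crude, but it only multiplies a term of order [w^2]. *)
Lemma integral_expd_linear {R : realType} (k : R) : (0 < k)%R ->
  \int[lebR]_(a in `[0%R, +oo[) (expd k a * a)%:E <= (4 / k)%:E.
Proof.
move=> k0; have k2 : (0 < k / 2)%R by rewrite divr_gt0.
apply: (@le_trans _ _ (\int[lebR]_(a in `[0%R, +oo[) ((4 / k)%:E * (expd (k / 2) a)%:E))).
  apply: ge0_le_integral => //.
  - move=> a; rewrite /= in_itv/= andbT => a0; by rewrite lee_fin mulr_ge0 ?expd_ge0.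
  - apply: measurable_funTS; apply/measurable_EFinP; apply: measurable_funM => //.
    exact: measurable_expd.
  - apply: measurable_funTS; apply/measurable_EFinP; apply: measurable_funM => //.
    exact: measurable_expd.
  - move=> a; rewrite /= in_itv/= andbT => a0; rewrite -EFinM lee_fin /expd.
    rewrite (_ : 4 / k * _ = 2 * expR (- (k / 2 * a)))%R; last by field; rewrite gt_eqF.
    rewrite (_ : - (k * a) = - (k / 2 * a) + - (k / 2 * a))%R; last by field.
    rewrite expRD -subr_ge0.
    set e := expR (- (k / 2 * a)).
    have e0 : (0 < e)%R := expR_gt0 _.
    have : (k / 2 * a * e <= 1)%R.
      rewrite /e expRN ler_pdivrMr ?expR_gt0// mul1r.
      by apply: le_trans (expR_ge1Dx _); rewrite lerDr.
    rewrite (_ : _ - _ = 2 * e * (1 - k / 2 * a * e))%R; last by field.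
    by move=> h; rewrite mulr_ge0 ?subr_ge0// mulr_ge0// ltW.
rewrite ge0_integralZl_EFin//.
- by rewrite integral_expd// mule1.
- by move=> a _; rewrite lee_fin expd_ge0.
- by apply: measurable_funTS; apply/measurable_EFinP; exact: measurable_expd.
- by rewrite divr_ge0// ltW.

Qed.

End ExpLinearMoment.

(** * Comparison of squared distances after a displacement *)

Section Displacement.
Context {R : realType}.
Implicit Types a b w x y c g : R.

(** If a farther station overtakes, the two distances [sqrt a] and [sqrt b] differ by less than
    [2 w]. Replacing [sqrt b] by [sqrt a] in the linear term therefore costs at most [4 w^2]. *)
Lemma displaced_lt a b w c c' : 0 <= a -> a <= b -> 0 <= w -> c' <= 1 -> - 1 <= c' -> c <= 1 ->
  b + 2 * w * (Num.sqrt b * c') + w ^+ 2 < a + 2 * w * (Num.sqrt a * c) + w ^+ 2 ->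
  b < a + 2 * w * Num.sqrt a * Num.max 0 (c - c') + 4 * w ^+ 2.
Proof.
move=> a0 ab w0 c1 c1' c2.
have b0 := le_trans a0 ab.
have x0 := sqrtr_ge0 a; have y0 := sqrtr_ge0 b.
have xy := ler_wsqrtr ab.
rewrite -{1 3}(sqr_sqrtr a0) -{1 3}(sqr_sqrtr b0).
move: (Num.sqrt a) (Num.sqrt b) x0 y0 xy => x y x0 y0 xy h.
set g := Num.max 0 (c - c').
have g0 : 0 <= g by rewrite le_max lexx.
have gc : c - c' <= g by rewrite le_max lexx orbT.
have h1 : y ^+ 2 - x ^+ 2 < 2 * w * (x * (c - c') - (y - x) * c') by lra.
have wx : 0 <= w * x by rewrite mulr_ge0.
have wyx : 0 <= w * (y - x) by rewrite mulr_ge0// subr_ge0.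
have h2 : (y - x) * (y + x) < 2 * w * (y + x) by nra.
have h3 : y - x < 2 * w.
  by rewrite ltNge; apply/negP => h4; move: h2; rewrite ltNge ler_wpM2r// addr_ge0.
have h5 : w * (y - x) <= w * (2 * w) by rewrite ler_wpM2l// ltW.
have h6 : w * x * (c - c') <= w * x * g by rewrite ler_wpM2l.
nra.
Qed.

Lemma lt_displaced a b w c c' : 0 <= a -> a <= b -> 0 <= w -> c' <= 1 -> - 1 <= c' -> c <= 1 ->
  b < a + 2 * w * Num.sqrt a * Num.max 0 (c - c') - 4 * w ^+ 2 ->
  b + 2 * w * (Num.sqrt b * c') + w ^+ 2 < a + 2 * w * (Num.sqrt a * c) + w ^+ 2.
Proof.
move=> a0 ab w0 c1 c1' c2.
have b0 := le_trans a0 ab.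
have x0 := sqrtr_ge0 a; have y0 := sqrtr_ge0 b.
have xy := ler_wsqrtr ab.
rewrite -{1 3}(sqr_sqrtr a0) -{1 2}(sqr_sqrtr b0).
move: (Num.sqrt a) (Num.sqrt b) x0 y0 xy => x y x0 y0 xy.
have yx : x ^+ 2 <= y ^+ 2 by rewrite ler_sqr ?nnegrE.
have wx : 0 <= w * x by rewrite mulr_ge0.
have w2 : 0 <= w ^+ 2 by rewrite sqr_ge0.
(* In the case [c < c'] the maximum is 0 and the hypothesis contradicts [a <= b]. *)
rewrite maxEle; case: ifP => [cc h|_ h]; last by lra.
have h2 : (y - x) * (y + x) <= 2 * w * (y + x) by nra.
have h3 : w * (y - x) <= w * (2 * w).
  have [yx0|x'] := eqVneq (y + x) 0; last first.
    rewrite ler_wpM2l//; move: h2; rewrite ler_pM2r//.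
    by rewrite lt_neqAle eq_sym x' addr_ge0.
  have -> : y - x = 0 by lra.
  by rewrite mulr0 mulr_ge0// mulr_ge0.
have h4 : 0 <= w * (y - x) by rewrite mulr_ge0// subr_ge0.
have h5 : w * (y - x) * c' <= w * (y - x) * 1 by rewrite ler_wpM2l.
nra.
Qed.

End Displacement.

Lemma indic_iff (R : realType) T T' (A : set T) (B : set T') x y :
  (A x <-> B y) -> (\1_A x : R) = \1_B y.
Proof.
move=> [AB BA]; rewrite !indicE; have -> // : (x \in A) = (y \in B).
by apply/idP/idP => /set_mem ?; apply/mem_set; [exact: AB|exact: BA].
Qed.

Section MeasureBelow.
Context {R : realType} (pp : (- pi < pi :> R)%R) (p0 : (0 < pi :> R)%R).
Variables (v t h : R).
Hypothesis w0 : (0 <= v * h)%R.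
Local Open Scope ereal_scope.

Notation mu := (leb2 \x unif pp).
Notation w := (v * h)%R.

Let coef_ge0 a : (0 <= 2 * w * Num.sqrt a)%R.
Proof. by rewrite mulr_ge0 ?sqrtr_ge0// mulr_ge0. Qed.

(** Law of cosines: the squared distance after a move of length [w] from squared distance [a], with
    [u] the angle between position and direction of motion. *)
Definition displaced (a u : R) : R := (a + 2 * w * (Num.sqrt a * cos u) + w ^+ 2)%R.

Lemma measurable_displaced : measurable_fun [set: R * R] (fun z => displaced z.1 z.2).
Proof.
apply: measurable_funD => //; apply: measurable_funD => //.
apply: measurable_funM => //; apply: measurable_funM.
  exact: measurable_funsqrt.
exact: measurable_funcos.
Qed.

(** The set [below] in the coordinates of [key_law], squared distance and angle; the squared
    distance ranges over the half-line only. *)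
Definition overtakers (a b : R) : set (R * R) :=
  [set z | 0 <= z.1 /\ (z.1 < a \/ displaced z.1 z.2 < b)]%R.

Lemma measurable_lt_preimage d (T : measurableType d) (f : T -> R) (a : R) :
  measurable_fun [set: T] f -> measurable [set z | f z < a]%R.
Proof.
move=> mf; rewrite (_ : [set z | _]%R = setT `&` f @^-1` `]-oo, a[%classic); last first.
  by rewrite setTI; apply/seteqP; split=> z /=; rewrite in_itv.
exact: (mf measurableT _ (measurable_itv `]-oo, a[)).
Qed.

Lemma measurable_overtakers a b : measurable (overtakers a b).
Proof.
have -> : overtakers a b = (fst @^-1` `[0%R, +oo[%classic) `&`
    ([set z | z.1 < a]%R `|` [set z | displaced z.1 z.2 < b]%R).
  by apply/seteqP; split=> z [/= h1 h2]; split=> //=; move: h1; rewrite in_itv/= andbT.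
apply: measurableI; first by rewrite -[X in measurable X]setTI; exact: measurable_fst.
apply: measurableU; first exact: (measurable_lt_preimage _ measurable_fst).
exact: (measurable_lt_preimage _ measurable_displaced).
Qed.

(** The angle is kept outermost because for a fixed angle the slice is, up to [4 w^2], an interval
    starting at 0 when [b] is [displaced a u]. *)
Lemma measure_belowE a b :
  mu (below (sqdist v t) (sqdist v (t + h)) a b) =
  pi%:E * \int[unif p0]_u lebR [set a' | overtakers a b (a', u)].
Proof.
set B := below _ _ _ _.
have mB : measurable B by apply: measurable_below; exact: measurable_sqdist.
transitivity (\int[mu]_y (\1_B y)%:E); first by rewrite (integral_indic _ measurableT mB) setIT.
pose C : set (R * R) := [set z | z.1 < a]%R `|` [set z | z.2 < b]%R.
have mC : measurable C.
  by apply: measurableU; [exact: (measurable_lt_preimage _ measurable_fst)|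
    exact: (measurable_lt_preimage _ measurable_snd)].
pose F (z : R * R) : \bar R := (\1_C z)%:E.
transitivity (\int[mu]_y F (sqdist v t y, sqdist v (t + h) y)).
  by apply: eq_integral => y _; congr EFin; apply: indic_iff.
rewrite (@key_law _ pp p0 v t h F); last 2 first.
- exact: measurable_indicE.
- by move=> z; rewrite lee_fin.
congr (_ * _).
have mO := measurable_overtakers a b.
have mK : measurable_fun [set: R * R] (fun z => (\1_(overtakers a b) z : R)%:E).
  exact: measurable_indicE.
transitivity (\int[lebR]_a' \int[unif p0]_u (\1_(overtakers a b) (a', u))%:E).
  rewrite integral_mkcond; apply: eq_integral => a' _.
  rewrite /restrict/= mem_setE in_itv/= andbT; case: ifPn => a0; last first.
    by rewrite integral0_eq// => u _; rewrite indicE memNset// => -[/= a0']; rewrite a0' in a0.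
  apply: eq_integral => u _; congr EFin; apply: indic_iff; split; first by split.
  by case.
rewrite (@fubini_tonelli _ _ _ _ R lebR (unif p0) _ mK)//.
apply: eq_integral => u _.
have mOu : measurable [set a' | overtakers a b (a', u)].
  rewrite -[X in measurable X]setTI.
  exact: (pair2_measurable u measurableT mO).
transitivity (\int[lebR]_a' (\1_[set a' | overtakers a b (a', u)] a')%:E); last first.
  by rewrite integral_indic// setIT.
by apply: eq_integral => a' _; congr EFin; apply: indic_iff.
Qed.

Let lebR_initial (c : R) : lebR `[0%R, c[%classic = (Num.max 0%R c)%:E.
Proof.
rewrite lebR_itv lebesgue_measure_itv/= lte_fin maxElt.
by case: ifP => //; rewrite -EFinB subr0.
Qed.

Let mlebR a b : measurable_fun [set: R] (fun u => lebR [set a' | overtakers a b (a', u)]).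
Proof.
rewrite (_ : (fun u => _) = lebR \o ysection (overtakers a b)); last first.
  apply/funext => u /=; congr (lebR _); apply/seteqP; split=> a' /=; rewrite /ysection/=.
    by move=> ?; exact: mem_set.
  by move/set_mem.
by apply: measurable_fun_ysection; exact: measurable_overtakers.
Qed.

Lemma overtakers_le a u u' : (0 <= a)%R ->
  lebR [set a' | overtakers a (displaced a u) (a', u')] <=
  (a + 2 * w * Num.sqrt a * cos_gap u u' + 4 * w ^+ 2)%:E.
Proof.
move=> a0.
have g0 := cos_gap_ge0 u u'.
have k0 : (0 <= 2 * w * Num.sqrt a * cos_gap u u')%R by rewrite mulr_ge0.
have w2 : (0 <= w ^+ 2)%R by rewrite sqr_ge0.
apply: (@le_trans _ _ (lebR `[0%R, (a + 2 * w * Num.sqrt a * cos_gap u u' + 4 * w ^+ 2)%R[%classic)).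
  apply: le_measure; rewrite ?inE//.
  - rewrite -[X in measurable X]setTI.
    exact: (pair2_measurable u' measurableT (measurable_overtakers _ _)).
  - move=> a' [/= a'0 H]; rewrite in_itv/= a'0/=.
    have [a'a|aa'] := ltP a' a; first by lra.
    case: H => [|H]; first by rewrite ltNge aa'.
    exact: (displaced_lt a0 aa' w0 (cos_le1 _) (cos_geN1 _) (cos_le1 _) H).
by rewrite lebR_initial max_r// !addr_ge0// mulr_ge0.
Qed.

Lemma overtakers_ge a u u' : (0 <= a)%R ->
  (a + 2 * w * Num.sqrt a * cos_gap u u')%:E <=
  lebR [set a' | overtakers a (displaced a u) (a', u')] + (4 * w ^+ 2)%:E.
Proof.
move=> a0.
rewrite -leeBlDr// -EFinB.
apply: (@le_trans _ _ (lebR `[0%R, (a + 2 * w * Num.sqrt a * cos_gap u u' - 4 * w ^+ 2)%R[%classic)).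
  by rewrite lebR_initial lee_fin le_max lexx orbT.
apply: le_measure; rewrite ?inE//.
- rewrite -[X in measurable X]setTI.
  exact: (pair2_measurable u' measurableT (measurable_overtakers _ _)).
- move=> a' /=; rewrite in_itv/= => /andP[a'0 H]; split => //=.
  have [a'a|aa'] := ltP a' a; [by left|right].
  exact: (lt_displaced a0 aa' w0 (cos_le1 _) (cos_geN1 _) (cos_le1 _) H).
Qed.

Let int_gap (k a u : R) : (0 <= k)%R -> (0 <= a)%R ->
  \int[unif p0]_u' (a + k * cos_gap u u')%:E = (a + k * mean_cos_gap p0 u)%:E.
Proof.
move=> k0 a0.
under eq_integral do rewrite EFinD EFinM.
have mg : measurable_fun [set: R] (fun u' => (cos_gap u u')%:E).
  by apply/measurable_EFinP; exact: measurable_cos_gap2.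
rewrite ge0_integralD//; last 2 first.
- by move=> u' _; rewrite mule_ge0 ?lee_fin ?cos_gap_ge0.
- exact: measurable_funeM.
rewrite integral_unif_cst ge0_integralZl_EFin//; last first.
  by move=> u' _; rewrite lee_fin cos_gap_ge0.
by rewrite -mean_cos_gapE.
Qed.

Lemma measure_below_le a u : (0 <= a)%R ->
  mu (below (sqdist v t) (sqdist v (t + h)) a (displaced a u)) <=
  (pi * (a + 2 * w * Num.sqrt a * mean_cos_gap p0 u + 4 * w ^+ 2))%:E.
Proof.
move=> a0; rewrite measure_belowE EFinM lee_wpmul2l ?lee_fin ?pi_ge0//.
have k0 := coef_ge0 a.
have w2 : (0 <= a + 4 * w ^+ 2)%R by rewrite addr_ge0// mulr_ge0// sqr_ge0.
rewrite addrAC -int_gap//.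
apply: ge0_le_integral => //.
- apply/measurable_EFinP; apply: measurable_funD => //; apply: measurable_funM => //.
  exact: measurable_cos_gap2.
- by move=> u' _; rewrite addrAC; exact: overtakers_le.
Qed.

Lemma measure_below_ge a u : (0 <= a)%R ->
  (pi * (a + 2 * w * Num.sqrt a * mean_cos_gap p0 u))%:E <=
  mu (below (sqdist v t) (sqdist v (t + h)) a (displaced a u)) + (pi * (4 * w ^+ 2))%:E.
Proof.
move=> a0; rewrite measure_belowE !EFinM -ge0_muleDr//; last 2 first.
- by apply: integral_ge0 => u' _; exact: measure_ge0.
- by rewrite lee_fin mulr_ge0// sqr_ge0.
rewrite lee_wpmul2l ?lee_fin ?pi_ge0// -EFinM.
have k0 := coef_ge0 a.
have w2 : (0 <= 4 * w ^+ 2)%R by rewrite mulr_ge0// sqr_ge0.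
rewrite -int_gap// -[X in _ <= _ + X](integral_unif_cst p0) -ge0_integralD//.
apply: ge0_le_integral => //.
- by move=> u' _; rewrite lee_fin addr_ge0// mulr_ge0// cos_gap_ge0.
- apply/measurable_EFinP; apply: measurable_funD => //; apply: measurable_funM => //.
  exact: measurable_cos_gap2.
- exact: emeasurable_funD.
- by move=> u' _; exact: overtakers_ge.
Qed.

End MeasureBelow.

(** * Second-order expansion of the winner integral *)

Section Asymptotics.
Context {R : realType} (pp : (- pi < pi :> R)%R) (p0 : (0 < pi :> R)%R).
Variables (lam v t h : R).
Hypotheses (lam0 : (0 < lam)%R) (w0 : (0 <= v * h)%R).
Local Open Scope ereal_scope.

Notation mu := (leb2 \x unif pp).
Notation w := (v * h)%R.
Notation f := (sqdist v t).
Notation g := (sqdist v (t + h)).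
Notation k := (lam * pi)%R.

Let k0 : (0 < k)%R. Proof. by rewrite mulr_gt0. Qed.

Lemma measurable_displaced_comp (F : R * R -> R) : measurable_fun [set: R * R] F ->
  measurable_fun [set: R * R] (fun z => F (z.1, displaced v h z.1 z.2)).
Proof.
move=> mF; apply: (measurableT_comp mF); apply/measurable_fun_pairP.
by split; [exact: measurable_fst|exact: measurable_displaced].
Qed.

Lemma key_law_displaced (F : R * R -> R) :
  measurable_fun [set: R * R] F -> (forall z, 0 <= F z)%R ->
  \int[mu]_y (F (f y, g y))%:E = \int[lebR]_(a in `[0%R, +oo[)
    \int[unif p0]_u (pi * F (a, displaced v h a u))%:E.
Proof.
move=> mF F0.
rewrite (@key_law _ pp p0 v t h (EFin \o F)); last 2 first.
- exact/measurable_EFinP.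
- by move=> z; rewrite lee_fin.
have mD := measurable_displaced_comp mF.
rewrite -ge0_integralZl_EFin ?pi_ge0//; last 2 first.
- by move=> a _; apply: integral_ge0 => u _; rewrite lee_fin.
- apply: measurable_funTS.
  apply: (@measurable_fun_fubini_tonelli_F _ _ _ _ R (unif p0)
    (fun z => (F (z.1, displaced v h z.1 z.2))%:E)).
    exact/measurable_EFinP.
  by move=> z; rewrite lee_fin.
apply: eq_integral => a _.
under [RHS]eq_integral do rewrite EFinM.
rewrite ge0_integralZl_EFin ?pi_ge0//.
- by move=> u _; rewrite lee_fin.
- by apply/measurable_EFinP; exact: (measurableT_comp mD (pair1_measurable a)).
Qed.

Let F (z : R * R) : R := (lam * expR (- (lam * fine (mu (below f g z.1 z.2)))))%R.

Let mF : measurable_fun [set: R * R] F.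
Proof.
apply: measurable_funM => //; apply: measurableT_comp => //; apply: measurable_funN.
apply: measurable_funM => //; apply: measurableT_comp => //.
rewrite (_ : (fun z => _) = fun z => pi%:E *
    \int[unif p0]_u lebR [set a' | overtakers v h z.1 z.2 (a', u)]); last first.
  by apply/funext => z; exact: measure_belowE.
apply: measurable_funeM.
(* The pair of thresholds and the angle are parameters, and [p.2] is the variable being measured:
   measurability in the thresholds follows from that of sections. *)
pose A : set ((R * R) * R * R) := [set p | overtakers v h p.1.1.1 p.1.1.2 (p.2, p.1.2)].
have m1 : measurable_fun [set: (R * R) * R * R] (fun p => p.1.1).
  exact: (measurableT_comp measurable_fst measurable_fst).
have mlt (u1 u2 : (R * R) * R * R -> R) : measurable_fun setT u1 ->
    measurable_fun setT u2 -> measurable [set p | u1 p < u2 p]%R.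
  move=> mu1 mu2; rewrite (_ : [set p | _]%R = [set p | u1 p - u2 p < 0]%R); last first.
    by apply/seteqP; split=> p /=; rewrite subr_lt0.
  by apply: measurable_lt_preimage; exact: measurable_funB.
have mA : measurable A.
  have -> : A = (snd @^-1` `[0%R, +oo[%classic) `&` ([set p | p.2 < p.1.1.1]%R `|`
      [set p | displaced v h p.2 p.1.2 < p.1.1.2]%R).
    by apply/seteqP; split=> p [/= h1 h2]; split=> //=; move: h1; rewrite in_itv/= andbT.
  apply: measurableI; first by rewrite -[X in measurable X]setTI; exact: measurable_snd.
  apply: measurableU; apply: mlt.
  - exact: measurable_snd.
  - exact: (measurableT_comp measurable_fst m1).
  - apply: (measurableT_comp (measurable_displaced v h) (_ : measurable_fun setT (fun p => (p.2, p.1.2)))).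
    apply/measurable_fun_pairP; split; first exact: measurable_snd.
    exact: (measurableT_comp measurable_snd measurable_fst).
  - exact: (measurableT_comp measurable_snd m1).
have mx : measurable_fun [set: (R * R) * R]
    (fun p => lebR [set a' | overtakers v h p.1.1 p.1.2 (a', p.2)]).
  rewrite (_ : (fun p => _) = lebR \o xsection A); last first.
    apply/funext => p /=; congr (lebR _); apply/seteqP; split=> y /=; rewrite /xsection/=.
      by move=> ?; exact: mem_set.
    by move/set_mem.
  exact: (@measurable_fun_xsection _ _ _ _ R lebR A mA).
by apply: (@measurable_fun_fubini_tonelli_F _ _ _ _ R (unif p0) _ mx) => p; exact: measure_ge0.
Qed.

Let F0 z : (0 <= F z)%R. Proof. by rewrite mulr_ge0 ?expR_ge0// ltW. Qed.

Let H (z : R * R) : R := (pi * F (z.1, displaced v h z.1 z.2))%R.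

Let H0 z : (0 <= H z)%R. Proof. by rewrite mulr_ge0 ?pi_ge0. Qed.

Let mH : measurable_fun [set: R * R] H.
Proof. exact: (measurable_funM (measurable_cst pi) (measurable_displaced_comp mF)). Qed.

Let mHa a : measurable_fun [set: R] (fun u => (H (a, u))%:E).
Proof. by apply/measurable_EFinP; exact: (measurableT_comp mH (pair1_measurable a)). Qed.

Let G a := \int[unif p0]_u (H (a, u))%:E.

Let mG : measurable_fun [set: R] G.
Proof.
apply: (@measurable_fun_fubini_tonelli_F _ _ _ _ R (unif p0) (fun z => (H z)%:E)).
  exact/measurable_EFinP.
by move=> z; rewrite lee_fin H0.
Qed.

Let G0 a : 0 <= G a. Proof. by apply: integral_ge0 => u _; rewrite lee_fin. Qed.

Lemma winner_integralE :
  \int[mu]_y (winner_density mu lam f g y)%:E = \int[lebR]_(a in `[0%R, +oo[) G a.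
Proof. exact: (key_law_displaced mF F0). Qed.

(** The exponent contributed by the stations that are better at the second time only; those better
    at the first time contribute [k a]. *)
Let excess a u : R := (lam * fine (mu (below f g a (displaced v h a u))) - k * a)%R.

Let HE a u : H (a, u) = (expd k a * expR (- excess a u))%R.
Proof.
rewrite /H /F /excess /expd/= -!mulrA -expRD mulrCA; congr (lam * (pi * expR _))%R.
ring.
Qed.

Let fin_below a u : (0 <= a)%R -> mu (below f g a (displaced v h a u)) \is a fin_num.
Proof.
move=> a0; rewrite ge0_fin_numE//.
by apply: le_lt_trans (measure_below_le pp p0 t w0 u a0) _; rewrite ltry.
Qed.

Let excess_ge0 a u : (0 <= a)%R -> (0 <= excess a u)%R.
Proof.
move=> a0; rewrite subr_ge0 -mulrA ler_pM2l// -lee_fin fineK ?fin_below//.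
rewrite -(sqdist_measure_lt pp v t a0); apply: le_measure; rewrite ?inE//.
- by apply: measurable_lt_preimage; exact: measurable_sqdist.
- by apply: measurable_below; exact: measurable_sqdist.
- by move=> y /= ya; left.
Qed.

(** The first-order part of [excess], which it approximates within [4 k w^2]. *)
Let slope a u : R := (2 * k * w * mean_cos_gap p0 u * Num.sqrt a)%R.

Let excess_le a u : (0 <= a)%R -> (excess a u <= slope a u + 4 * k * w ^+ 2)%R.
Proof.
move=> a0; have := measure_below_le pp p0 t w0 u a0.
rewrite -[X in X <= _]fineK ?fin_below// lee_fin -(ler_pM2l lam0) /excess /slope.
lra.
Qed.

Let excess_ge a u : (0 <= a)%R -> (slope a u <= excess a u + 4 * k * w ^+ 2)%R.
Proof.
move=> a0; have := measure_below_ge pp p0 t w0 u a0.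
rewrite -[X in _ <= X + _]fineK ?fin_below// lee_fin -(ler_pM2l lam0) /excess /slope.
lra.
Qed.

Let slope_ge0 a u : (0 <= slope a u)%R.
Proof.
rewrite mulr_ge0 ?sqrtr_ge0// mulr_ge0 ?mean_cos_gap_ge0// mulr_ge0//.
by rewrite mulr_ge0// ltW.
Qed.

Let expd0 a : (0 <= expd k a)%R. Proof. exact: expd_ge0. Qed.

Let H_ge a u : (0 <= a)%R ->
  (expd k a <= H (a, u) + expd k a * (4 * k * w ^+ 2 + slope a u))%R.
Proof.
move=> a0; rewrite HE -mulrDr -[leLHS]mulr1 ler_wpM2l//.
have := expR_ge1Dx (- excess a u); have := excess_le u a0; lra.
Qed.

(** The quadratic error is controlled by [excess <= 4 k w sqrt a + 4 k w^2], where the mean cosine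
    gap is bounded by 2; squaring with [(p + q)^2 <= 2 p^2 + 2 q^2] gives the factors 32. *)
Let H_le a u : (0 <= a)%R -> (H (a, u) + expd k a * slope a u <=
  expd k a * (1 + 4 * k * w ^+ 2 + 32 * k ^+ 2 * w ^+ 2 * a + 32 * k ^+ 2 * w ^+ 4))%R.
Proof.
move=> a0; rewrite HE -mulrDr ler_wpM2l//.
have x0 := excess_ge0 u a0; have xle := excess_le u a0; have xge := excess_ge u a0.
move: (excess a u) x0 xle xge => x x0 xle xge.
(* Equivalent to [1 <= (1 - x + x^2) exp x], which follows from [exp x >= 1 + x] and
   [(1 - x + x^2) (1 + x) = 1 + x^3]. *)
have ex : (expR (- x) <= 1 - x + x ^+ 2)%R.
  rewrite expRN -div1r ler_pdivrMr ?expR_gt0//.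
  apply: (@le_trans _ _ ((1 - x + x ^+ 2) * (1 + x))%R).
    rewrite (_ : _ * _ = 1 + x ^+ 3)%R; last by ring.
    by rewrite lerDl exprn_ge0.
  by rewrite ler_wpM2l ?expR_ge1Dx//; nra.
have s4 : (slope a u <= 4 * k * w * Num.sqrt a)%R.
  rewrite ler_wpM2r ?sqrtr_ge0//.
  have := mean_cos_gap_le2 p0 u; have : (0 <= k * w)%R by rewrite mulr_ge0// ltW.
  nra.
have x2 : (x ^+ 2 <= (4 * k * w * Num.sqrt a + 4 * k * w ^+ 2) ^+ 2)%R.
  rewrite ler_sqr ?nnegrE//; first by lra.
  by apply: le_trans x0 (le_trans xle _); rewrite lerD2r.
have x3 : ((4 * k * w * Num.sqrt a + 4 * k * w ^+ 2) ^+ 2 <=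
    32 * k ^+ 2 * w ^+ 2 * a + 32 * k ^+ 2 * w ^+ 4)%R.
  rewrite -[in leRHS](sqr_sqrtr a0) -subr_ge0.
  rewrite (_ : _ - _ = (4 * k * w * Num.sqrt a - 4 * k * w ^+ 2) ^+ 2)%R ?sqr_ge0//; ring.
lra.
Qed.

Let int_slope (p a : R) : (0 <= p)%R -> (0 <= a)%R ->
  \int[unif p0]_u (expd k a * (p + slope a u))%:E =
  (expd k a * p + expd k a * Num.sqrt a * (2 * k * w * (4 / pi ^+ 2)))%:E.
Proof.
move=> p00 a0.
have c0 : (0 <= expd k a * Num.sqrt a * (2 * k * w))%R.
  by rewrite mulr_ge0//; [rewrite mulr_ge0// sqrtr_ge0|rewrite mulr_ge0// mulr_ge0// ltW].
transitivity (\int[unif p0]_u ((expd k a * p)%:E +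
    (expd k a * Num.sqrt a * (2 * k * w))%:E * (mean_cos_gap p0 u)%:E)).
  apply: eq_integral => u _; rewrite -EFinM -EFinD; congr EFin; rewrite /slope; ring.
have mm : measurable_fun [set: R] (fun u => (mean_cos_gap p0 u)%:E).
  by apply/measurable_EFinP; exact: measurable_mean_cos_gap.
rewrite ge0_integralD//; last 3 first.
- by move=> u _; rewrite lee_fin mulr_ge0.
- by move=> u _; rewrite mule_ge0 ?lee_fin ?mean_cos_gap_ge0.
- exact: measurable_funeM.
rewrite integral_unif_cst ge0_integralZl_EFin//; last first.
  by move=> u _; rewrite lee_fin mean_cos_gap_ge0.
by rewrite mean_mean_cos_gap -EFinM -EFinD !mulrA.
Qed.

Let me : measurable_fun [set: R] (expd k). Proof. exact: measurable_expd. Qed.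

Let int_affine (p q r : R) : (0 <= p)%R -> (0 <= q)%R -> (0 <= r)%R ->
  \int[lebR]_(a in `[0%R, +oo[) (expd k a * p + expd k a * Num.sqrt a * q + expd k a * a * r)%:E =
  (p + Num.sqrt pi / (2 * Num.sqrt k) * q)%:E +
    \int[lebR]_(a in `[0%R, +oo[) (expd k a * a)%:E * r%:E.
Proof.
move=> p00 q0 r0.
have D0 : measurable (`[0%R, +oo[%classic : set R) by [].
have ms : measurable_fun [set: R] (fun a => Num.sqrt a) by exact: measurable_funsqrt.
have m1 c : measurable_fun (`[0%R, +oo[%classic : set R) (fun a => (expd k a * c)%:E).
  by apply: measurable_funTS; apply/measurable_EFinP; exact: measurable_funM.
have m2 : measurable_fun (`[0%R, +oo[%classic : set R) (fun a => (expd k a * Num.sqrt a)%:E).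
  by apply: measurable_funTS; apply/measurable_EFinP; exact: measurable_funM.
have m3 : measurable_fun (`[0%R, +oo[%classic : set R) (fun a => (expd k a * a)%:E).
  by apply: measurable_funTS; apply/measurable_EFinP; exact: measurable_funM.
have n3 a : a \in (`[0%R, +oo[%classic : set R) -> (0 <= expd k a * a)%R.
  by rewrite mem_setE in_itv/= andbT => a0; rewrite mulr_ge0.
have n3' a : `[0%R, +oo[%classic a -> 0 <= (expd k a * a)%:E.
  by move=> /mem_set/n3; rewrite lee_fin.
under eq_integral do rewrite !EFinD (EFinM _ q) (EFinM _ r).
rewrite ge0_integralD//; last 4 first.
- move=> a _; apply: adde_ge0; first by rewrite lee_fin mulr_ge0.
  by apply: mule_ge0; rewrite lee_fin// mulr_ge0// sqrtr_ge0.
- by apply: emeasurable_funD => //; exact: emeasurable_funM.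
- by move=> a Da; rewrite mule_ge0// n3'.
- exact: emeasurable_funM.
rewrite ge0_integralD//; last 3 first.
- by move=> a _; rewrite lee_fin mulr_ge0.
- by move=> a _; apply: mule_ge0; rewrite lee_fin// mulr_ge0// sqrtr_ge0.
- exact: emeasurable_funM.
rewrite [X in X + _ + _](_ : _ = p%:E); last first.
  under eq_integral do rewrite EFinM.
  have m0 : measurable_fun (`[0%R, +oo[%classic : set R) (fun a => (expd k a)%:E).
    by apply: measurable_funTS; exact/measurable_EFinP.
  rewrite ge0_integralZr//; last by move=> a _; rewrite lee_fin.
  by rewrite integral_expd// mul1e.
rewrite ge0_integralZr//; last by move=> a _; rewrite lee_fin mulr_ge0// sqrtr_ge0.
rewrite integral_expd_sqrt// ge0_integralZr//.
Qed.

(** The mean of [slope]: the mean of [sqrt a] under the exponential law, times the average over the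
    angle, where [4 / pi^2] is the mean cosine gap. *)
Definition crossing_rate : R := (Num.sqrt pi / (2 * Num.sqrt k) * (2 * k * w * (4 / pi ^+ 2)))%R.

Let rate0 : (0 <= 2 * k * w * (4 / pi ^+ 2))%R.
Proof. by rewrite mulr_ge0 ?divr_ge0 ?sqr_ge0// mulr_ge0// mulr_ge0// ltW. Qed.

Let w2 : (0 <= 4 * k * w ^+ 2)%R.
Proof. by rewrite mulr_ge0 ?sqr_ge0// mulr_ge0// ltW. Qed.

(** [H_ge] integrated over angle and squared distance. The correction terms stand on the right so
    that only nonnegative integrals are added. *)
Lemma winner_integral_ge :
  1 <= \int[mu]_y (winner_density mu lam f g y)%:E + (4 * k * w ^+ 2 + crossing_rate)%:E.
Proof.
have := @int_affine (4 * k * w ^+ 2) _ 0 w2 rate0 (lexx _).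
rewrite mule0 adde0 => <-; rewrite winner_integralE -ge0_integralD//; last 3 first.
- exact: measurable_funTS.
- by move=> a _; rewrite lee_fin mulr0 addr0 addr_ge0// mulr_ge0// mulr_ge0// sqrtr_ge0.
- apply: measurable_funTS; apply/measurable_EFinP; apply: measurable_funD.
    apply: measurable_funD; first exact: measurable_funM.
    by apply: measurable_funM => //; apply: measurable_funM => //; exact: measurable_funsqrt.
  by apply: measurable_funM => //; apply: measurable_funM.
rewrite -(integral_expd k0); apply: ge0_le_integral => //.
- by move=> a _; rewrite lee_fin.
- by apply: measurable_funTS; exact/measurable_EFinP.
- apply: measurable_funTS; apply: emeasurable_funD => //.
  apply/measurable_EFinP; apply: measurable_funD.
    apply: measurable_funD; first exact: measurable_funM.
    by apply: measurable_funM => //; apply: measurable_funM => //; exact: measurable_funsqrt.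
  by apply: measurable_funM => //; apply: measurable_funM.
move=> a /=; rewrite in_itv/= andbT => a0.
rewrite mulr0 addr0 -int_slope// -ge0_integralD//; last 3 first.
- by move=> u _; rewrite lee_fin.
- by move=> u _; rewrite lee_fin mulr_ge0// addr_ge0.
- apply/measurable_EFinP; apply: measurable_funM => //; apply: measurable_funD => //.
  apply: measurable_funM => //; apply: measurable_funM => //.
  exact: measurable_mean_cos_gap.
rewrite -[leLHS](integral_unif_cst p0); apply: ge0_le_integral => //.
- by move=> u _; rewrite lee_fin.
- apply: emeasurable_funD => //.
  apply/measurable_EFinP; apply: measurable_funM => //; apply: measurable_funD => //.
  apply: measurable_funM => //; apply: measurable_funM => //.
  exact: measurable_mean_cos_gap.
- by move=> u _; rewrite lee_fin H_ge.
Qed.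

Lemma winner_integral_le :
  \int[mu]_y (winner_density mu lam f g y)%:E + crossing_rate%:E <=
  (1 + 4 * k * w ^+ 2 + 32 * k ^+ 2 * w ^+ 4 + 128 * k * w ^+ 2)%:E.
Proof.
pose p := (1 + 4 * k * w ^+ 2 + 32 * k ^+ 2 * w ^+ 4)%R.
pose r := (32 * k ^+ 2 * w ^+ 2)%R.
have r0 : (0 <= r)%R by rewrite /r mulr_ge0 ?sqr_ge0// mulr_ge0 ?sqr_ge0.
have pp0 : (0 <= p)%R.
  rewrite /p addr_ge0//; first by rewrite addr_ge0.
  by rewrite mulr_ge0 ?exprn_ge0// mulr_ge0 ?sqr_ge0.
have maff (x y z : R) : measurable_fun [set: R]
    (fun a => (expd k a * x + expd k a * Num.sqrt a * y + expd k a * a * z)%:E).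
  apply/measurable_EFinP; apply: measurable_funD.
    apply: measurable_funD; first exact: measurable_funM.
    by apply: measurable_funM => //; apply: measurable_funM => //; exact: measurable_funsqrt.
  by apply: measurable_funM => //; apply: measurable_funM.
apply: (@le_trans _ _ (p%:E + \int[lebR]_(a in `[0%R, +oo[) (expd k a * a)%:E * r%:E)); last first.
  apply: (@le_trans _ _ (p%:E + (4 / k)%:E * r%:E)).
    by rewrite leeD2l// lee_wpmul2r ?lee_fin// integral_expd_linear.
  (* The constant 128 is 32 times the 4 of the bound [4 / k] on the linear moment. *)
  rewrite -EFinM -EFinD lee_fin /p lerD2l (_ : 4 / k * r = 128 * k * w ^+ 2)%R//.
  rewrite /r (_ : 4 / k * _ = 128 * k * w ^+ 2 * (k^-1 * k))%R; last by ring.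
  by rewrite mulVf ?mulr1// gt_eqF.
have := int_affine pp0 (lexx 0%R) r0; rewrite mulr0 addr0 => <-.
have := int_affine (lexx 0%R) rate0 (lexx 0%R); rewrite mule0 adde0 add0r => <-.
rewrite winner_integralE -ge0_integralD//; last 3 first.
- exact: measurable_funTS.
- by move=> a _; rewrite lee_fin !mulr0 addr0 add0r mulr_ge0// mulr_ge0// sqrtr_ge0.
- exact: measurable_funTS.
apply: ge0_le_integral => //.
- by move=> a _; rewrite adde_ge0// lee_fin !mulr0 addr0 add0r mulr_ge0// mulr_ge0// sqrtr_ge0.
- by apply: measurable_funTS; apply: emeasurable_funD.
- exact: measurable_funTS.
move=> a /=; rewrite in_itv/= andbT => a0.
rewrite (mulr0 (expd k a * a)%R) addr0 -int_slope// -ge0_integralD//; last 3 first.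
- by move=> u _; rewrite lee_fin.
- by move=> u _; rewrite lee_fin mulr_ge0// addr_ge0.
- apply/measurable_EFinP; apply: measurable_funM => //; apply: measurable_funD => //.
  apply: measurable_funM => //; apply: measurable_funM => //.
  exact: measurable_mean_cos_gap.
rewrite -[leRHS](integral_unif_cst p0); apply: ge0_le_integral => //.
- by move=> u _; apply: adde_ge0; rewrite lee_fin// mulr_ge0// addr_ge0.
- apply: emeasurable_funD => //.
  apply/measurable_EFinP; apply: measurable_funM => //; apply: measurable_funD => //.
  apply: measurable_funM => //; apply: measurable_funM => //.
  exact: measurable_mean_cos_gap.
move=> u _; rewrite -EFinD lee_fin add0r; apply: le_trans (H_le u a0) _.
rewrite mulr0 addr0 (_ : _ * p + _ = expd k a * (p + a * r))%R; last by ring.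
by rewrite ler_wpM2l// /p /r; lra.
Qed.

End Asymptotics.

(** * Probability of a change of station *)

Lemma crossing_rateE {R : realType} (lam v h : R) : 0 < lam ->
  crossing_rate lam v h = h * (4 * v * Num.sqrt lam / pi).
Proof.
rewrite /crossing_rate => lam0; have := @pi_gt0 R; move: (pi : R) => q q0.
rewrite (sqrtrM _ (ltW lam0)).
have := sqrtr_gt0 lam; have := sqrtr_gt0 q; rewrite lam0 q0.
have := sqr_sqrtr (ltW lam0); have := sqr_sqrtr (ltW q0).
move: (Num.sqrt lam) (Num.sqrt q) => s r <- <- r0 s0.
by field; rewrite !gt_eqF.
Qed.

Section NoCommonWinner.
Context d (T : measurableType d) (R : realType) (P : probability T R).
Context (X : nat -> T -> R * R) (Th : nat -> T -> R) (lam v : R).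
Hypotheses (lam0 : 0 < lam) (v0 : 0 < v).
Hypothesis hX : is_homogeneous_PPP P X lam.
Hypothesis hTh : iid_uniform_marks_indep P X Th.
Local Open Scope ereal_scope.

Let p0 : (0 < pi :> R)%R. Proof. exact: pi_gt0. Qed.
Let pp : (- pi < pi :> R)%R. Proof. by rewrite gtrN. Qed.
Notation mu := (leb2 \x unif pp).

Definition no_common_winner (t h : R) : set T :=
  ~` common_winner (marked X Th) (sqdist v t) (sqdist v (t + h)).

Lemma measurable_no_common_winner t h : measurable (no_common_winner t h).
Proof.
apply: measurableC; apply: measurable_common_winner.
- exact: measurable_marked hX hTh.
- exact: measurable_sqdist.
- exact: measurable_sqdist.
Qed.

(** By [key_law_displaced] with time lag 0, this is the integral of [pi exp (- lam pi a)] over the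
    half-line, that is [1 / lam]. *)
Let int_exp t : \int[mu]_y (expR (- (lam * pi * sqdist v t y)))%:E < +oo.
Proof.
have lp : (0 < lam * pi :> R)%R by rewrite mulr_gt0.
pose F (z : R * R) : R := expR (- (lam * pi * z.1)).
have mF : measurable_fun [set: R * R] F.
  have m1 : measurable_fun [set: R * R] (fun z => lam * pi * z.1)%R.
    exact: (measurable_funM (measurable_cst (lam * pi)%R) measurable_fst).
  exact: (measurableT_comp (@measurable_expR R) (measurable_funN m1)).
have F0 z : (0 <= F z)%R by exact: expR_ge0.
have -> : \int[mu]_y (expR (- (lam * pi * sqdist v t y)))%:E =
    \int[lebR]_(a in `[0%R, +oo[) \int[unif p0]_u (pi * expR (- (lam * pi * a)))%:E.
  exact: (key_law_displaced pp p0 v t 0 mF F0).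
rewrite (_ : \int[lebR]_(a in _) _ = (lam^-1)%:E * \int[lebR]_(a in `[0%R, +oo[) (expd (lam * pi) a)%:E).
  by rewrite integral_expd// mule1 ltry.
rewrite -ge0_integralZl_EFin ?invr_ge0 ?(ltW lam0)//; last 2 first.
- by move=> a _; rewrite lee_fin expd_ge0.
- by apply: measurable_funTS; apply/measurable_EFinP; exact: measurable_expd.
apply: eq_integral => a _; rewrite integral_unif_cst -EFinM /expd.
by rewrite !mulrA mulVf ?mul1r// gt_eqF.
Qed.

Let common_winner_integral t h :
  P (common_winner (marked X Th) (sqdist v t) (sqdist v (t + h))) =
  \int[mu]_y (winner_density mu lam (sqdist v t) (sqdist v (t + h)) y)%:E.
Proof.
have mN : measurable (~` loc_finite X) by apply: measurableC; exact: (measurable_loc_finite hX).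
have far o : ~ (~` loc_finite X) o -> forall r, exists N, forall i, (N <= i)%N ->
    (r < sqdist v t (marked X Th i o))%R.
  move=> /contrapT lf r; have [N hN] := loc_finite_dist Th v r `|t| lf.
  by exists N => i iN; exact: hN.
have glt b : (0 <= b)%R -> mu [set y | sqdist v (t + h) y < b]%R < +oo.
  by move=> b0; rewrite sqdist_measure_lt// ltry.
exact: (common_winner_probability (measurable_marked hX hTh) lam0
  (fun A mA Aoo => void_probability lam0 hX hTh mA Aoo)
  (measurable_sqdist v t) (measurable_sqdist v (t + h))
  (sqdist_ge0 v t) (sqdist_ge0 v (t + h)) p0 (sqdist_measure_itv pp v t) glt
  (int_exp t) mN (loc_finite_ae lam0 hX) far).
Qed.

(** The constant is chosen before [t] and [h], which allows a sum over all dyadic times; [h <= 1]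
    absorbs the term in [h^4]. *)
Lemma no_common_winner_bounds : exists C, forall t h, (0 <= h)%R -> (h <= 1)%R ->
  (h * (4 * v * Num.sqrt lam / pi) - C * h ^+ 2)%:E <= P (no_common_winner t h)
    <= (h * (4 * v * Num.sqrt lam / pi) + C * h ^+ 2)%:E.
Proof.
exists (4 * (lam * pi) * v ^+ 2 + 32 * (lam * pi) ^+ 2 * v ^+ 4 + 128 * (lam * pi) * v ^+ 2)%R.
move=> t h h0 h1.
have vh : (0 <= v * h)%R by rewrite mulr_ge0// ltW.
have k0 : (0 < lam * pi :> R)%R by rewrite mulr_gt0.
have := winner_integral_ge pp p0 t lam0 vh; have := winner_integral_le pp p0 t lam0 vh.
rewrite -common_winner_integral /no_common_winner probability_setC; last first.
  apply: measurable_common_winner; [exact: measurable_marked hX hTh| |]; exact: measurable_sqdist.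
rewrite -[P (common_winner _ _ _)]fineK ?fin_num_measure//; last first.
  apply: measurable_common_winner; [exact: measurable_marked hX hTh| |]; exact: measurable_sqdist.
move: (fine _) => J; rewrite (_ : 1 - J%:E = (1 - J)%:E)// -!EFinD !lee_fin crossing_rateE//.
move: (lam * pi)%R k0 (h * _)%R => k k0 rh le1 le2.
have h2 : (0 <= h ^+ 2)%R by rewrite sqr_ge0.
have hh : (h ^+ 4 <= h ^+ 2)%R.
  rewrite (_ : h ^+ 4 = h ^+ 2 * h ^+ 2)%R; last by rewrite -exprD.
  by rewrite ler_piMr// exprn_ile1.
have e4 : (0 <= 32 * k ^+ 2 * v ^+ 4)%R by rewrite mulr_ge0 ?exprn_ge0 ?(ltW v0)// mulr_ge0 ?sqr_ge0.
have e4h : (32 * k ^+ 2 * v ^+ 4 * h ^+ 4 <= 32 * k ^+ 2 * v ^+ 4 * h ^+ 2)%R by rewrite ler_wpM2l.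
have e2 : (0 <= k * v ^+ 2 * h ^+ 2)%R by rewrite mulr_ge0 ?sqr_ge0// mulr_ge0 ?sqr_ge0// ltW.
have e5 : (0 <= 32 * k ^+ 2 * v ^+ 4 * h ^+ 2)%R by rewrite mulr_ge0.
move: le1 le2; rewrite !exprMn => le1 le2; apply/andP; split; lra.
Qed.

End NoCommonWinner.

(** * Lower envelopes of affine functions *)

Section AffineEnvelope.
Context {R : realType} (A B : nat -> R).
Implicit Types (s t u : R) (i j k m n : nat).

Definition line i t : R := A i + B i * t.
Definition winner t i := forall k, line i t <= line k t.
Definition distinct t := forall i j, i != j -> line i t != line j t.
Definition epoch t := exists i j, [/\ i != j, line i t = line j t & winner t i].
(** This makes the infimum over infinitely many lines a minimum over finitely many. *)
Definition far_lines t := forall r, exists N, forall i, (N <= i)%N -> r < line i t.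

Lemma line_between i k s t u : s <= u -> u <= t -> s < t ->
  line i s < line k s -> line i t < line k t -> line i u < line k u.
Proof.
move=> su ut st; rewrite /line.
set a := A i; set b := B i; set a' := A k; set b' := B k => h1 h2.
have [->//|us] := eqVneq u s.
have p1 : 0 < u - s by rewrite subr_gt0 lt_neqAle eq_sym us.
have p2 : 0 <= t - u by rewrite subr_ge0.
have p3 : 0 < t - s by rewrite subr_gt0.
rewrite -(ltr_pM2r p3).
have q1 : 0 < (u - s) * (a' + b' * t - (a + b * t)) by rewrite mulr_gt0// subr_gt0.
have q2 : 0 <= (t - u) * (a' + b' * s - (a + b * s)) by rewrite mulr_ge0// subr_ge0 ltW.
nra.
Qed.

Lemma exists_winner t : far_lines t -> exists i, winner t i.
Proof.
move=> /(_ (line 0%N t))[N hN].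
pose i0 : 'I_N.+1 := ord0.
case: (arg_minP (fun i : 'I_N.+1 => line i t) (erefl (xpredT i0))) => i _ hi.
exists i => k; have [kN|Nk] := ltnP k N.+1; first exact: (hi (Ordinal kN)).
by apply: le_trans (hi i0 isT) (ltW (hN _ _)); exact: ltnW.
Qed.

Lemma winner_strict t i k : distinct t -> winner t i -> k != i -> line i t < line k t.
Proof. by move=> dt wi ki; rewrite lt_neqAle dt ?wi// eq_sym. Qed.

(** A strict winner at both ends is strictly below every other line in between, by affinity. Of the
    two lines tied at an epoch, at least one is not [i]. *)
Lemma common_winner_no_epoch i s t u : distinct s -> distinct t -> winner s i -> winner t i ->
  s < t -> s <= u -> u <= t -> ~ epoch u.
Proof.
move=> ds dt ws wt st su ut [p [q [pq pqu wp]]].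
have beat k : k != i -> line i u < line k u.
  by move=> ki; apply: (line_between su ut st); exact: winner_strict.
have [pi_|pi_] := eqVneq p i.
  by have := beat q; rewrite -pi_ eq_sym pq pqu ltxx => /(_ isT).
by have := beat p pi_; rewrite ltNge wp.
Qed.

Lemma exists_epoch s t : s < t -> distinct s -> distinct t -> far_lines s -> far_lines t ->
  ~ (exists i, winner s i /\ winner t i) -> exists u, [/\ s < u, u < t & epoch u].
Proof.
move=> st ds dt fs ft nc.
have [i wi] := exists_winner fs; have [j wj] := exists_winner ft.
have ji : j != i by apply/eqP => ji; apply: nc; exists i; split; rewrite // -ji.
have jt : line j t < line i t by apply: winner_strict => //; rewrite eq_sym.
(* Line [k] meets line [i] at [cross k]; the earliest such time, among the lines that
   are below line [i] at [t], is an epoch. *)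
pose gap k u := line k u - line i u.
pose cross k := s + (t - s) * (gap k s / (gap k s - gap k t)).
(* The lines below line [i] at time [t] have index less than [N], so the minimum is over a finite
   set, and [j] shows that it is nonempty. *)
have [N hN] := ft (line i t).
have jN : (j < N)%N by rewrite ltnNge; apply/negP => Nj; have := hN _ Nj; rewrite ltNge (ltW jt).
pose below_i := fun k : 'I_N => line k t < line i t.
case: (arg_minP (fun k : 'I_N => cross k) (jt : below_i (Ordinal jN))) => m mt hm.
rewrite /below_i in mt.
have gs k : k != i -> 0 < gap k s by move=> ki; rewrite subr_gt0 winner_strict.
have ne k : line k t < line i t -> k != i by move=> h; apply/eqP => ki; rewrite ki ltxx in h.
have gt_ k : line k t < line i t -> gap k t < 0 by rewrite subr_lt0.
have den k : line k t < line i t -> 0 < gap k s - gap k t.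
  by move=> h; have := gs k (ne k h); have := gt_ k h; lra.
have gapE k u : gap k u * (t - s) = gap k s * (t - u) + gap k t * (u - s).
  by rewrite /gap /line; ring.
have ts : 0 < t - s by rewrite subr_gt0.
set u := cross m.
have um : u - s = (t - s) * (gap m s / (gap m s - gap m t)) by rewrite /u /cross addrC addKr.
have dm := den m mt; have gm := gs m (ne m mt); have gmt := gt_ m mt.
have fr0 : 0 < gap m s / (gap m s - gap m t) by rewrite divr_gt0.
have fr1 : gap m s / (gap m s - gap m t) < 1 by rewrite ltr_pdivrMr// mul1r; lra.
have su : s < u by rewrite -subr_gt0 um mulr_gt0.
have ut : u < t by have : u - s < t - s; [rewrite um gtr_pMr|lra].
have gu0 : gap m u = 0.
  apply/eqP; rewrite -(mulIr_eq0 _ (mulIf (lt0r_neq0 ts))) gapE.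
  have -> : t - u = (t - s) - (u - s) by ring.
  rewrite um; apply/eqP; field; exact: lt0r_neq0.
exists u; split=> //; exists i, (m : nat); split.
- by rewrite eq_sym ne.
- by apply/esym/eqP; rewrite -subr_eq0; apply/eqP.
(* A line that is not below line [i] at [t] is above it throughout the interval; any other line
   meets line [i] no earlier than [u], by minimality. *)
move=> k; have [->//|ki] := eqVneq k i.
rewrite -subr_ge0 -[_ - _]/(gap k u) -(pmulr_lge0 _ ts) gapE.
have [kt|kt] := leP (line i t) (line k t).
  rewrite addr_ge0// mulr_ge0//; first exact: ltW (gs k ki).
  - by rewrite subr_ge0 ltW.
  - by rewrite subr_ge0.
  - by rewrite subr_ge0 ltW.
have kN : (k < N)%N by rewrite ltnNge; apply/negP => Nk; have := hN _ Nk; rewrite ltNge (ltW kt).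
have := hm (Ordinal kN) kt; rewrite -/u /cross/= -lerBlDl => uk.
have dk := den k kt.
have : (u - s) * (gap k s - gap k t) <= (t - s) * gap k s.
  by move: uk; rewrite mulrA ler_pdivlMr.
by rewrite -subr_ge0 => h; rewrite (_ : _ + _ = (t - s) * gap k s - (u - s) * (gap k s - gap k t))//; ring.
Qed.

End AffineEnvelope.

(** * Epochs and changes of winner at dyadic times *)

Section DyadicCount.
Context {R : realType} (A B : nat -> R).
Implicit Types (s t u : R) (i j k m n : nat).

Definition dyadic n k : R := k%:R / 2 ^+ n.

Definition winner_change n k :=
  ~ exists i, winner A B (dyadic n k) i /\ winner A B (dyadic n k.+1) i.

Definition change_indices n := [seq k <- iota 0 (2 ^ n) | `[< winner_change n k >]].

Lemma size_change_indices n :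
  (size (change_indices n))%:R = \sum_(k < 2 ^ n) (`[< winner_change n k >])%:R :> R.
Proof.
rewrite size_filter -sum1_count natr_sum big_mkcond -(big_mkord xpredT
  (fun k => (`[< winner_change n k >])%:R : R)) /index_iota subn0.
by apply: eq_bigr => k _; case: ifP.
Qed.

Hypothesis far01 : forall t, 0 <= t -> t <= 1 -> far_lines A B t.
Hypothesis distinct01 : forall n k, (k <= 2 ^ n)%N -> distinct A B (dyadic n k).

Let dy0 n k : 0 <= dyadic n k.
Proof. by rewrite divr_ge0// exprn_ge0. Qed.

Let dy1 n k : (k <= 2 ^ n)%N -> dyadic n k <= 1.
Proof. by move=> kn; rewrite ler_pdivrMr ?exprn_gt0// mul1r -natrX ler_nat. Qed.

Let dyS n k : dyadic n k < dyadic n k.+1.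
Proof. by rewrite ltr_pM2r ?invr_gt0 ?exprn_gt0// ltr_nat. Qed.

Let dy_le n k m : (k <= m)%N -> dyadic n k <= dyadic n m.
Proof. by move=> km; rewrite ler_pM2r ?invr_gt0 ?exprn_gt0// ler_nat. Qed.

(** Each change yields an epoch strictly inside its dyadic interval, and these open intervals are
    disjoint, so the epochs are distinct. *)
Lemma epochs_of_changes n : exists s : seq R, [/\ uniq s, size s = size (change_indices n) &
  forall u, u \in s -> [/\ 0 <= u, u <= 1 & epoch A B u]].
Proof.
have H k : exists u, k \in change_indices n ->
    [/\ dyadic n k < u, u < dyadic n k.+1 & epoch A B u].
  have [|] := boolP (k \in change_indices n); last by exists 0.
  rewrite mem_filter mem_iota add0n leq0n/= => /andP[/asboolP ch kn].
  have [u hu] := exists_epoch (dyS n k) (distinct01 (ltnW kn)) (distinct01 kn)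
    (far01 (dy0 n k) (dy1 (ltnW kn))) (far01 (dy0 n k.+1) (dy1 kn)) ch.
  by exists u.
have [e he] := choice H.
exists (map e (change_indices n)); split.
- rewrite map_inj_in_uniq ?filter_uniq ?iota_uniq// => k m hk hm ekm.
  have [k1 k2 _] := he k hk; have [m1 m2 _] := he m hm; rewrite ekm in k1 k2.
  case: (ltngtP k m) => // lt.
    by have := lt_le_trans k2 (le_trans (dy_le n lt) (ltW m1)); rewrite ltxx.
  by have := lt_le_trans m2 (le_trans (dy_le n lt) (ltW k1)); rewrite ltxx.
- by rewrite size_map.
- move=> _ /mapP[k hk ->]; have [k1 k2 ek] := he k hk; split=> //.
    exact: le_trans (ltW k1).
  apply: le_trans (ltW k2) (dy1 _).
  by move: hk; rewrite mem_filter mem_iota add0n => /andP[_ /andP[]].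
Qed.

Let epoch_ndyadic n k u : (k <= 2 ^ n)%N -> epoch A B u -> u != dyadic n k.
Proof.
move=> kn [i [j [ij eij _]]]; apply/eqP => uk; rewrite uk in eij.
by have := distinct01 kn ij; rewrite eij eqxx.
Qed.

Let epoch_change n u : 0 <= u -> u <= 1 -> epoch A B u ->
  dyadic_index n u \in change_indices n.
Proof.
move=> u0 u1 eu.
(* The time 1 is dyadic of level 0, hence without ties; excluding it keeps the index below [2^n]. *)
have u1' : u < 1.
  rewrite lt_neqAle u1 andbT; apply: contraT => /negPn/eqP e1.
  have := epoch_ndyadic (leqnn (2 ^ 0)) eu.
  by rewrite /dyadic e1 expn0 expr0 divr1 eqxx.
have ku : dyadic n (dyadic_index n u) <= u by exact: dyadic_floor_le.
have uk : u <= dyadic n (dyadic_index n u).+1.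
  have := dyadic_floor_gt n u0; rewrite ltrBlDr => /ltW.
  by rewrite /dyadic_floor /dyadic -[(dyadic_index n u).+1%:R]natr1 mulrDl mul1r.
have kn : (dyadic_index n u < 2 ^ n)%N.
  have := le_lt_trans ku u1'; rewrite ltr_pdivrMr ?exprn_gt0// mul1r.
  by rewrite -natrX ltr_nat.
rewrite mem_filter mem_iota add0n leq0n kn !andbT; apply/asboolP => -[i [w1 w2]].
by apply: (common_winner_no_epoch _ _ w1 w2 (dyS n _) ku uk eu);
  [exact/distinct01/ltnW|exact: distinct01].
Qed.

(** Finitely many epochs eventually lie in different dyadic intervals, and each such interval has a
    change of winner. Finite subsets are used because the set of all epochs is not known to be
    finite. *)
Lemma changes_of_epochs (s : seq R) : uniq s ->
  (forall u, u \in s -> [/\ 0 <= u, u <= 1 & epoch A B u]) ->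
  \forall n \near \oo, (size s <= size (change_indices n))%N.
Proof.
move=> us hs.
have sep (p : seq_sub s * seq_sub s) : \forall n \near \oo,
    dyadic_index n (ssval p.1) = dyadic_index n (ssval p.2) -> ssval p.1 = ssval p.2.
  have [u0 _ _] := hs _ (ssvalP p.1); have [w0 _ _] := hs _ (ssvalP p.2).
  have main (x y : R) : 0 <= x -> 0 <= y -> x < y -> \forall n \near \oo,
      dyadic_index n x <> dyadic_index n y.
    move=> x0 y0 /(dyadic_floor_near y0)[N hN]; exists N => // n /= Nn exy.
    have := lt_le_trans hN (dyadic_floor_homo y0 Nn).
    by rewrite /dyadic_floor -exy ltNge => /negP; apply; exact: dyadic_floor_le.
  case: (ltgtP (ssval p.1) (ssval p.2)) => lt; last by apply: nearW.
    by apply: filterS (main _ _ u0 w0 lt).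
  by apply: filterS (main _ _ w0 u0 lt) => n h /esym.
apply: filterS (filter_forall _ sep) => n hn.
rewrite -(size_map (dyadic_index n)); apply: uniq_leq_size.
  rewrite map_inj_in_uniq// => x y xs ys exy.
  exact: (hn (SeqSub xs, SeqSub ys)).
by move=> _ /mapP[u us' ->]; have [u0 u1 eu] := hs u us'; exact: epoch_change.
Qed.

End DyadicCount.

(** * Counting handovers *)

Import HBNNSimple.

Section Counting.
Local Open Scope ereal_scope.

Lemma sum_seq1 (R : realType) (T : Type) (s : seq T) :
  \sum_(x <- s) (1 : \bar R) = ((size s)%:R)%:E.
Proof.
elim: s => [|x s IH]; first by rewrite big_nil.
by rewrite big_cons IH /= -(natr1 (size s)) addrC EFinD.
Qed.

Lemma size_le_esum1 (R : realType) (T : choiceType) (S : set T) (s : seq T) :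
  uniq s -> (forall x, x \in s -> S x) -> ((size s)%:R)%:E <= \esum_(x in S) (1 : \bar R).
Proof.
move=> us sS; apply: esum_ge; exists [set` s]; last by rewrite -fsbig_seq// sum_seq1.
by split => //; exact: finite_seq.
Qed.

Lemma esum1_le (R : realType) (T : choiceType) (S : set T) (x : \bar R) :
  (forall s : seq T, uniq s -> (forall y, y \in s -> S y) -> ((size s)%:R)%:E <= x) ->
  \esum_(y in S) (1 : \bar R) <= x.
Proof.
move=> H; apply: ge_ereal_sup => _ [A [/finite_seqP[s As] AS] <-].
have -> : A = [set` undup s].
  by rewrite As; apply/seteqP; split=> y /=; rewrite mem_undup.
rewrite -fsbig_seq ?undup_uniq// sum_seq1; apply: H; first exact: undup_uniq.
by move=> y; rewrite mem_undup => ys; apply: AS; rewrite As.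
Qed.

Lemma limn_einf_ge (R : realType) (u : (\bar R)^nat) (x : \bar R) :
  (\forall n \near \oo, x <= u n) -> x <= limn_einf u.
Proof.
move=> [N _ hN]; rewrite limn_einf_lim; apply: lime_ge; first exact: is_cvg_einfs.
exists N => // n /= Nn; apply: le_ereal_inf_tmp => _ [k /= nk <-].
by apply: hN => /=; exact: leq_trans nk.
Qed.

Lemma measurable_fun_limn_einf d (T : measurableType d) (R : realType) (f : (T -> \bar R)^nat) :
  (forall n, measurable_fun [set: T] (f n)) ->
  measurable_fun [set: T] (fun x => limn_einf (f ^~ x)).
Proof.
move=> mf; rewrite (_ : (fun x => _) = (fun x => - limn_esup (-%E \o f ^~ x))); last first.
  by apply/funext => x; rewrite limn_esupN oppeK.
have mN n : measurable_fun [set: T] (-%E \o f n).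
  by apply: measurableT_comp => //; exact: mf.
have mE := measurable_fun_limn_esup mN.
by apply: (measurableT_comp (g := fun x => limn_esup (-%E \o f ^~ x))) => //; exact: mE.
Qed.

(* [ae_eq_integral] would require [f] to be measurable. *)
Lemma ge0_integral_eq_off_null d (T : measurableType d) (R : realType)
    (P : {measure set T -> \bar R}) (f g : T -> \bar R) (N : set T) :
  (forall x, 0 <= f x) -> (forall x, 0 <= g x) -> measurable_fun [set: T] g ->
  measurable N -> P N = 0 -> (forall x, ~ N x -> f x = g x) ->
  \int[P]_x f x = \int[P]_x g x.
Proof.
move=> f0 g0 mg mN PN fg.
have negN : P.-negligible N by exists N; split.
rewrite (ge0_integralTE P f0); apply/eqP; rewrite eq_le; apply/andP; split.
  apply: ge_ereal_sup => _ [h /= hf <-]; rewrite -integralT_nnsfun.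
  apply: ae_ge0_le_integral => //.
  - by move=> x _; rewrite lee_fin fun_ge0.
  - by apply/measurable_EFinP; exact: measurable_funPT.
  - apply: negligibleS negN => x /= nx; apply: contrapT => Nx.
    by apply: nx => _; rewrite -fg.
(* For the other inequality [g] is set to 0 on [N], which puts it below [f] everywhere. *)
have mg' : measurable_fun [set: T] (g \_ (~` N)).
  apply/(measurable_restrictT _ _).1; first exact: measurableC.
  exact: measurable_funTS.
have g'0 x : 0 <= (g \_ (~` N)) x by apply: erestrict_ge0.
rewrite (_ : \int[P]_x g x = \int[P]_x (g \_ (~` N)) x); last first.
  rewrite (ge0_negligible_integral mN measurableT mg)//.
  by rewrite setTD -integral_mkcond.
rewrite (ge0_integralTE P g'0); apply: ereal_sup_le => _ [h /= hg <-].
exists h => // x; apply: le_trans (hg x) _; rewrite /restrict/=.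
by case: ifPn => [/set_mem Nx|_]; [rewrite fg|exact: f0].
Qed.

End Counting.

Section Handovers.
Context d (T : measurableType d) (R : realType) (P : probability T R).
Context (X : nat -> T -> R * R) (Th : nat -> T -> R) (lam v : R).
Hypotheses (lam0 : 0 < lam) (v0 : 0 < v).
Hypothesis hX : is_homogeneous_PPP P X lam.
Hypothesis hTh : iid_uniform_marks_indep P X Th.

Let A o i : R := nsq (X i o).
Let B o i : R := 2 * v * ((X i o).1 * cos (Th i o) + (X i o).2 * sin (Th i o)).

Let lineE o i t : sqdist v t (marked X Th i o) = line (A o) (B o) i t + (v * t) ^+ 2.
Proof.
have E : cos (Th i o) ^+ 2 = 1 - sin (Th i o) ^+ 2 by exact: cos2sin2.
rewrite /sqdist /marked /line /A /B /nsq/=; ring: E.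
Qed.

Let handover_epochE o t : handover_epoch X Th v o t <-> epoch (A o) (B o) t.
Proof.
have dE i : enorm2 (station X Th v i o t) = Num.sqrt (line (A o) (B o) i t + (v * t) ^+ 2).
  by rewrite -lineE.
have d0 i : 0 <= line (A o) (B o) i t + (v * t) ^+ 2 by rewrite -lineE sqdist_ge0.
split=> -[i [j]].
  move=> [ij [eij wi]]; exists i, j; split=> //.
    by move/eqP: eij; rewrite !dE eqr_sqrt// => /eqP/addIr.
  by move=> k; have := wi k; rewrite !dE ler_sqrt// lerD2r.
move=> [ij eij wi]; exists i, j; split=> //; split; first by rewrite !dE eij.
by move=> k; rewrite !dE ler_sqrt// lerD2r wi.
Qed.

Let bad : set T := ~` loc_finite X `|`
  \bigcup_n \bigcup_k ties X Th v (dyadic (R := R) n k).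

Let mbad : measurable bad.
Proof.
apply: measurableU; first by apply: measurableC; exact: (measurable_loc_finite hX).
by do 2!apply: bigcupT_measurable => ?; exact: (measurable_ties v hX hTh).
Qed.

Let Pbad : P bad = 0%E.
Proof.
apply: measure_negligible => //; apply: negligibleU.
  exists (~` loc_finite X); split=> //; last exact: (loc_finite_ae lam0 hX).
  by apply: measurableC; exact: (measurable_loc_finite hX).
apply: negligible_bigcup => n; apply: negligible_bigcup => k.
exists (ties X Th v (dyadic n k)); split=> //; last exact: (ties_ae v lam0 hX hTh).
exact: (measurable_ties v hX hTh).
Qed.

Let changes n o := change_indices (A o) (B o) n.

Let far01 o : ~ bad o -> forall t, 0 <= t -> t <= 1 -> far_lines (A o) (B o) t.
Proof.
move=> nb t t0 t1 r.
have lf : loc_finite X o by apply: contrapT => h; apply: nb; left.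
have [N hN] := loc_finite_dist Th v (r + (v * t) ^+ 2) 1 lf; exists N => i Ni.
by have := hN i t Ni; rewrite ger0_norm// lineE ltrD2r; exact.
Qed.

Let distinct01 o : ~ bad o -> forall n k, (k <= 2 ^ n)%N -> distinct (A o) (B o) (dyadic n k).
Proof.
move=> nb n k _ i j ij; apply/eqP => e; apply: nb; right; exists n => //; exists k => //.
by exists i, j; split=> //; rewrite !lineE e.
Qed.

(** Every finite set of epochs is eventually matched by as many changes, and the number of changes
    at any level is at most the number of epochs. The lower limit makes sense, and is measurable,
    before convergence is known. *)
Let handover_countE o : ~ bad o ->
  handover_count X Th v o = limn_einf (fun n => ((size (changes n o))%:R)%:E).
Proof.
move=> nb; apply/eqP; rewrite eq_le; apply/andP; split.
  apply: esum1_le => s us hs; apply: limn_einf_ge.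
  have := @changes_of_epochs _ (A o) (B o) (distinct01 nb) s us.
  case=> [u us'|N _ hN].
    by have [/andP[u0 u1] /handover_epochE] := hs u us'.
  by exists N => // n /= Nn; rewrite lee_fin ler_nat; exact: hN.
rewrite limn_einf_lim; apply: lime_le; first exact: is_cvg_einfs.
apply: nearW => n; apply: (@le_trans _ _ ((size (changes n o))%:R)%:E).
  by apply: ereal_inf_lbound; exists n => /=.
have [s [us <- hs]] := epochs_of_changes (far01 nb) (distinct01 nb) n.
apply: size_le_esum1 => // u us'; have [u0 u1 eu] := hs u us'; split; first by rewrite u0.
exact/handover_epochE.
Qed.

Let changesE n o : ((size (changes n o))%:R : R) = \sum_(k < 2 ^ n)
  \1_(no_common_winner X Th v (dyadic n k) (2 ^- n)) o.
Proof.
rewrite size_change_indices; apply: eq_bigr => k _; rewrite indicE.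
have -> // : `[< winner_change (A o) (B o) n k >] =
    (o \in no_common_winner X Th v (dyadic n k) (2 ^- n)).
have dS : dyadic n k.+1 = dyadic n k + 2 ^- n :> R.
  by rewrite /dyadic -[k.+1%:R]natr1 mulrDl mul1r.
apply/asboolP/idP.
  move=> h; apply/mem_set => -[i hi]; apply: h; exists i; rewrite dS.
  by split=> j; have [h1 h2] := hi j; move: h1 h2; rewrite !lineE !lerD2r.
move=> /set_mem h [i [h1 h2]]; apply: h; exists i => j; rewrite !lineE !lerD2r -dS.
by split; [exact: h1|exact: h2].
Qed.

Let rate := 4 * v * Num.sqrt lam / pi.

Let m1 n k : measurable_fun [set: T]
  (fun o => (\1_(no_common_winner X Th v (dyadic n k) (2 ^- n)) o)%:E : \bar R).
Proof. by apply: measurable_indicE; exact: (measurable_no_common_winner v hX hTh). Qed.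

Let mchanges n : measurable_fun [set: T] (fun o => ((size (changes n o))%:R : R)%:E).
Proof.
rewrite (_ : (fun o => _) = (fun o => \sum_(k < 2 ^ n)
  (\1_(no_common_winner X Th v (dyadic n k) (2 ^- n)) o)%:E)%E); last first.
  by apply/funext => o; rewrite changesE sumEFin.
by apply: emeasurable_sum => k; exact: m1.
Qed.

(** There are [2^n] terms, each equal to [rate] times [2^-n] up to [C 4^-n], so the total error is
    at most [C 2^-n]. *)
Let int_changes : (\int[P]_o ((size (changes n o))%:R)%:E)%E @[n --> \oo] --> rate%:E.
Proof.
have [C hC] := no_common_winner_bounds lam0 v0 hX hTh.
have E n : (\int[P]_o ((size (changes n o))%:R)%:E =
    \sum_(k < 2 ^ n) P (no_common_winner X Th v (dyadic n k) (2 ^- n)))%E.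
  under eq_integral do rewrite changesE -sumEFin.
  rewrite ge0_integral_sum//.
  apply: eq_bigr => k _.
  by rewrite (integral_indic _ measurableT (measurable_no_common_winner v hX hTh _ _)) setIT.
have e0 n : 0 < 2 ^- n :> R by rewrite invr_gt0 exprn_gt0.
have e1 n : 2 ^- n <= 1 :> R by rewrite invf_le1 ?exprn_gt0// exprn_ege1// ler1n.
have S n (x : R) : (\sum_(k < 2 ^ n) x%:E = (2 ^+ n * x)%:E)%E.
  by rewrite sumEFin sumr_const card_ord -(mulr_natl x) natrX.
have m2 n (s : R) : 2 ^+ n * (2 ^- n * rate + s * (2 ^- n) ^+ 2) = rate + s * 2 ^- n :> R.
  by field; rewrite expf_neq0.
apply: (squeeze_cvge (f := fun n => (rate - C * 2 ^- n)%:E) (h := fun n => (rate + C * 2 ^- n)%:E)).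
- apply: nearW => n; rewrite E -mulNr -!m2 -!S mulNr; apply/andP; split;
    apply: lee_sum => k _; by have /andP[] := hC (dyadic n k) _ (ltW (e0 n)) (e1 n).
- apply: cvg_EFin; first exact: nearW.
  rewrite -[X in _ --> X]subr0 -[X in _ - X](mulr0 C).
  apply: cvgB; first exact: cvg_cst.
  by apply: cvgM; [exact: cvg_cst|exact: cvg_dyadic_step].
- apply: cvg_EFin; first exact: nearW.
  rewrite -[X in _ --> X]addr0 -[X in _ + X](mulr0 C).
  apply: cvgD; first exact: cvg_cst.
  by apply: cvgM; [exact: cvg_cst|exact: cvg_dyadic_step].
Qed.

(** Fatou gives the upper bound through the lower limit. The lower bound holds because, off the null
    set, the number of changes at each level is at most the number of handovers. *)
Lemma integral_handover_count :
  (\int[P]_o handover_count X Th v o = (4 * v * Num.sqrt lam / pi)%:E)%E.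
Proof.
have L0 o : (0 <= limn_einf (fun n => ((size (changes n o))%:R : R)%:E))%E.
  by apply: limn_einf_ge; apply: nearW => n; rewrite lee_fin.
have mL := measurable_fun_limn_einf mchanges.
rewrite (ge0_integral_eq_off_null _ L0 mL mbad Pbad handover_countE); last first.
  by move=> o; exact: esum_ge0.
apply/eqP; rewrite eq_le; apply/andP; split.
  rewrite -(cvg_limn_einf_sup int_changes).1.
  by apply: fatou => // n o _; rewrite lee_fin.
rewrite -(cvg_lim _ int_changes)//; apply: lime_le; first exact: cvgP int_changes.
apply: nearW => n; apply: ae_ge0_le_integral => //.
have negB : P.-negligible bad by exists bad; split.
apply: negligibleS negB => o /= no; apply: contrapT => nb; apply: no => _; rewrite -handover_countE//.
have [s [us <- hs]] := epochs_of_changes (far01 nb) (distinct01 nb) n.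
apply: size_le_esum1 => // u us'; have [u0 u1 eu] := hs u us'; split; first by rewrite u0.
exact/handover_epochE.
Qed.

End Handovers.

Theorem theorem4p26 (R : realType) (d : measure_display) (T : measurableType d)
    (P : probability T R) (lam v : R) (X : nat -> T -> R * R) (Th : nat -> T -> R) :
  0 < lam -> 0 < v ->
  is_homogeneous_PPP P X lam ->
  iid_uniform_marks_indep P X Th ->
  (\int[P]_w handover_count X Th v w = (4 * v * Num.sqrt lam / pi)%:E)%E.
Proof. by move=> lam0 v0; exact: integral_handover_count. Qed.
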